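(* Let $E$ be a Hilbert $C^*$-module over a $C^*$-algebra $\mathcal{A}$. 1. For a closed semiregular operator $T$ in $E$ the following statements are equivalent: (1) $T$ is regular. (2) For every representation $(\pi,H_\pi)$ of $\mathcal{A}$ the localizations $T^\pi$ and $(T^* )^\pi$ are adjoints of each other, i.e. $(T^* )^\pi=(T^\pi)^*$. (3) For every state $\omega$ on $\mathcal{A}$ the localizations $T^\omega$ and $(T^* )^\omega$ are adjoints of each other, i.e. $(T^* )^\omega=(T^\omega)^*$. 2. For a closed, densely defined and symmetric operator $T$ in $E$ the following statements are equivalent: (1) $T$ is selfadjoint and regular. (2) For every representation $(\pi,H_\pi)$ of $\mathcal{A}$ the localization $T^\pi$ is selfadjoint. (3) For every state $\omega$ on $\mathcal{A}$ the localization $T^\omega$ is selfadjoint.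
   Context: $C^*$-algebras are not assumed unital. A Hilbert $C^*$-module $E$ over $\mathcal{A}$ is a right $\mathcal{A}$-module with an $\mathcal{A}$-valued inner product $\langle\cdot,\cdot\rangle$ (conjugate linear in the first, linear in the second variable), complete in the norm $\|x\|=\|\langle x,x\rangle\|^{1/2}$. A semiregular operator in $E$ is an operator $T:\mathrm{dom}(T)\to E$ defined on a dense $\mathcal{A}$-submodule $\mathrm{dom}(T)\subset E$ whose adjoint $T^*$ is densely defined; here $y\in\mathrm{dom}(T^* )$ iff there is $z=T^*y\in E$ with $\langle Tx,y\rangle=\langle x,z\rangle$ for all $x\in\mathrm{dom}(T)$. Such a $T$ is automatically $\mathcal{A}$-linear and closable. A closed semiregular operator $T$ is called regular if $I+T^*T$ has dense range (it is then invertible). A densely defined operator $T$ (domain a dense $\mathcal{A}$-submodule) is symmetric if $T\subset T^*$ and selfadjoint if $T=T^*$; symmetric operators are semiregular. For a representation $\pi$ of $\mathcal{A}$ on a Hilbert space $H_\pi$, $E\hat\otimes_{\mathcal{A}}H_\pi$ denotes the interior tensor product: the Hilbert space completion of the algebraic tensor product $E\otimes_{\mathcal{A}}H_\pi$ for $\langle x\otimes h,x'\otimes h'\rangle=\langle h,\pi(\langle x,x'\rangle)h'\rangle$. For a semiregular $T$, the localization $T^\pi$ is the closure of the (well-defined, densely defined, closable) operator $T_0^\pi$ in $E\hat\otimes_{\mathcal{A}}H_\pi$ with domain $\mathrm{dom}(T)\otimes_{\mathcal{A}}H_\pi$ and $T_0^\pi(x\otimes h)=(Tx)\otimes h$. For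 a state $\omega$ on $\mathcal{A}$, put $\langle x,y\rangle_\omega=\omega(\langle x,y\rangle)$ on $E$ and $\mathcal{N}_\omega=\{x\in E:\langle x,x\rangle_\omega=0\}$; $E^\omega$ is the Hilbert space completion of $E/\mathcal{N}_\omega$ and $\iota_\omega:E\to E^\omega$ is the natural map. The localization $T^\omega$ is the closure of the operator $T^\omega_0$ in $E^\omega$ with $\mathrm{dom}(T_0^\omega)=\iota_\omega(\mathrm{dom}(T))$ and $T^\omega_0\iota_\omega(x)=\iota_\omega(Tx)$. (If $(\pi_\omega,H_\omega,\xi_\omega)$ is the GNS representation of $\omega$, then $\iota_\omega(x)\mapsto x\otimes\xi_\omega$ identifies $E^\omega$ with $E\hat\otimes_{\mathcal{A}}H_\omega$ and $T^\omega$ with $T^{\pi_\omega}$.) *)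

(* Defs.v *)
From HB Require Import structures.
From mathcomp Require Import all_boot all_order all_algebra.
From mathcomp Require Import complex.
From mathcomp Require Import all_classical all_reals all_analysis.

Set Implicit Arguments.
Unset Strict Implicit.
Unset Printing Implicit Defensive.

Import Order.TTheory GRing.Theory Num.Theory.
Import numFieldNormedType.Exports.

Local Open Scope classical_set_scope.
Local Open Scope complex_scope.
Local Open Scope ring_scope.

(* The scalars are R[i] for a realType R; norms take values in R[i] and are
   real and nonnegative there. *)

(* C*-algebras, not assumed unital: hence not based on the (unital) rings of
   the algebraic hierarchy. *)
HB.mixin Record CompleteNormedModule_isCStarAlgebra (R : realType) A
    of CompleteNormedModule R[i] A := {
  amul : A -> A -> A ;
  star : A -> A ;
  amulA : forall a b c, amul a (amul b c) = amul (amul a b) c ;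
  amul_linearl : forall b (k : R[i]) a a',
    amul (k *: a + a') b = k *: amul a b + amul a' b ;
  amul_linearr : forall a (k : R[i]) b b',
    amul a (k *: b + b') = k *: amul a b + amul a b' ;
  normr_amul : forall a b, `|amul a b| <= `|a| * `|b| ;
  starK : forall a, star (star a) = a ;
  star_semilinear : forall (k : R[i]) a b,
    star (k *: a + b) = k^* *: star a + star b ;
  star_amul : forall a b, star (amul a b) = amul (star b) (star a) ;
  cstar_identity : forall a, `|amul (star a) a| = `|a| ^+ 2
}.

#[short(type="cstarAlgType")]
HB.structure Definition CStarAlgebra (R : realType) :=
  {A of CompleteNormedModule_isCStarAlgebra R A & CompleteNormedModule R[i] A}.

Definition apositive (R : realType) (A : cstarAlgType R) (a : A) : Prop :=
  exists b : A, a = amul (star b) b.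

(* Definiteness of the inner product is part of normr_mip, which also makes the
   completeness of E the completeness in the norm of the inner product. *)
HB.mixin Record CompleteNormedModule_isHilbertModule (R : realType)
    (A : cstarAlgType R) E of CompleteNormedModule R[i] E := {
  ract : E -> A -> E ;
  mip : E -> E -> A ;
  ractA : forall x a b, ract (ract x a) b = ract x (amul a b) ;
  ract_linearl : forall a (k : R[i]) x y,
    ract (k *: x + y) a = k *: ract x a + ract y a ;
  ract_linearr : forall x (k : R[i]) a b,
    ract x (k *: a + b) = k *: ract x a + ract x b ;
  mip_linearr : forall x (k : R[i]) y z,
    mip x (k *: y + z) = k *: mip x y + mip x z ;
  mip_ract : forall x y a, mip x (ract y a) = amul (mip x y) a ;
  mip_star : forall x y, mip y x = star (mip x y) ;
  mip_positive : forall x, apositive (mip x x) ;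
  normr_mip : forall x, `|x| = sqrtC `|mip x x|
}.

#[short(type="hilbertModType")]
HB.structure Definition HilbertModule (R : realType) (A : cstarAlgType R) :=
  {E of CompleteNormedModule_isHilbertModule R A E
      & CompleteNormedModule R[i] E}.

HB.mixin Record CompleteNormedModule_isHilbert (R : realType) H
    of CompleteNormedModule R[i] H := {
  inner : H -> H -> R[i] ;
  inner_linearr : forall x (k : R[i]) y z,
    inner x (k *: y + z) = k * inner x y + inner x z ;
  inner_conj : forall x y, inner y x = (inner x y)^* ;
  inner_ge0 : forall x, 0 <= inner x x ;
  normr_inner : forall x, `|x| = sqrtC (inner x x)
}.

#[short(type="hilbertType")]
HB.structure Definition Hilbert (R : realType) :=
  {H of CompleteNormedModule_isHilbert R H & CompleteNormedModule R[i] H}.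

(* Unbounded operators in V are identified with their graphs, sets of pairs
   (x, T x); equality and inclusion of operators are those of graphs. *)
Definition is_operator (V : Type) (T : set (V * V)) : Prop :=
  forall x y y', T (x, y) -> T (x, y') -> y = y'.

Definition dom (V : Type) (T : set (V * V)) : set V :=
  [set x | exists y, T (x, y)].

Definition adjoint (V W : Type) (ip : V -> V -> W) (T : set (V * V)) :
    set (V * V) :=
  [set yz | forall x w, T (x, w) -> ip w yz.1 = ip x yz.2].

Section HilbertModuleOperators.
Context (R : realType) (A : cstarAlgType R) (E : hilbertModType A).
Implicit Types (T : set (E * E)) (D : set E).

Definition submodule D : Prop :=
  [/\ D 0,
      forall (k : R[i]) x y, D x -> D y -> D (k *: x + y) &
      forall x (a : A), D x -> D (ract x a)].

Definition madjoint T : set (E * E) := adjoint (@mip R A E) T.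

Definition densely_defined T : Prop :=
  [/\ is_operator T, submodule (dom T) & dense (dom T)].

Definition semiregular T : Prop :=
  densely_defined T /\ dense (dom (madjoint T)).

Definition msymmetric T : Prop := T `<=` madjoint T.

Definition mselfadjoint T : Prop := T = madjoint T.

Definition range_1_adjoint_mul T : set E :=
  [set u | exists x y z, [/\ T (x, y), madjoint T (y, z) & u = x + z]].

Definition regular T : Prop :=
  [/\ semiregular T, closed T & dense (range_1_adjoint_mul T)].

End HilbertModuleOperators.

Section HilbertSpaceOperators.
Context (R : realType) (H : hilbertType R).

Definition hadjoint (T : set (H * H)) : set (H * H) := adjoint (@inner R H) T.

Definition hselfadjoint (T : set (H * H)) : Prop := T = hadjoint T.

End HilbertSpaceOperators.

(* Representations are *-homomorphisms into the bounded operators, not assumed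
   nondegenerate. *)
Record representation (R : realType) (A : cstarAlgType R) (H : hilbertType R) :=
  Representation {
  rep :> A -> {linear H -> H} ;
  rep_continuous : forall a, continuous (rep a) ;
  rep_linear : forall (k : R[i]) a b h,
    rep (k *: a + b) h = k *: rep a h + rep b h ;
  rep_amul : forall a b h, rep (amul a b) h = rep a (rep b h) ;
  rep_star : forall a h h', inner (rep (star a) h) h' = inner h (rep a h')
}.

Record state (R : realType) (A : cstarAlgType R) := State {
  state_fun :> {linear A -> R[i]^o} ;
  state_positive : forall a, 0 <= (state_fun (amul (star a) a) : R[i]) ;
  state_norm1 :
    sup [set complex.Re `|state_fun a : R[i]| | a in [set a | `|a| <= 1]] = 1
}.

Definition finite_sums (V : nmodType) (S : set V) : set V :=
  [set v | exists n (s : 'I_n -> V), (forall i, S (s i)) /\ v = \sum_i s i].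

Section InteriorTensorProduct.
Context (R : realType) (A : cstarAlgType R) (E : hilbertModType A).
Context (H : hilbertType R) (pi : representation A H).

(* The completion of the algebraic tensor product over A, given by the Hilbert
   space together with the A-balanced bilinear map (x, h) |-> x (x) h into it;
   it is determined up to a unique unitary compatible with these maps.  The
   finite sums of elementary tensors form the image of the algebraic tensor
   product. *)
Record interior_tensor := InteriorTensor {
  it_space : hilbertType R ;
  tens : E -> H -> it_space ;
  tens_linearl : forall h (k : R[i]) x y,
    tens (k *: x + y) h = k *: tens x h + tens y h ;
  tens_linearr : forall x (k : R[i]) h h',
    tens x (k *: h + h') = k *: tens x h + tens x h' ;
  tens_balanced : forall x (a : A) h, tens (ract x a) h = tens x (pi a h) ;
  tens_inner : forall x h x' h',
    inner (tens x h) (tens x' h') = inner h (pi (mip x x') h') ;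
  tens_dense :
    dense (finite_sums [set tens x h | x in setT & h in setT] : set it_space)
}.

Context (K : interior_tensor).

Definition rep_localization0 (T : set (E * E)) :
    set (it_space K * it_space K) :=
  finite_sums [set (tens K xy.1 h, tens K xy.2 h) | xy in T & h in setT].

Definition rep_localization (T : set (E * E)) :
    set (it_space K * it_space K) :=
  closure (rep_localization0 T).

End InteriorTensorProduct.

Arguments rep_localization0 {R A E H pi} K T _.
Arguments rep_localization {R A E H pi} K T _.

Section StateLocalization.
Context (R : realType) (A : cstarAlgType R) (E : hilbertModType A).
Context (omega : state A).

(* The completion of E / N_omega, given by the Hilbert space together with the
   natural map of E into it, whose kernel is N_omega by iota_inner. *)
Record state_space := StateSpace {
  st_space : hilbertType R ;
  iota_st : {linear E -> st_space} ;
  iota_inner : forall x y, inner (iota_st x) (iota_st y) = omega (mip x y) ;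
  iota_dense : dense (range iota_st)
}.

Context (K : state_space).

Definition state_localization0 (T : set (E * E)) :
    set (st_space K * st_space K) :=
  [set (iota_st K xy.1, iota_st K xy.2) | xy in T].

Definition state_localization (T : set (E * E)) :
    set (st_space K * st_space K) :=
  closure (state_localization0 T).

End StateLocalization.

Arguments state_localization0 {R A E omega} K T _.
Arguments state_localization {R A E omega} K T _.

(* Main.v *)
Require Import Defs.
From HB Require Import structures.
From mathcomp Require Import all_boot all_order all_algebra.
From mathcomp Require Import complex.
From mathcomp Require Import all_classical all_reals all_analysis.
From mathcomp Require Import ring lra.

(* A closed semiregular [T] is regular iff the graph of [T] and the rotated
   graph of [T*] span a dense submodule of [E + E]; this density passes to all
   localizations, where it makes [T*] localize to the adjoint.  Conversely, if
   the span misses a ball around a point [u] of [E + E], then some positive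
   functional [om] of [A] satisfies [om <u - l, u - l> >= d > 0] for all [l] in
   the span, so that the span is not dense in the localization at [om], which
   contradicts the orthogonal decomposition given by the adjoint there.  The
   functional comes from the Hahn-Banach theorem, applied to the cone generated
   by the positive elements [lam + x - S <u - l, u - l>] of the unitization; it
   extends to the unitization, hence its GNS representation has a cyclic vector
   and no approximate units are needed.

   The order of [A] is that of the operators [f] on [A] with
   [|t - f| <= t] for some [t]; its properties, including the positivity of
   [b* b], follow from square roots of [1 - s] for [|s| < 1], without spectral
   theory. *)

Set Implicit Arguments.
Unset Strict Implicit.
Unset Printing Implicit Defensive.

Import Order.TTheory GRing.Theory Num.Theory.
Import numFieldNormedType.Exports.

Local Open Scope classical_set_scope.
Local Open Scope complex_scope.
Local Open Scope ring_scope.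

(** A closed submodule of a Hilbert module need not be complemented, even when nothing is orthogonal
    to it. Hence no A-valued projection can test the density of the span, and scalar functionals
    have to do it. The function [l |-> <u - l, u - l>] is quadratic and A-valued, but it is convex
    for the order of A; this is what lets one linear functional on A bound it from below over the
    whole span. Density of the span amounts to regularity because the two graphs are orthogonal:
    their sum is then closed, and a decomposition of [(u, 0)] reads [u = x + T* T x]. The
    contradiction in a localization is the projection theorem, which is available there and not in
    E. For symmetric [T], a selfadjoint localization forces those of [T] and [T*] to coincide.
    Regularity then follows as in the first equivalence, and a point of [T*] outside the closed
    graph of [T] is excluded by the same separation, with the graph of [T] in place of the span. *)

Section LinearCombinations.
Context (K : comPzRingType) (V : lmodType K).

(** Reified linear combinations: comparing coefficients atom by atom turns a module identity into
    scalar identities, which [ring] can settle. *)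
Inductive lexp :=
  | LAtom of nat | LZero | LAdd of lexp & lexp | LOpp of lexp
  | LScale of K & lexp.

Fixpoint leval (env : seq V) (e : lexp) : V :=
  match e with
  | LAtom i => nth 0 env i
  | LZero => 0
  | LAdd e1 e2 => leval env e1 + leval env e2
  | LOpp e1 => - leval env e1
  | LScale k e1 => k *: leval env e1
  end.

Fixpoint lcoef (e : lexp) (i : nat) : K :=
  match e with
  | LAtom j => if Nat.eqb j i then 1 else 0
  | LZero => 0
  | LAdd e1 e2 => lcoef e1 i + lcoef e2 i
  | LOpp e1 => - lcoef e1 i
  | LScale k e1 => k * lcoef e1 i
  end.

(** A nested conjunction instead of a bounded quantifier, so that after computation [repeat split]
    leaves one scalar goal for each atom. *)
Fixpoint same_lcoef (n : nat) (e1 e2 : lexp) : Prop :=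
  if n is m.+1 then lcoef e1 m = lcoef e2 m /\ same_lcoef m e1 e2 else True.

Lemma levalE env e : leval env e = \sum_(i < size env) lcoef e i *: env`_i.
Proof.
elim: e => [j||e1 IH1 e2 IH2|e1 IH1|k e1 IH1] /=.
- have [lt_j|le_j] := ltnP j (size env).
    rewrite (bigD1 (Ordinal lt_j)) //= PeanoNat.Nat.eqb_refl scale1r.
    rewrite big1 ?addr0 // => i; rewrite -val_eqE /= => /eqP ij.
    by case: PeanoNat.Nat.eqb_spec => [ji|]; [case: ij | rewrite scale0r].
  rewrite nth_default // big1 // => i _.
  case: PeanoNat.Nat.eqb_spec => [ji|]; last by rewrite scale0r.
  by have := ltn_ord i; rewrite -ji ltnNge le_j.
- by rewrite big1 // => i _; rewrite scale0r.
- by rewrite IH1 IH2 -big_split; apply: eq_bigr => i _; rewrite scalerDl.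
- by rewrite IH1 -sumrN; apply: eq_bigr => i _; rewrite scaleNr.
- by rewrite IH1 scaler_sumr; apply: eq_bigr => i _; rewrite scalerA.
Qed.

Lemma leval_eq env e1 e2 :
  same_lcoef (size env) e1 e2 -> leval env e1 = leval env e2.
Proof.
rewrite !levalE => e12; apply: eq_bigr => i _; congr (_ *: _).
elim: (size env) e12 i => [_ []//|n IH /= [en12 /IH e12] i].
have := ltn_ord i; rewrite ltnS leq_eqVlt => /orP[/eqP->//|lt_i].
by have := e12 (Ordinal lt_i).
Qed.

End LinearCombinations.

(** Atoms are compared by unification, so that terms that differ only up to conversion are not
    counted twice. The inner [match] runs [unify] while a term is being built. *)
Ltac lmem x env :=
  match env with
  | nil => constr:(false)
  | cons ?y ?env' =>
    match constr:(Set) with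
    | _ => let _ := match constr:(Set) with _ => unify x y end in constr:(true)
    | _ => lmem x env'
    end
  end.

Ltac latoms env t :=
  match t with
  | 0%R => env
  | (?a + ?b)%R => let env' := latoms env a in latoms env' b
  | (- ?a)%R => latoms env a
  | (?k *: ?a)%R => latoms env a
  | _ => match lmem t env with
         | true => env
         | false => constr:(cons t env)
         end
  end.

Ltac lindex x env :=
  match env with
  | cons ?y ?env' =>
    match constr:(Set) with
    | _ => let _ := match constr:(Set) with _ => unify x y end in constr:(0%N)
    | _ => let i := lindex x env' in constr:(S i)
    end
  end.

Ltac lreify K env t :=
  match t with
  | 0%R => constr:(@LZero K)
  | (?a + ?b)%R =>
    let a' := lreify K env a in let b' := lreify K env b in
    constr:(@LAdd K a' b')
  | (- ?a)%R => let a' := lreify K env a in constr:(@LOpp K a')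
  | (?k *: ?a)%R => let a' := lreify K env a in constr:(@LScale K k a')
  | _ => let i := lindex t env in constr:(@LAtom K i)
  end.

(* Reduces an identity in a module over the field K to the equalities of the
   coefficients of its atoms. *)
Ltac lincomb_with K V :=
  match goal with
  | |- ?l = ?r =>
    let env0 := latoms (@nil V) l in
    let env := latoms env0 r in
    let e1 := lreify K env l in
    let e2 := lreify K env r in
    refine (@leval_eq K V env e1 e2 _); cbn [same_lcoef size lcoef Nat.eqb];
    repeat split
  end.

Ltac lincomb R :=
  match goal with
  | |- @eq ?V _ _ =>
    lincomb_with (complex R : comPzRingType) (V : lmodType (complex R))
  end.

(** * Real-valued norms and convergence of sequences *)

Section RealNorm.
Context (R : realType).

(** Norms take values in [R[i]]; their real part is used instead, to have a total order and the
    tactics for ordered fields at hand. *)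
Definition rnorm (V : normedZmodType R[i]) (x : V) : R := complex.Re `|x|.

Lemma normE (V : normedZmodType R[i]) (x : V) : `|x| = (rnorm x)%:C.
Proof. by rewrite /rnorm RRe_real ?normr_real. Qed.

Lemma rnorm_ge0 (V : normedZmodType R[i]) (x : V) : 0 <= rnorm x.
Proof. by rewrite -ler0c -normE. Qed.

Lemma rnorm_eq0 (V : normedZmodType R[i]) (x : V) : (rnorm x == 0) = (x == 0).
Proof. by rewrite -(normr_eq0 x) normE eq_complex /= eqxx andbT. Qed.

Lemma rnorm0 (V : normedZmodType R[i]) : rnorm (0 : V) = 0.
Proof. by apply/eqP; rewrite rnorm_eq0. Qed.

Lemma rnormN (V : normedZmodType R[i]) (x : V) : rnorm (- x) = rnorm x.
Proof. by rewrite /rnorm normrN. Qed.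

Lemma rnorm_distC (V : normedZmodType R[i]) (x y : V) :
  rnorm (x - y) = rnorm (y - x).
Proof. by rewrite /rnorm distrC. Qed.

Lemma rnormD (V : normedZmodType R[i]) (x y : V) :
  rnorm (x + y) <= rnorm x + rnorm y.
Proof. by rewrite -lecR rmorphD /= -!normE ler_normD. Qed.

Lemma rnormB (V : normedZmodType R[i]) (x y : V) :
  rnorm (x - y) <= rnorm x + rnorm y.
Proof. by rewrite -(rnormN y) rnormD. Qed.

Lemma rnorm_dist (V : normedZmodType R[i]) (y x z : V) :
  rnorm (x - z) <= rnorm (x - y) + rnorm (y - z).
Proof. by rewrite -[x - z](subrKA y) rnormD. Qed.

Lemma rnorm_dist_dist (V : normedZmodType R[i]) (x y : V) :
  rnorm x - rnorm y <= rnorm (x - y).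
Proof. by rewrite lerBlDr -{1}(subrK y x) rnormD. Qed.

Lemma rnormZ (V : normedModType R[i]) (k : R[i]) (x : V) :
  rnorm (k *: x) = rnorm k * rnorm x.
Proof. by apply: (@complexI R); rewrite rmorphM /= -!normE normrZ. Qed.

Lemma rnormM (k l : R[i]) : rnorm (k * l) = rnorm k * rnorm l.
Proof. by apply: (@complexI R); rewrite rmorphM /= -!normE normrM. Qed.

Lemma rnormc (t : R) : rnorm (t%:C : R[i]) = `|t|.
Proof.
by rewrite /rnorm normc_def /= expr0n addr0 sqrtr_sqr.
Qed.

Lemma rnormZc (V : normedModType R[i]) (t : R) (x : V) :
  rnorm (t%:C *: x) = `|t| * rnorm x.
Proof. by rewrite rnormZ rnormc. Qed.

Lemma rnormJ (k : R[i]) : rnorm k^* = rnorm k.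
Proof. by rewrite /rnorm norm_conjC. Qed.

Lemma rnorm_sqr (k : R[i]) : ((rnorm k) ^+ 2)%:C = k^* * k.
Proof. by rewrite rmorphXn /= -normE sqr_normc mulrC. Qed.

Lemma Re_le_rnorm (k : R[i]) : complex.Re k <= rnorm k.
Proof.
by rewrite (le_trans (ler_norm _)) // -lecR -normE normc_ge_Re.
Qed.

Lemma rnorm_ge0_Re (k : R[i]) : 0 <= k -> k = (complex.Re k)%:C.
Proof. by move=> k0; rewrite RRe_real ?ger0_real. Qed.

Lemma rnorm_small0 (V : normedZmodType R[i]) (x : V) :
  (forall e : R, 0 < e -> rnorm x <= e) -> x = 0.
Proof.
move=> small; apply/eqP; rewrite -rnorm_eq0 eq_le rnorm_ge0 andbT.
by apply/ler_addgt0Pr => e e0; rewrite add0r small.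
Qed.

Lemma rnorm_eq_small (V : normedZmodType R[i]) (x y : V) :
  (forall e : R, 0 < e -> rnorm (x - y) <= e) -> x = y.
Proof. by move=> /rnorm_small0/eqP; rewrite subr_eq0 => /eqP. Qed.

Definition rcauchy (V : normedZmodType R[i]) (u : nat -> V) :=
  forall e : R, 0 < e ->
  exists N, forall m n, (N <= m)%N -> (N <= n)%N -> rnorm (u m - u n) <= e.

Definition rcvg (V : normedZmodType R[i]) (u : nat -> V) (l : V) :=
  forall e : R, 0 < e -> exists N, forall n, (N <= n)%N -> rnorm (l - u n) <= e.

Lemma rcvg_unique (V : normedZmodType R[i]) (u : nat -> V) l l' :
  rcvg u l -> rcvg u l' -> l = l'.
Proof.
move=> ul ul'; apply: rnorm_eq_small => e e0.
have e20 : 0 < e / 2 by rewrite divr_gt0.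
have [N uN] := ul _ e20; have [N' uN'] := ul' _ e20.
rewrite (le_trans (rnorm_dist (u (maxn N N')) _ _)) // [leRHS](splitr e).
by rewrite lerD ?uN ?leq_maxl // rnorm_distC uN' ?leq_maxr.
Qed.

Lemma inv_small (e : R) : 0 < e ->
  exists N, forall n, (N <= n)%N -> n.+1%:R^-1 <= e.
Proof.
move=> e0; have [N _ lN] := near_infty_natSinv_lt (PosNum e0).
exists N => n Nn; exact/ltW/lN.
Qed.

End RealNorm.

Section CompleteSequences.
Context (R : realType) (V : completeNormedModType R[i]).

Lemma rcauchy_cvg (u : nat -> V) : rcauchy u -> exists l, rcvg u l.
Proof.
move=> cu; have : cvg (u @ \oo).
  apply: (@cauchy_cvg V); apply: cauchy_exP => e e0.
  have ere := rnorm_ge0_Re (ltW e0); set er := complex.Re e in ere.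
  have er0 : 0 < er by move: e0; rewrite ere ltcR.
  have [|N cN] := cu (er / 2); first by rewrite divr_gt0.
  exists (u N); exists N => // n /= Nn.
  rewrite -ball_normE /ball_ /= normE ere ltcR.
  rewrite (le_lt_trans (cN _ _ _ _)) // ltr_pdivrMr // ltr_pMr //.
  by rewrite ltr1n.
move=> /cvg_ex[l /cvgrPdist_le ul]; exists l => e e0.
have /ul[N _ lN] : 0 < e%:C :> R[i] by rewrite ltcR.
by exists N => n Nn; rewrite -lecR -normE lN.
Qed.

Lemma geometric_cvg (u : nat -> V) (C rho : R) : 0 <= C -> 0 <= rho < 1 ->
  (forall n, rnorm (u n.+1 - u n) <= C * rho ^+ n) ->
  exists l, forall n, rnorm (l - u n) <= C * rho ^+ n / (1 - rho).
Proof.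
move=> C0 /andP[rho0 rho1] du; have r1 : 0 < 1 - rho by rewrite subr_gt0.
(* Geometric tail: [C rho^(n+1) / (1 - rho) + C rho^n = C rho^n / (1 - rho)]. *)
have dist k n : rnorm (u (k + n)%N - u n) <= C * rho ^+ n / (1 - rho).
  elim: k n => [|k IH] n.
    by rewrite add0n subrr rnorm0 divr_ge0 ?mulr_ge0 ?exprn_ge0 // ltW.
  rewrite addSnnS (le_trans (rnorm_dist (u n.+1) _ _)) //.
  rewrite (le_trans (lerD (IH n.+1) (du n))) //.
  rewrite exprS le_eqVlt; apply/orP; left; apply/eqP; field.
  by rewrite gt_eqF.
have small (e : R) : 0 < e ->
    exists N, forall n, (N <= n)%N -> C * rho ^+ n / (1 - rho) <= e.
  move=> e0.
  have : (fun n => C / (1 - rho) * rho ^+ n) @ \oo --> C / (1 - rho) * 0.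
    by apply: cvgMr; apply: cvg_expr; rewrite ger0_norm.
  rewrite mulr0 => /cvgrPdist_le /(_ e e0) [N _ lN]; exists N => n Nn.
  have := lN n Nn; rewrite sub0r normrN mulrAC.
  exact: (le_trans (ler_norm _)).
have [l ul] : exists l, rcvg u l.
  apply: rcauchy_cvg => e e0; have [N lN] := small _ e0.
  exists N; suff H m n : (N <= m)%N -> (m <= n)%N -> rnorm (u n - u m) <= e.
    move=> m n Nm Nn; have [mn|/ltnW nm] := leqP m n; last exact: H.
    by rewrite rnorm_distC H.
  by move=> Nm mn; rewrite -(subnK mn) (le_trans (dist _ _)) // lN.
exists l => n; apply/ler_addgt0Pr => e /ul[N lN].
rewrite (le_trans (rnorm_dist (u (N + n)%N) _ _)) // addrC.
by rewrite lerD // lN // leq_addr.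
Qed.

End CompleteSequences.

(** * C*-algebras and positive operators on them *)

Section CStarBasics.
Context (R : realType) (A : cstarAlgType R).
Implicit Types (a b x y : A) (k : R[i]) (t : R).

Lemma conj_real_complex t : ((t%:C : R[i])^*)%R = t%:C.
Proof. exact: conjc_real. Qed.

Lemma amulDl a b x : amul (a + b) x = amul a x + amul b x.
Proof. by rewrite -{1}(scale1r a) amul_linearl scale1r. Qed.

Lemma amulDr x a b : amul x (a + b) = amul x a + amul x b.
Proof. by rewrite -{1}(scale1r a) amul_linearr scale1r. Qed.

Lemma amul0l x : amul 0 x = 0.
Proof. by apply: (addrI (amul 0 x)); rewrite addr0 -amulDl addr0. Qed.

Lemma amul0r x : amul x 0 = 0.
Proof. by apply: (addrI (amul x 0)); rewrite addr0 -amulDr addr0. Qed.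

Lemma amulZl k a x : amul (k *: a) x = k *: amul a x.
Proof. by rewrite -[k *: a]addr0 amul_linearl amul0l addr0. Qed.

Lemma amulZr k x a : amul x (k *: a) = k *: amul x a.
Proof. by rewrite -[k *: a]addr0 amul_linearr amul0r addr0. Qed.

Lemma amulNl a x : amul (- a) x = - amul a x.
Proof. by rewrite -scaleN1r amulZl scaleN1r. Qed.

Lemma amulNr x a : amul x (- a) = - amul x a.
Proof. by rewrite -scaleN1r amulZr scaleN1r. Qed.

Lemma starD a b : star (a + b) = star a + star b.
Proof. by rewrite -{1}(scale1r a) star_semilinear rmorph1 scale1r. Qed.

Lemma star0 : star (0 : A) = 0.
Proof. by apply: (addrI (star 0)); rewrite addr0 -starD addr0. Qed.

Lemma starZ k a : star (k *: a) = (k^*)%R *: star a.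
Proof. by rewrite -[k *: a]addr0 star_semilinear star0 addr0. Qed.

Lemma starN a : star (- a) = - star a.
Proof. by rewrite -scaleN1r starZ rmorphN rmorph1 scaleN1r. Qed.

Definition amulE := (amulDl, amulDr, amulZl, amulZr, amulNl, amulNr).
Definition starE := (starD, starZ, starN).

Lemma rnorm_amul a b : rnorm (amul a b) <= rnorm a * rnorm b.
Proof. by rewrite -lecR rmorphM /= -!normE normr_amul. Qed.

Lemma rnorm_cstar a : rnorm (amul (star a) a) = rnorm a ^+ 2.
Proof.
by apply: (@complexI R); rewrite rmorphXn /= -!normE cstar_identity.
Qed.

Lemma rnorm_star a : rnorm (star a) = rnorm a.
Proof.
suff le b : rnorm b <= rnorm (star b).
  by apply/eqP; rewrite eq_le le -{2}(starK a) le.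
have [->|b0] := eqVneq b 0; first by rewrite star0.
have := rnorm_amul (star b) b; rewrite rnorm_cstar expr2 ler_pM2r //.
by rewrite lt_def rnorm_eq0 b0 rnorm_ge0.
Qed.

(** Nondegeneracy of the product, by the C*-identity at [x = a - b]. It replaces evaluation at a
    unit and makes adjoints unique. *)
Lemma amul_star_inj a b :
  (forall x, amul (star x) a = amul (star x) b) -> a = b.
Proof.
move=> ab; apply/eqP; rewrite -subr_eq0 -rnorm_eq0 -sqrf_eq0 -rnorm_cstar.
by rewrite amulDr amulNr ab subrr rnorm0.
Qed.

End CStarBasics.

Section Operators.
Context (R : realType) (A : cstarAlgType R).
Implicit Types (f g h : A -> A) (s t M : R).

(** Adjoints for the inner product [x* y] of A as a Hilbert module over itself. Such operators stand
    in for elements of the unitization: the identity is the unit, and [amul a] represents [a]. *)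
Definition isadj f g := forall x y, amul (star (f x)) y = amul (star x) (g y).

Definition bounded_by M f := forall x, rnorm (f x) <= M * rnorm x.

Definition opos f :=
  isadj f f /\ exists2 t : R, 0 <= t & bounded_by t (fun x => t%:C *: x - f x).

Lemma isadj_sym f g : isadj f g -> isadj g f.
Proof.
by move=> fg x y; rewrite -[LHS]starK star_amul starK -fg star_amul starK.
Qed.

(** An adjoint forces linearity, as [z* f(x) = g(z)* x] is linear in [x] for each [z]. *)
Lemma isadj_linear f g : isadj f g -> exists F : {linear A -> A}, f = F.
Proof.
move=> /isadj_sym gf; have lf : linear f.
  by move=> k x y; apply: amul_star_inj => z; rewrite !amulE -!gf !amulE.
pose m := GRing.isLinear.Build _ _ _ _ f lf.
by exists (HB.pack_for {linear A -> A} f m).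
Qed.

Lemma isadj_amul a : isadj (amul a) (amul (star a)).
Proof. by move=> x y; rewrite star_amul amulA. Qed.

Lemma isadj_scale (k : R[i]) f g :
  isadj f g -> isadj (fun x => k *: f x) (fun x => (k^*)%R *: g x).
Proof. by move=> fg x y; rewrite !starE !amulE fg. Qed.

Lemma isadj_scaleR t f : isadj f f ->
  isadj (fun x => t%:C *: f x) (fun x => t%:C *: f x).
Proof. by move=> /(isadj_scale t%:C); rewrite conj_real_complex. Qed.

Lemma isadj_id : isadj id id. Proof. by []. Qed.

Lemma isadj_zero : isadj (fun=> 0) (fun=> 0).
Proof. by move=> x y; rewrite star0 amul0l amul0r. Qed.

Lemma isadjD f f' g g' : isadj f g -> isadj f' g' ->
  isadj (fun x => f x + f' x) (fun x => g x + g' x).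
Proof. by move=> fg fg' x y; rewrite !starE !amulE fg fg'. Qed.

Lemma isadjB f f' g g' : isadj f g -> isadj f' g' ->
  isadj (fun x => f x - f' x) (fun x => g x - g' x).
Proof. by move=> fg fg' x y; rewrite !starE !amulE fg fg'. Qed.

Lemma isadj_comp f f' g g' : isadj f g -> isadj f' g' ->
  isadj (f \o f') (g' \o g).
Proof. by move=> fg fg' x y; rewrite /= fg fg'. Qed.

Lemma eq_bounded_by M f g : f =1 g -> bounded_by M f -> bounded_by M g.
Proof. by move=> fg fM x; rewrite -fg. Qed.

Lemma bounded_byW M M' f : M <= M' -> bounded_by M f -> bounded_by M' f.
Proof.
by move=> MM' fM x; rewrite (le_trans (fM x)) // ler_wpM2r // rnorm_ge0.
Qed.

Lemma bounded_by_amul (a : A) : bounded_by (rnorm a) (amul a).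
Proof. by move=> x; exact: rnorm_amul. Qed.

Lemma bounded_by_id : bounded_by 1 id.
Proof. by move=> x; rewrite mul1r. Qed.

Lemma bounded_byZ M t f : bounded_by M f ->
  bounded_by (`|t| * M) (fun x => t%:C *: f x).
Proof. by move=> fM x; rewrite rnormZc -mulrA ler_wpM2l. Qed.

Lemma bounded_byZi M f : bounded_by M f ->
  bounded_by M (fun x => 'i *: f x).
Proof.
move=> fM x; rewrite rnormZ.
suff -> : rnorm ('i : R[i]) = 1 by rewrite mul1r.
by apply: (@complexI R); rewrite -normE normCi.
Qed.

Lemma bounded_byN M f : bounded_by M f -> bounded_by M (fun x => - f x).
Proof. by move=> fM x; rewrite rnormN. Qed.

Lemma bounded_byD M M' f g : bounded_by M f -> bounded_by M' g ->
  bounded_by (M + M') (fun x => f x + g x).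
Proof. by move=> fM gM x; rewrite (le_trans (rnormD _ _)) // mulrDl lerD. Qed.

Lemma bounded_byB M M' f g : bounded_by M f -> bounded_by M' g ->
  bounded_by (M + M') (fun x => f x - g x).
Proof. by move=> fM /bounded_byN gM; exact: bounded_byD. Qed.

Lemma bounded_by_comp M M' f g : 0 <= M -> bounded_by M f -> bounded_by M' g ->
  bounded_by (M * M') (f \o g).
Proof.
by move=> M0 fM gM x /=; rewrite (le_trans (fM _)) // -mulrA ler_wpM2l.
Qed.

(** [|f x|^2 = |x* g(f x)| <= M^2 |x|^2]: the C*-identity for operators, by which bounds on squares
    become bounds. *)
Lemma bounded_by_cstar M f g : 0 <= M -> isadj f g ->
  bounded_by (M ^+ 2) (g \o f) -> bounded_by M f.
Proof.
move=> M0 fg gfM x.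
rewrite -ler_sqr ?nnegrE ?mulr_ge0 ?rnorm_ge0 //.
rewrite -rnorm_cstar fg (le_trans (rnorm_amul _ _)) // rnorm_star.
by rewrite exprMn expr2 mulrCA -expr2 ler_wpM2l ?rnorm_ge0 ?(gfM x).
Qed.

(** [|g x|^2 = |x* f(g x)| <= M |x| |g x|]. When [g x = 0] the claim is [0 <= M |x|], which is read
    off from [fM x], as the sign of [M] is unknown. *)
Lemma bounded_by_adj M f g : isadj f g -> bounded_by M f -> bounded_by M g.
Proof.
move=> fg fM x; have [gx0|gx0] := eqVneq (rnorm (g x)) 0.
  have [->|x0] := eqVneq x 0; last first.
    rewrite gx0 mulr_ge0 ?rnorm_ge0 // -(ler_pM2r (x := rnorm x)).
      by rewrite mul0r (le_trans _ (fM x)) ?rnorm_ge0.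
    by rewrite lt_def rnorm_eq0 x0 rnorm_ge0.
  by have /isadj_sym/isadj_linear[G ->] := fg; rewrite linear0 !rnorm0 mulr0.
rewrite -(ler_pM2r (x := rnorm (g x))); last by rewrite lt_def gx0 rnorm_ge0.
rewrite -expr2 -rnorm_cstar (isadj_sym fg) (le_trans (rnorm_amul _ _)) //.
by rewrite rnorm_star mulrC mulrAC ler_wpM2r ?rnorm_ge0.
Qed.

Lemma bounded_by_small M f :
  (forall e, 0 < e -> bounded_by (M + e) f) -> bounded_by M f.
Proof.
move=> fM x; apply/ler_addgt0Pr => e e0.
have r1 : 0 < rnorm x + 1 by rewrite ltr_wpDl ?rnorm_ge0.
have /fM/(_ x) : 0 < e / (rnorm x + 1) by rewrite divr_gt0.
move=> /le_trans-> //; rewrite mulrDl lerD2l -mulrA ler_piMr 1?ltW //.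
by rewrite mulrC ltr_pdivrMr // mul1r ltrDl.
Qed.

End Operators.

Lemma ler_div_succ (R : realType) (e r : R) : 0 <= e -> 0 <= r ->
  e / (r + 1) * r <= e.
Proof.
move=> e0 r0; rewrite mulrAC ler_pdivrMr ?ltr_wpDl //.
by rewrite ler_wpM2l // lerDl.
Qed.

(** * Square roots by iteration *)

Section SquareRoot.
Context (R : realType) (A : cstarAlgType R).
Implicit Types (f g h : A -> A) (t M e : R).

Definition unif_cvg (u : nat -> A -> A) f := forall e, 0 < e ->
  exists N, forall n, (N <= n)%N -> bounded_by e (fun x => f x - u n x).

Lemma unif_cvg_isadj (u : nat -> A -> A) f :
  (forall n, isadj (u n) (u n)) -> unif_cvg u f -> isadj f f.
Proof.
move=> un uf x y; apply: rnorm_eq_small => e e0.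
pose C := rnorm x * rnorm y + 1.
have C0 : 0 < C by rewrite ltr_wpDl // mulr_ge0 ?rnorm_ge0.
have [|N fN] := uf (e / 2 / C); first by rewrite !divr_gt0.
have {}fN := fN N (leqnn N).
have -> : amul (star (f x)) y - amul (star x) (f y) =
    amul (star (f x - u N x)) y - amul (star x) (f y - u N y).
  by rewrite !starE !amulE un; lincomb R; ring.
have leC z w : rnorm z * rnorm w <= rnorm x * rnorm y ->
    e / 2 / C * rnorm z * rnorm w <= e / 2.
  move=> zw; rewrite -mulrA -[leRHS]mulr1 -[leLHS]mulrA ler_wpM2l //.
    by rewrite divr_ge0 ?ltW.
  by rewrite ler_pdivrMl // mulr1 (le_trans zw) // lerDl.
rewrite (le_trans (rnormB _ _)) // [leRHS](splitr e) lerD //.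
  rewrite (le_trans (rnorm_amul _ _)) // rnorm_star.
  rewrite (le_trans (ler_wpM2r (rnorm_ge0 _) (fN x))) //.
  exact: leC.
rewrite (le_trans (rnorm_amul _ _)) // rnorm_star mulrC.
rewrite (le_trans (ler_wpM2r (rnorm_ge0 _) (fN y))) //.
by apply: leC; rewrite mulrC.
Qed.

Lemma unif_cvg_bounded (u : nat -> A -> A) f M :
  (forall n, bounded_by M (u n)) -> unif_cvg u f -> bounded_by M f.
Proof.
move=> un uf; apply: bounded_by_small => e /uf[N fN] x.
rewrite -[f x](subrK (u N x)) addrC (le_trans (rnormD _ _)) // mulrDl.
by rewrite lerD ?un ?fN.
Qed.

Lemma unif_cvg_comm (u : nat -> A -> A) f g M : 0 <= M ->
  (forall x y, g (x - y) = g x - g y) -> bounded_by M g ->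
  (forall n x, g (u n x) = u n (g x)) -> unif_cvg u f ->
  forall x, g (f x) = f (g x).
Proof.
move=> M0 gB gM gu uf x; apply: rnorm_eq_small => e e0.
pose C := M * rnorm x + 1.
have C0 : 0 < C by rewrite ltr_wpDl // mulr_ge0 ?rnorm_ge0.
have [|N fN] := uf (e / 2 / C); first by rewrite !divr_gt0.
have {}fN := fN N (leqnn N).
have -> : g (f x) - f (g x) = g (f x - u N x) - (f (g x) - u N (g x)).
  by rewrite gB gu; lincomb R; ring.
have leC : e / 2 / C * (M * rnorm x) <= e / 2.
  by apply: ler_div_succ; rewrite mulr_ge0 ?rnorm_ge0 ?(ltW e0).
rewrite (le_trans (rnormB _ _)) // [leRHS](splitr e) lerD //.
  rewrite (le_trans (gM _)) // (le_trans (ler_wpM2l M0 (fN x))) //.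
  by rewrite mulrCA.
rewrite (le_trans (fN _)) // (le_trans _ leC) // ler_wpM2l ?gM //.
by rewrite !divr_ge0 ?ltW.
Qed.

(* The square root of [1 - s] is [1 - c] for the fixed point [c] of
   [c |-> (s + c^2) / 2], which contracts a ball of radius [rho < 1]. *)
Lemma sqrt_fixpoint s (rho : R) : 0 <= rho < 1 -> isadj s s ->
  bounded_by (rho ^+ 2) s ->
  exists u c, [/\ u 0%N = (fun=> 0),
    forall n, u n.+1 = (fun x => (2^-1)%:C *: (s x + u n (u n x))),
    forall n, isadj (u n) (u n), unif_cvg u c &
    bounded_by rho c /\ forall x, s x = (2%:R)%:C *: c x - c (c x)].
Proof.
move=> /andP[rho0 rho1] ss sM.
pose u := fix u n : A -> A :=
  if n is m.+1 then fun x => (2^-1)%:C *: (s x + u m (u m x)) else fun=> 0.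
have uu n : isadj (u n) (u n).
  elim: n => [|n IH]; first exact: isadj_zero.
  by apply: isadj_scaleR; apply: isadjD => //; exact: isadj_comp.
have uM n : bounded_by rho (u n).
  elim: n => [|n IH] x; first by rewrite rnorm0 mulr_ge0 ?rnorm_ge0.
  rewrite /= rnormZc ger0_norm ?invr_ge0 // ler_pdivrMl //.
  rewrite (le_trans (bounded_byD sM (bounded_by_comp rho0 IH IH) x)) //.
  rewrite mulrA ler_wpM2r ?rnorm_ge0 // -expr2 mulr2n mulrDl mul1r lerD //.
    by rewrite expr2 ler_piMr // ltW.
  by rewrite expr2 ler_piMr // ltW.
have du n : bounded_by (rho ^+ n.+1) (fun x => u n.+1 x - u n x).
  elim: n => [|n IH] x.
    rewrite /= subr0 addr0 rnormZc ger0_norm ?invr_ge0 // expr1.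
    rewrite ler_pdivrMl // (le_trans (sM x)) // mulrA ler_wpM2r ?rnorm_ge0 //.
    rewrite expr2 ler_wpM2r // ltW // (lt_trans rho1) // ltr1n //.
  have uB a b : u n.+1 (a - b) = u n.+1 a - u n.+1 b.
    by have [U ->] := isadj_linear (uu n.+1); rewrite linearB.
  (* [p^2 - q^2 = p (p - q) + (p - q) q], which holds without commutation. *)
  have -> : u n.+2 x - u n.+1 x = (2^-1)%:C *:
     (u n.+1 (u n.+1 x - u n x) + (u n.+1 (u n x) - u n (u n x))).
    rewrite -[u n.+2 x]/((2^-1)%:C *: (s x + u n.+1 (u n.+1 x))).
    rewrite -[X in _ - X]/((2^-1)%:C *: (s x + u n (u n x))).
    by rewrite uB; lincomb R; ring.
  rewrite rnormZc ger0_norm ?invr_ge0 // ler_pdivrMl //.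
  rewrite (le_trans (rnormD _ _)) // [2](_ : _ = 1 + 1) // mulrDl mul1r.
  rewrite exprS -mulrA lerD //.
    by rewrite (le_trans (uM _ _)) // ler_wpM2l.
  rewrite (le_trans (IH _)) // mulrCA ler_wpM2l ?exprn_ge0 //.
  exact: uM.
have cauchyu x : exists l, forall n,
    rnorm (l - u n x) <= rho * rnorm x * rho ^+ n / (1 - rho).
  apply: geometric_cvg; rewrite ?mulr_ge0 ?rnorm_ge0 ?rho0 //.
  by move=> n; rewrite mulrAC -exprS; exact: du.
have [c cP] := choice cauchyu.
have uc : unif_cvg u c.
  move=> e e0; pose C := rho / (1 - rho).
  have : (fun n => C * rho ^+ n) @ \oo --> C * 0.
    by apply: cvgMr; apply: cvg_expr; rewrite ger0_norm.
  rewrite mulr0 => /cvgrPdist_le /(_ e e0) [N _ lN]; exists N => n Nn x.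
  have := lN n Nn; rewrite sub0r normrN => /(le_trans (ler_norm _)) le_e.
  rewrite (le_trans (cP x n)) // (le_trans _ (ler_wpM2r (rnorm_ge0 x) le_e)) //.
  by rewrite le_eqVlt; apply/orP; left; apply/eqP; rewrite /C; ring.
have cc := unif_cvg_isadj uu uc; have cM := unif_cvg_bounded uM uc.
have uS n y : s y = (2%:R)%:C *: u n.+1 y - u n (u n y).
  rewrite /= scalerA -rmorphM /= mulfV ?pnatr_eq0 // scale1r.
  by rewrite addrK.
(* The iterates are part of the conclusion: commutation with an operator, and membership in A, are
   checked on them and passed to the limit. *)
exists u, c; split=> //; split=> // x.
have cB a b : c (a - b) = c a - c b.
  by have [U ->] := isadj_linear cc; rewrite linearB.
apply: rnorm_eq_small => e e0.
pose C := rnorm x + 1.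
have C0 : 0 < C by rewrite ltr_wpDl ?rnorm_ge0.
have [|N uN] := uc (e / 4 / C); first by rewrite !divr_gt0.
have -> : s x - ((2%:R)%:C *: c x - c (c x)) =
    c (c x - u N x) + (c (u N x) - u N (u N x)) - (2%:R)%:C *: (c x - u N.+1 x).
  rewrite cB (uS N); lincomb R; ring.
have ex : e / 4 / C * rnorm x <= e / 4.
  by apply: ler_div_succ; rewrite ?rnorm_ge0 ?divr_ge0 ?(ltW e0).
rewrite (le_trans (rnormB _ _)) // rnormZc ger0_norm //.
have -> : e = e / 4 + e / 4 + 2 * (e / 4) by field.
apply: lerD; last first.
  by rewrite ler_wpM2l //; exact: le_trans (uN _ (leqnSn N) x) ex.
rewrite (le_trans (rnormD _ _)) // lerD //.
  rewrite (le_trans (cM _)) // (le_trans _ ex) //.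
  rewrite (le_trans _ (uN _ (leqnn N) x)) // ler_piMl ?rnorm_ge0 // ltW //.
rewrite (le_trans (uN _ (leqnn N) _)) // (le_trans _ ex) //.
rewrite ler_wpM2l ?divr_ge0 ?(ltW C0) ?(ltW e0) //.
by rewrite (le_trans (uM _ _)) // ler_piMl ?rnorm_ge0 // ltW.
Qed.

End SquareRoot.

(** Moves the factor 1/2 or 1/4 of a polarization identity to the other side, so that no inverse is
    left to [ring]. *)
Lemma eq_scaleV (R : realType) (V : lmodType R[i]) n (x y : V) :
  n.+1%:R *: x = y -> x = (n.+1%:R^-1)%:C *: y.
Proof.
move=> <-; rewrite scalerA -(rmorph_nat (real_complex R)) -rmorphM /=.
by rewrite mulVf ?pnatr_eq0 // scale1r.
Qed.

(** * Positive operators on A and their square roots *)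

Section PositiveOperators.
Context (R : realType) (A : cstarAlgType R).
Implicit Types (f g h : A -> A) (t M e : R).

Definition bounded f := exists2 M : R, 0 <= M & bounded_by M f.

Definition commutes f g := forall x, f (g x) = g (f x).

Lemma boundedB f g : bounded f -> bounded g -> bounded (fun x => f x - g x).
Proof.
by move=> [M M0 fM] [N N0 gN]; exists (M + N); [exact: addr_ge0|exact: bounded_byB].
Qed.

Lemma boundedD f g : bounded f -> bounded g -> bounded (fun x => f x + g x).
Proof.
by move=> [M M0 fM] [N N0 gN]; exists (M + N); [exact: addr_ge0|exact: bounded_byD].
Qed.

Lemma boundedZ t f : bounded f -> bounded (fun x => t%:C *: f x).
Proof.
by move=> [M M0 fM]; exists (`|t| * M); [exact: mulr_ge0|exact: bounded_byZ].
Qed.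

Lemma bounded_comp f g : bounded f -> bounded g -> bounded (f \o g).
Proof.
move=> [M M0 fM] [N N0 gN].
by exists (M * N); [exact: mulr_ge0|exact: bounded_by_comp].
Qed.

Lemma bounded_id : bounded id.
Proof. by exists 1 => //; exact: bounded_by_id. Qed.

Lemma bounded_amul (a : A) : bounded (amul a).
Proof. by exists (rnorm a); [exact: rnorm_ge0|exact: bounded_by_amul]. Qed.

Lemma bounded_adj f g : isadj f g -> bounded f -> bounded g.
Proof. by move=> fg [M M0 fM]; exists M => //; exact: bounded_by_adj fM. Qed.

(** Here [d = 1 - c]. The iterates are built from [s] by sums and composition, so that what commutes
    with [s] commutes with each of them and, if bounded, with the limit. *)
Lemma sqrt_one_minus s (rho : R) : 0 <= rho < 1 -> isadj s s ->
  bounded_by (rho ^+ 2) s ->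
  exists d : {linear A -> A}, [/\ isadj d d, bounded d,
    forall x, d (d x) = x - s x &
    forall g : {linear A -> A}, bounded g -> commutes g s -> commutes g d].
Proof.
move=> rho01 ss sM; have [u [c [u0 uS uu uc [cM sE]]]] := sqrt_fixpoint rho01 ss sM.
have cc := unif_cvg_isadj uu uc.
have dd : isadj (fun x => x - c x) (fun x => x - c x) by exact: isadjB.
have [d dE] := isadj_linear dd; have [C cE] := isadj_linear cc.
have dx x : d x = x - c x by rewrite -dE.
exists d; split.
- by rewrite -dE.
- rewrite -dE; apply: boundedB; first exact: bounded_id.
  by exists rho => //; case/andP: rho01.
- move=> x; rewrite !dx sE [c (x - _)](_ : _ = c x - c (c x)).
    by lincomb R; ring.
  by rewrite cE linearB.
- move=> g [M M0 gM] gs x; rewrite !dx linearB; congr (_ - _).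
  apply: (unif_cvg_comm M0 _ gM _ uc) => [y z|n]; first by rewrite linearB.
  elim: n => [y|n IH y]; first by rewrite u0 linear0.
  by rewrite uS linearZ linearD gs !IH.
Qed.

(** [f + e = (t + e) (1 - s)] for [s = (t - f) / (t + e)], whose bound [t / (t + e)] is less than 1;
    the shift by [e] is what makes the iteration contract. *)
Lemma opos_sqrt f e : opos f -> 0 < e -> exists r : {linear A -> A},
  [/\ isadj r r, bounded r, forall x, r (r x) = f x + e%:C *: x &
  forall g : {linear A -> A}, bounded g -> commutes g f -> commutes g r].
Proof.
move=> [ff [t t0 fM]] e0; have te0 : 0 < t + e by rewrite ltr_wpDl.
pose s x := (t + e)^-1%:C *: (t%:C *: x - f x).
have ss : isadj s s.
  by apply: isadj_scaleR; apply: isadjB => //; exact: isadj_scaleR.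
have sM : bounded_by (Num.sqrt (t / (t + e)) ^+ 2) s.
  rewrite sqr_sqrtr ?divr_ge0 // ?ltW //.
  have := bounded_byZ (t + e)^-1 fM.
  by rewrite ger0_norm ?invr_ge0 ?(ltW te0) // mulrC.
have rho01 : 0 <= Num.sqrt (t / (t + e)) < 1.
  rewrite sqrtr_ge0 /= -sqrtr1 ltr_sqrt // ltr_pdivrMr // mul1r ltrDl //.
have [d [dd dM dsq dcomm]] := sqrt_one_minus rho01 ss sM.
have rr := isadj_scaleR (Num.sqrt (t + e)) dd.
have [r rE] := isadj_linear rr.
have rx x : r x = (Num.sqrt (t + e))%:C *: d x by rewrite -rE.
exists r; split.
- by rewrite -rE.
- by rewrite -rE; exact: boundedZ.
- move=> x; rewrite !rx linearZ /= dsq scalerA -rmorphM /= -expr2.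
  rewrite sqr_sqrtr ?ltW // /s scalerBr scalerA -rmorphM /= mulfV ?gt_eqF //.
  by rewrite scale1r rmorphD; lincomb R; ring.
- move=> g gM gf x; rewrite !rx linearZ /= dcomm // => y.
  by rewrite /s linearZ /= linearB linearZ /= gf.
Qed.

Lemma scale_ii (x : A) : 'i *: ('i *: x) = - x.
Proof. by rewrite scalerA -expr2 sqrCi scaleN1r. Qed.

Lemma isadj_addi (r q : {linear A -> A}) : isadj r r -> isadj q q ->
  exists u v : {linear A -> A}, [/\ isadj u v,
    forall x, u x = r x + 'i *: q x & forall x, v x = r x - 'i *: q x].
Proof.
move=> rr qq; have uv := isadjD rr (isadj_scale 'i qq).
have [u uE] := isadj_linear uv; have [v vE] := isadj_linear (isadj_sym uv).
exists u, v; split=> [|x|x]; first by rewrite -uE -vE.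
  by rewrite -uE.
by rewrite -vE conjCi scaleNr.
Qed.

Lemma bounded_by_isometry (m : R) (u v : {linear A -> A}) : 0 <= m ->
  isadj u v -> (forall x, v (u x) = m%:C *: x) ->
  bounded_by (Num.sqrt m) u /\ bounded_by (Num.sqrt m) v.
Proof.
move=> m0 uv vu; have uM : bounded_by (Num.sqrt m) u.
  apply: bounded_by_cstar uv _; first exact: sqrtr_ge0.
  by move=> x; rewrite /= vu rnormZc sqr_sqrtr // ger0_norm.
by split=> //; exact: bounded_by_adj uv uM.
Qed.

Lemma isadj_shift m f : isadj (fun x => m%:C *: x + f x) (fun x => m%:C *: x + f x) ->
  isadj f f.
Proof.
move=> adjf; have -> : f = (fun x => (m%:C *: x + f x) - m%:C *: x).
  by apply/funext => x; rewrite addrAC subrr add0r.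
by apply: isadjB => //; apply: isadj_scaleR; exact: isadj_id.
Qed.

(* With commuting square roots [r] and [q] of [m + y] and [m - y], the operator
   [u = r + i q] satisfies [u* u = 2 m] and [y = (u^2 + u*^2) / 4]. *)
Lemma bounded_by_opos m (y : A -> A) : 0 <= m ->
  opos (fun x => m%:C *: x + y x) -> opos (fun x => m%:C *: x - y x) ->
  bounded_by m y.
Proof.
move=> m0 mDy mBy; apply: bounded_by_small => e e0.
have [/isadj_shift/isadj_linear[y' yE] _] := mDy; subst y.
have [r [rr rM rsq rcomm]] := opos_sqrt mDy e0.
have [q [qq qM qsq qcomm]] := opos_sqrt mBy e0.
have yE x : y' x = r (r x) - (m + e)%:C *: x.
  by rewrite rsq rmorphD; lincomb R; ring.
have yM : bounded y'.
  have -> : (y' : A -> A) = fun x => r (r x) - (m + e)%:C *: x by exact/funext.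
  apply: boundedB; first exact: (bounded_comp rM rM).
  by apply: boundedZ; exact: bounded_id.
(* [r] commutes with all that commutes with [m + y], in particular with [y]; then [q] commutes with
   [r] in turn. *)
have yr : commutes y' r by apply: rcomm => // x; rewrite linearD linearZ.
have rq : commutes r q.
  by apply: qcomm => // x; rewrite linearB linearZ /= yr.
have [u [v [uv uE vE]]] := isadj_addi rr qq.
(* The shifts add up to [r^2 + q^2 = 2 (m + e)], and the cross terms cancel by [rq]. *)
have vu x : v (u x) = (2 * (m + e))%:C *: x.
  rewrite vE !uE !linearD !linearZ /= ?scalerDr ?scalerN !scale_ii rq rsq qsq.
  by lincomb R; ring.
have me0 : 0 <= 2 * (m + e) by rewrite mulr_ge0 // addr_ge0 // ltW.
have [uM vM] := bounded_by_isometry me0 uv vu.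
have yuv x : y' x = (4^-1)%:C *: (u (u x) + v (v x)).
  apply: (@eq_scaleV R _ 3).
  rewrite !uE !vE !linearD !linearN !linearZ /= ?scalerDr ?scalerN !scale_ii.
  by rewrite rsq qsq rq; lincomb R; ring.
move=> x; rewrite yuv rnormZc ger0_norm ?invr_ge0 // ler_pdivrMl //.
have s0 := sqrtr_ge0 (2 * (m + e)).
have := bounded_byD (bounded_by_comp s0 uM uM) (bounded_by_comp s0 vM vM) x.
rewrite -expr2 sqr_sqrtr // => /le_trans -> //.
by rewrite le_eqVlt; apply/orP; left; apply/eqP; ring.
Qed.

Lemma opos_ext f g : f =1 g -> opos f -> opos g.
Proof. by move=> /funext->. Qed.

Lemma opos_bounded f : opos f -> bounded f.
Proof.
move=> fpos; have [r [_ rM rsq _]] := opos_sqrt fpos ltr01.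
have -> : f = fun x => r (r x) - 1%:C *: x.
  by apply/funext => x; rewrite rsq; lincomb R; ring.
apply: boundedB; first exact: (bounded_comp rM rM).
by apply: boundedZ; exact: bounded_id.
Qed.

Lemma oposD f g : opos f -> opos g -> opos (fun x => f x + g x).
Proof.
move=> [ff [t t0 ft]] [gg [t' t'0 gt]]; split; first exact: isadjD.
exists (t + t'); first exact: addr_ge0.
apply: eq_bounded_by (bounded_byD ft gt) => x.
by rewrite rmorphD; lincomb R; ring.
Qed.

Lemma oposZ t f : 0 <= t -> opos f -> opos (fun x => t%:C *: f x).
Proof.
move=> t0 [ff [t' t'0 ft]]; split; first exact: isadj_scaleR.
exists (t * t'); first exact: mulr_ge0.
have := bounded_byZ t ft; rewrite ger0_norm //; apply: eq_bounded_by => x.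
by rewrite rmorphM; lincomb R; ring.
Qed.

Lemma opos_id : opos (@id A).
Proof.
split; first exact: isadj_id.
by exists 1 => // x; rewrite scale1r subrr rnorm0 mul1r rnorm_ge0.
Qed.

Lemma opos_scale t : 0 <= t -> opos (fun x : A => t%:C *: x).
Proof. by move=> t0; exact: oposZ t0 opos_id. Qed.

Lemma opos0 : opos (fun=> 0 : A).
Proof.
apply: opos_ext (opos_scale (lexx 0)) => x.
by rewrite rmorph0 scale0r.
Qed.

Lemma bounded_opos M f : 0 <= M -> isadj f f -> bounded_by M f ->
  opos (fun x => M%:C *: x + f x) /\ opos (fun x => M%:C *: x - f x).
Proof.
move=> M0 ff fM.
have adjM : isadj (fun x : A => M%:C *: x) (fun x => M%:C *: x).
  by apply: isadj_scaleR; exact: isadj_id.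
split; (split; [by [exact: isadjD|exact: isadjB] | exists M => // x]).
  by rewrite opprD addNKr rnormN.
by rewrite opprB addrCA subrr addr0.
Qed.

(* If [d] is a square root of [1 - r^2], then [r + i d] is unitary, hence
   [d], which is its imaginary part, is a contraction. *)
Lemma opos_sqr (r : {linear A -> A}) : isadj r r -> bounded r -> opos (r \o r).
Proof.
move=> rr [M M0 rM]; split; first exact: isadj_comp.
pose k := M ^+ 2 + 1; have k0 : 0 < k by rewrite ltr_wpDl ?sqr_ge0.
exists k; first exact: ltW.
have rho01 : 0 <= Num.sqrt (M ^+ 2 / k) < 1.
  rewrite sqrtr_ge0 /= -sqrtr1 ltr_sqrt // ltr_pdivrMr // mul1r ltrDl //.
have sM : bounded_by (Num.sqrt (M ^+ 2 / k) ^+ 2) (fun x => k^-1%:C *: r (r x)).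
  rewrite sqr_sqrtr ?divr_ge0 ?sqr_ge0 // ?ltW //.
  have := bounded_byZ k^-1 (bounded_by_comp M0 rM rM).
  by rewrite ger0_norm ?invr_ge0 ?(ltW k0) // mulrC -expr2.
have ss := isadj_scaleR k^-1 (isadj_comp rr rr).
have [d [dd dM dsq dcomm]] := sqrt_one_minus rho01 ss sM.
have rs := isadj_scaleR (Num.sqrt k)^-1 rr; have [r' r'E] := isadj_linear rs.
have r'x x : r' x = (Num.sqrt k)^-1%:C *: r x by rewrite -r'E.
rewrite r'E in rs; have [u [v [uv uE vE]]] := isadj_addi rs dd.
have rd : commutes r d.
  by apply: dcomm => [|x]; [exists M|rewrite linearZ].
have r'd : commutes r' d by move=> x; rewrite !r'x rd linearZ.
have r'sq x : r' (r' x) = k^-1%:C *: r (r x).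
  rewrite !r'x linearZ /= scalerA -rmorphM -expr2 /= exprVn sqr_sqrtr //.
  exact: ltW.
have vu x : v (u x) = 1%:C *: x.
  rewrite vE !uE !linearD !linearZ /= ?scalerDr ?scalerN !scale_ii r'd dsq r'sq /=.
  lincomb R; ring.
have [uM vM] := bounded_by_isometry ler01 uv vu.
rewrite sqrtr1 in uM vM.
have d1 : bounded_by 1 d.
  have -> : (d : A -> A) = fun x => (2^-1)%:C *: ('i *: (v x - u x)).
    apply/funext => x; apply: (@eq_scaleV R _ 1).
    by rewrite uE vE !(scalerDr 'i, scalerN) !scale_ii; lincomb R; ring.
  have := bounded_byZ (2^-1) (bounded_byZi (bounded_byB vM uM)).
  rewrite ger0_norm ?invr_ge0 //.
  by have -> : 2^-1 * (1 + 1) = 1 :> R by field.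
have := bounded_byZ k (bounded_by_comp ler01 d1 d1).
rewrite !mulr1 ger0_norm ?(ltW k0) //; apply: eq_bounded_by => x /=.
rewrite dsq scalerBr scalerA -rmorphM /= mulfV ?gt_eqF // scale1r //.
Qed.

(** With [M] a bound of [f], both [(M + e) + (M - f)] and [(M + e) - (M - f) = f + e] are positive,
    so that [|M - f| <= M + e] for all [e]. *)
Lemma opos_closed f : bounded f ->
  (forall e, 0 < e -> opos (fun x => f x + e%:C *: x)) -> opos f.
Proof.
move=> [M M0 fM] fe.
have ff : isadj f f.
  have [+ _] := fe _ ltr01.
  have -> : (fun x => f x + 1%:C *: x) = fun x => 1%:C *: x + f x.
    by apply/funext => x; rewrite addrC.
  exact: isadj_shift.
have [fpos fneg] := bounded_opos M0 ff fM.
split=> //; exists M => //; apply: bounded_by_small => e e0.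
apply: bounded_by_opos; first by rewrite addr_ge0 // ltW.
  apply: opos_ext (oposD (oposD fneg (opos_scale M0)) (opos_scale (ltW e0))) => x.
  by rewrite rmorphD; lincomb R; ring.
by apply: opos_ext (fe e e0) => x; rewrite rmorphD; lincomb R; ring.
Qed.

(** Monotonicity of the norm: [- m/2 <= f - m/2 <= m/2] bounds [f - m/2] by [m/2], hence [f] by
    [m]. *)
Lemma bounded_by_opos_le m f : 0 <= m -> opos f ->
  opos (fun x => m%:C *: x - f x) -> bounded_by m f.
Proof.
move=> m0 fpos mBf; have m20 : 0 <= m / 2 by rewrite divr_ge0.
have half : bounded_by (m / 2) (fun x => f x - (m / 2)%:C *: x).
  apply: bounded_by_opos => //.
    by apply: opos_ext fpos => x; lincomb R; ring.
  apply: opos_ext mBf => x; rewrite {1}(splitr m) rmorphD; lincomb R; ring.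
have := bounded_byD half (bounded_byZ (m / 2) (@bounded_by_id R A)).
rewrite mulr1 ger0_norm // -splitr; apply: eq_bounded_by => x.
by lincomb R; ring.
Qed.

End PositiveOperators.

(** * Positivity of [b* b] and of conjugates *)

Section PositivityOfSquares.
Context (R : realType) (A : cstarAlgType R).
Implicit Types (f g : A -> A) (t M e : R).

(** The operator norm, as an infimum; its minimality is what an improved bound will contradict. *)
Lemma least_bound f : bounded f -> exists N, [/\ 0 <= N, bounded_by N f &
  forall M, 0 <= M -> bounded_by M f -> N <= M].
Proof.
move=> [M0 M00 fM0]; pose S := [set M : R | 0 <= M /\ bounded_by M f].
have infS : has_inf S by split; [exists M0 | exists 0 => M []].
exists (inf S); split.
- by apply: lb_le_inf; [exact: infS.1 | move=> M []].
- apply: bounded_by_small => e e0; have [M [_ fM] lt_M] := inf_adherent e0 infS.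
  exact: bounded_byW (ltW lt_M) fM.
- by move=> M M_ge0 fM; apply: ge_inf; [exact: infS.2|split].
Qed.

(* If the least bound [N] of [y = v w] exceeded 1, then [v (N - w v) w =
   y (N - y)] would be bounded by [N (N + 1)], and completing the square would
   give a smaller bound for [y]. *)
Lemma bounded_by_adj_mul (w v : {linear A -> A}) : isadj w v -> bounded w ->
  opos (fun x => 1%:C *: x - v (w x)) -> opos (fun x => 1%:C *: x + w (v x)) ->
  bounded_by 1 (v \o w).
Proof.
move=> wv wb yle xge; have vb := bounded_adj wv wb.
have [N [N0 yN Nmin]] := least_bound (bounded_comp vb wb).
have [N1|N1] := leP N 1; first exact: bounded_byW yN.
exfalso; have [c Nc] : exists c, N = c + c by exists (N / 2); exact: splitr.
have s0 := sqrtr_ge0 N; have ss : Num.sqrt N * Num.sqrt N = N.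
  by rewrite -expr2 sqr_sqrtr.
have wN : bounded_by (Num.sqrt N) w.
  by apply: bounded_by_cstar wv _ => //; rewrite expr2 ss.
have vN := bounded_by_adj wv wN.
have xN : bounded_by N (w \o v) by rewrite -ss; exact: bounded_by_comp.
have yadj : isadj (v \o w) (v \o w) by exact: (isadj_comp (isadj_sym wv) wv).
have xadj : isadj (w \o v) (w \o v) by exact: (isadj_comp wv (isadj_sym wv)).
have N10 : 0 <= N + 1 by rewrite addr_ge0.
(* [w v] lies between -1 and [N], so that [N - w v] lies between 0 and [N + 1]. *)
have zN : bounded_by (N + 1) (fun x => N%:C *: x - w (v x)).
  apply: bounded_by_opos_le => //; first by have [] := bounded_opos N0 xadj xN.
  by apply: opos_ext xge => x; rewrite rmorphD; lincomb R; ring.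
have gN := bounded_by_comp s0 vN (bounded_by_comp N10 zN wN).
(* As [N = 2 c], one has [h^2 = c^2 - y (N - y)], whence the bound [K] on [h^2]. *)
pose h x := c%:C *: x - v (w x).
have hadj : isadj h h.
  by apply: isadjB => //; apply: isadj_scaleR; exact: isadj_id.
pose K := c ^+ 2 + N * (N + 1).
have K0 : 0 <= K by rewrite addr_ge0 ?sqr_ge0 ?mulr_ge0.
have hh : bounded_by K (h \o h).
  have := bounded_byB (bounded_byZ (c ^+ 2) (@bounded_by_id R A)) gN.
  have -> : `|c ^+ 2| * 1 + Num.sqrt N * ((N + 1) * Num.sqrt N) = K.
    by rewrite mulr1 ger0_norm ?sqr_ge0 // mulrCA ss [(N + 1) * N]mulrC.
  apply: eq_bounded_by => x.
  rewrite /h /= !linearB !linearZ /= [X in X%:C *: - v _]Nc.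
  by lincomb R; ring.
have hN : bounded_by (Num.sqrt K) h.
  by apply: bounded_by_cstar hadj _; rewrite ?sqrtr_ge0 ?sqr_sqrtr.
(* Gives [1 <= sqrt K - c], so that [y <= 1] implies the upper half of [|y| <= sqrt K - c]; the
   lower half is [h <= sqrt K]. *)
have leK : c + 1 <= Num.sqrt K.
  have c1 : 0 <= c + 1 by lra.
  rewrite -(ger0_norm c1).
  by rewrite -sqrtr_sqr ler_sqrt // /K; nra.
have N1pos : 0 <= Num.sqrt K - c by lra.
have : N <= Num.sqrt K - c.
  apply: Nmin => //; apply: bounded_by_opos => //.
    have [_ hpos] := bounded_opos (sqrtr_ge0 K) hadj hN.
    by apply: opos_ext hpos => x; rewrite /h rmorphB; lincomb R; ring.
  have ge0 : 0 <= Num.sqrt K - c - 1 by lra.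
  apply: opos_ext (oposD yle (opos_scale _ ge0)) => x.
  by rewrite !rmorphB /=; lincomb R; ring.
(* For [N > 1] this is impossible: [9 N^2 / 4 <= N^2 / 4 + N (N + 1)] means [N^2 <= N]. *)
move=> NK; have : (3 / 2 * N) ^+ 2 <= K.
  have N30 : 0 <= 3 / 2 * N by nra.
  rewrite -[leRHS](sqr_sqrtr K0) ler_sqr ?nnegrE ?sqrtr_ge0 //; lra.
rewrite /K; nra.
Qed.

(* For [a = v w] of norm at most 1 and [d^2 = 1 - a], the element
   [y = 4 d a d = 1 - (1 - 2 d^2)^2] is again of this form and at most 1; the
   bound [y >= - 4^-k] turns into [a >= - 4^-(k+1)]. *)
Lemma opos_adj_mul_approx k (w v : {linear A -> A}) : isadj w v -> bounded w ->
  bounded_by 1 (v \o w) ->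
  opos (fun x => v (w x) + ((4^-1) ^+ k)%:C *: x).
Proof.
elim: k w v => [|k IH] w v wv wb a1.
  have aa : isadj (v \o w) (v \o w) by exact: (isadj_comp (isadj_sym wv) wv).
  have [apos _] := bounded_opos ler01 aa a1.
  by apply: opos_ext apos => x; rewrite expr0 addrC.
have vb := bounded_adj wv wb; have ab := bounded_comp vb wb.
have aa : isadj (v \o w) (v \o w) by exact: (isadj_comp (isadj_sym wv) wv).
apply: opos_closed => [|e e0].
  by apply: boundedD => //; apply: boundedZ; exact: bounded_id.
have [_ /opos_sqrt/(_ e0)[d0 [d0adj d0b d0sq _]]] := bounded_opos ler01 aa a1.
(* Rescaling [d0^2 = 1 - a + e] by [kap] absorbs the shift: [d^2 = 1 - kap a]. *)
pose kap := (1 + e)^-1; have e10 : 0 < 1 + e by rewrite addr_gt0.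
have kap0 : 0 < kap by rewrite invr_gt0.
have dadj := isadj_scaleR (Num.sqrt kap) d0adj.
have db := boundedZ (Num.sqrt kap) d0b.
have [d dE] := isadj_linear dadj.
have dx x : d x = (Num.sqrt kap)%:C *: d0 x by rewrite -dE.
rewrite {}dE in dadj db.
have kap1 : kap * (1 + e) = 1 by rewrite mulVf // gt_eqF.
have dsq x : d (d x) = x - kap%:C *: v (w x).
  rewrite !dx linearZ /= d0sq scalerA -rmorphM -expr2 sqr_sqrtr ?(ltW kap0) //=.
  transitivity ((kap * (1 + e))%:C *: x - kap%:C *: v (w x)).
    by lincomb R; ring.
  by rewrite kap1 scale1r.
have ksq x : kap%:C *: v (w x) = x - d (d x) by rewrite dsq; lincomb R; ring.
(* [c^2 = 4 kap] makes [v2 w2 = 4 d (kap a) d = 4 (d^2 - d^4)]. *)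
pose c := 2 * Num.sqrt kap.
have wvadj : isadj (fun x => c%:C *: w (d x)) (fun x => c%:C *: d (v x)).
  by have := isadj_scale c%:C (isadj_comp wv dadj); rewrite conj_real_complex.
have [w2 w2E] := isadj_linear wvadj.
have [v2 v2E] := isadj_linear (isadj_sym wvadj).
have w2x x : w2 x = c%:C *: w (d x) by rewrite -w2E.
have v2x x : v2 x = c%:C *: d (v x) by rewrite -v2E.
have w2b : bounded w2 by rewrite -w2E; exact: boundedZ (bounded_comp wb db).
rewrite w2E v2E in wvadj.
have cc : c * c = 4 * kap.
  by rewrite /c mulrACA -expr2 -expr2 sqr_sqrtr ?(ltW kap0) // -natrX.
have y2 x : v2 (w2 x) = (4%:R)%:C *: (d (d x) - d (d (d (d x)))).
  have kd : kap%:C *: d (v (w (d x))) = d (d x) - d (d (d (d x))).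
    by have := congr1 d (ksq (d x)); rewrite linearZ linearB.
  by rewrite v2x w2x !linearZ /= scalerA -rmorphM cc rmorphM /= -scalerA kd.
pose h0 x := x - (2%:R)%:C *: d (d x).
have hadj0 : isadj h0 h0.
  apply: isadjB; first exact: isadj_id.
  exact: isadj_scaleR (isadj_comp dadj dadj).
have hb0 : bounded h0.
  by apply: boundedB; [exact: bounded_id|exact: boundedZ (bounded_comp db db)].
have [h hE] := isadj_linear hadj0.
have hx x : h x = x - (2%:R)%:C *: d (d x) by rewrite -hE.
rewrite hE in hadj0 hb0.
have hh x : h (h x) = x - v2 (w2 x).
  by rewrite !hx y2 !linearB !linearZ /=; lincomb R; ring.
have hpos := opos_sqr hadj0 hb0.
have yle : opos (fun x => 1%:C *: x - v2 (w2 x)).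
  by apply: opos_ext hpos => x /=; rewrite hh scale1r.
(* With the selfadjoint [p = w2 + v2] and [q = i (w2 - v2)], one has
   [w2 v2 = (p^2 + q^2) / 2 - v2 w2]; so [1 + w2 v2] is the sum of [1 - v2 w2] and of halves of
   squares. *)
have xge : opos (fun x => 1%:C *: x + w2 (v2 x)).
  have v2b := bounded_adj wvadj w2b.
  have padj : isadj (fun x => w2 x + v2 x) (fun x => w2 x + v2 x).
    have pe : (fun x => w2 x + v2 x) = fun x => v2 x + w2 x.
      by apply/funext => x; rewrite addrC.
    by rewrite [X in isadj _ X]pe; exact: isadjD wvadj (isadj_sym wvadj).
  have qadj : isadj (fun x => 'i *: (w2 x - v2 x)) (fun x => 'i *: (w2 x - v2 x)).
    have qe : (fun x => 'i *: (w2 x - v2 x)) = fun x => 'i^* *: (v2 x - w2 x).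
      by apply/funext => x; rewrite conjCi; lincomb R; ring.
    by rewrite [X in isadj _ X]qe; exact: isadj_scale (isadjB wvadj (isadj_sym wvadj)).
  have pb := boundedD w2b v2b.
  have qb : bounded (fun x => 'i *: (w2 x - v2 x)).
    by have [M M0 fM] := boundedB w2b v2b; exists M => //; exact: bounded_byZi.
  have [p pE] := isadj_linear padj; have [q qE] := isadj_linear qadj.
  have px x : p x = w2 x + v2 x by rewrite -pE.
  have qx x : q x = 'i *: (w2 x - v2 x) by rewrite -qE.
  rewrite pE qE in padj qadj pb qb.
  have half0 : 0 <= 2^-1 :> R by rewrite invr_ge0.
  have ppos := oposZ half0 (oposD (opos_sqr padj pb) (opos_sqr qadj qb)).
  apply: opos_ext (oposD yle ppos) => x /=.
  have -> : p (p x) + q (q x) = (2%:R)%:C *: (w2 (v2 x) + v2 (w2 x)).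
    rewrite !px !qx !(linearZ, linearD, linearN) /= !(scalerDr, scalerN) !scale_ii.
    by lincomb R; ring.
  rewrite scalerA -rmorphM mulVf ?pnatr_eq0 //; lincomb R; ring.
have y1 := bounded_by_adj_mul wvadj w2b yle xge.
have ypos := IH _ _ wvadj w2b y1.
pose q := (4^-1 : R) ^+ k; have q0 : 0 <= q by rewrite exprn_ge0 ?invr_ge0.
(* [y >= - q] gives [h^2 = 1 - y <= 1 + q <= (1 + q / 2)^2], hence [h >= - (1 + q / 2)]; and
   [1 + h = 2 kap a]. *)
have hle : bounded_by (1 + q) (h \o h).
  apply: bounded_by_opos_le => //; first by rewrite addr_ge0.
  by apply: opos_ext ypos => x /=; rewrite hh -/q; lincomb R; ring.
have q2 : 0 <= 1 + q / 2 by rewrite addr_ge0 ?divr_ge0.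
have hle2 : bounded_by (1 + q / 2) h.
  apply: bounded_by_cstar hadj0 _ => //; apply: bounded_byW hle; nra.
have [hp _] := bounded_opos q2 hadj0 hle2.
have kap20 : 0 <= (2 * kap)^-1 by rewrite invr_ge0 mulr_ge0 // ltW.
(* The difference between [q / 4 + e], which is required, and [(q / 4) (1 + e)], which comes out
   after division by [2 kap]. *)
have qe0 : 0 <= e * (1 - q / 4).
  have q1 : q <= 1 by rewrite /q exprn_ile1 ?invr_ge0 ?invf_le1 ?ler1n.
  by rewrite mulr_ge0 ?(ltW e0) //; lra.
apply: opos_ext (oposD (oposZ kap20 hp) (opos_scale _ qe0)) => x.
have -> : (1 + q / 2)%:C *: x + h x =
    (2 * kap)%:C *: v (w x) + (q / 2)%:C *: x.
  by rewrite hx dsq; lincomb R; ring.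
rewrite scalerDr !scalerA -!rmorphM /= mulVf ?gt_eqF ?mulr_gt0 //.
have -> : (2 * kap)^-1 * (q / 2) = q / 4 * (1 + e).
  by rewrite invfM /kap invrK; field.
rewrite exprS -/q [4^-1 * q]mulrC; lincomb R; ring.
Qed.

(** Once [w] is scaled to norm at most 1, the lower bounds [- 4^-n] tend to 0, and the order is
    closed. *)
Lemma opos_adj_mul (w v : {linear A -> A}) : isadj w v -> bounded w ->
  opos (v \o w).
Proof.
move=> wv wb; have vb := bounded_adj wv wb; have [M M0 wM] := wb.
have vM := bounded_by_adj wv wM.
pose k := (M + 1)^-1; have M1 : 0 < M + 1 by rewrite ltr_wpDl.
have wv' := isadj_scale k%:C wv; rewrite conj_real_complex in wv'.
have [w' w'E] := isadj_linear wv'; have [v' v'E] := isadj_linear (isadj_sym wv').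
have w'x x : w' x = k%:C *: w x by rewrite -w'E.
have v'x x : v' x = k%:C *: v x by rewrite -v'E.
have k0 : 0 <= k by rewrite invr_ge0 ltW.
have w'1 : bounded_by 1 w'.
  rewrite -w'E; apply: bounded_byW (bounded_byZ k wM).
  by rewrite ger0_norm // mulrC ler_pdivrMr // mul1r lerDl.
rewrite w'E v'E in wv'; have w'b : bounded w' by exists 1.
have v'1 := bounded_by_adj wv' w'1.
have a1 := bounded_by_comp ler01 v'1 w'1; rewrite mulr1 in a1.
have a'pos : opos (v' \o w').
  apply: opos_closed => [|e e0]; first by exists 1.
  have [n ne] : exists n, (4^-1 : R) ^+ n <= e.
    have [n ne] := inv_small e0; exists n.+1.
    apply: le_trans (ne n (leqnn n)); rewrite exprVn lef_pV2 ?posrE ?exprn_gt0 //.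
    by rewrite -natrX ler_nat ltnW // ltn_expl.
  have e'0 : 0 <= e - (4^-1 : R) ^+ n by rewrite subr_ge0.
  apply: opos_ext (oposD (opos_adj_mul_approx n wv' w'b a1) (opos_scale _ e'0)) => x.
  by rewrite rmorphB; lincomb R; ring.
apply: opos_ext (oposZ (sqr_ge0 (M + 1)) a'pos) => x /=.
rewrite v'x w'x [v _]linearZ /= !scalerA -!rmorphM /=.
have -> : (M + 1) ^+ 2 * k * k = 1 by rewrite /k; field; rewrite gt_eqF.
by rewrite scale1r.
Qed.

(** With [f + d = r^2], [v f w + d v w] is the adjoint of [r w] times [r w]; and [v w <= M^2] bounds
    the excess by [d M^2], so that [d = e / (M^2 + 1)] suffices. *)
Lemma opos_conj f (w v : {linear A -> A}) : opos f -> isadj w v -> bounded w ->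
  opos (fun x => v (f (w x))).
Proof.
move=> fpos wv wb; have vb := bounded_adj wv wb; have [M M0 wM] := wb.
have fb := opos_bounded fpos.
apply: opos_closed => [|e e0].
  exact: (bounded_comp vb (bounded_comp fb wb)).
have M1 : 0 < M ^+ 2 + 1 by rewrite ltr_wpDl ?sqr_ge0.
pose d := e / (M ^+ 2 + 1); have d0 : 0 < d by rewrite divr_gt0.
have [r [rr rb rsq _]] := opos_sqrt fpos d0.
have rw := isadj_comp rr wv; have rwb := bounded_comp rb wb.
have [u uE] := isadj_linear rw; have [u' u'E] := isadj_linear (isadj_sym rw).
have ux x : u x = r (w x) by rewrite -uE.
have u'x x : u' x = v (r x) by rewrite -u'E.
rewrite uE u'E in rw rwb.
have vw : bounded_by (M * M) (v \o w).
  exact: bounded_by_comp M0 (bounded_by_adj wv wM) wM.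
have vwadj : isadj (v \o w) (v \o w) by exact: (isadj_comp (isadj_sym wv) wv).
have [_ vwle] := bounded_opos (mulr_ge0 M0 M0) vwadj vw.
apply: opos_ext (oposD (oposD (opos_adj_mul rw rwb) (oposZ (ltW d0) vwle))
                       (opos_scale _ (ltW d0))) => x /=.
rewrite u'x ux rsq linearD linearZ /=.
have -> : e = d * (M ^+ 2 + 1) by rewrite /d mulfVK // gt_eqF.
by lincomb R; ring.
Qed.

End PositivityOfSquares.

(** * From operators back to elements of A *)

Section SelfadjointElements.
Context (R : realType) (A : cstarAlgType R).
Implicit Types (a b x y : A) (t M e : R).

(** Evaluated at [a*], the bound turns into one on [|a|^2] by the C*-identity. *)
Lemma bounded_by_amulP a M : 0 <= M -> bounded_by M (amul a) -> rnorm a <= M.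
Proof.
move=> M0 aM; have [->|a0] := eqVneq a 0; first by rewrite rnorm0.
have := aM (star a); rewrite -{1}(starK a) rnorm_cstar !rnorm_star expr2.
by rewrite ler_pM2r // lt_def rnorm_eq0 a0 rnorm_ge0.
Qed.

Lemma amul_inj a b : amul a = amul b -> a = b.
Proof.
move=> ab; rewrite -(starK a) -(starK b); congr star; apply: amul_star_inj => x.
by rewrite -!star_amul ab.
Qed.

Lemma isadj_amul_sa a : isadj (amul a) (amul a) -> star a = a.
Proof.
move=> aa; apply: amul_inj; apply/funext => y; apply: amul_star_inj => x.
by rewrite -aa star_amul amulA.
Qed.

Lemma selfadjoint_amul a : star a = a -> isadj (amul a) (amul a).
Proof. by move=> aa; rewrite -{2}aa; exact: isadj_amul. Qed.

(** The iterates are left multiplications by elements of A; these form a Cauchy sequence, since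
    multiplication reflects norms, and the limit represents [c]. Representations act on elements
    only, hence this version of the square root for them. *)
Lemma sqrt_element (s : A) (rho : R) : 0 <= rho < 1 -> star s = s ->
  rnorm s <= rho ^+ 2 ->
  exists2 c, star c = c & s = (2%:R)%:C *: c - amul c c.
Proof.
move=> rho01 ss sM.
have sM' : bounded_by (rho ^+ 2) (amul s) := bounded_byW sM (bounded_by_amul s).
have [u [c [u0 uS uu uc [_ sE]]]] :=
  sqrt_fixpoint rho01 (selfadjoint_amul ss) sM'.
have /choice[a aE] : forall n, exists a : A, u n = amul a.
  elim=> [|n [a ua]]; first by exists 0; rewrite u0; apply/funext => x; rewrite amul0l.
  exists ((2^-1)%:C *: (s + amul a a)); rewrite uS ua; apply/funext => x.
  by rewrite !amulE amulA.
have [l al] : exists l, rcvg a l.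
  apply: rcauchy_cvg => e e0; have [|N cN] := uc (e / 2); first by rewrite divr_gt0.
  exists N => m n Nm Nn; apply: bounded_by_amulP; first exact: ltW.
  have := bounded_byB (cN n Nn) (cN m Nm); rewrite -splitr.
  by apply: eq_bounded_by => x; rewrite !aE !amulE; lincomb R; ring.
have cl : c = amul l.
  apply/funext => x; apply: rnorm_eq_small => e e0.
  pose e' := e / 2 / (rnorm x + 1).
  have e'0 : 0 < e' by rewrite !divr_gt0 // ltr_wpDl ?rnorm_ge0.
  have le_e : e' * rnorm x <= e / 2.
    by apply: ler_div_succ; rewrite ?rnorm_ge0 ?divr_ge0 ?(ltW e0).
  have [N cN] := uc _ e'0; have [N' lN'] := al _ e'0.
  pose n := maxn N N'.
  rewrite (le_trans (rnorm_dist (u n x) _ _)) // [leRHS](splitr e) lerD //.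
    by rewrite (le_trans (cN _ (leq_maxl _ _) x)).
  rewrite aE -amulNl -amulDl (le_trans (rnorm_amul _ _)) //.
  rewrite (le_trans _ le_e) // ler_wpM2r ?rnorm_ge0 // rnorm_distC.
  by rewrite lN' ?leq_maxr.
exists l.
  by apply: isadj_amul_sa; rewrite -cl; exact: unif_cvg_isadj uu uc.
by apply: amul_inj; apply/funext => x; rewrite sE cl !amulE amulA.
Qed.

Lemma opos_apositive a : apositive a -> opos (amul a).
Proof.
move=> [b ->].
have [w wE] := isadj_linear (isadj_amul b).
have [v vE] := isadj_linear (isadj_sym (isadj_amul b)).
have := @opos_adj_mul R A w v; rewrite -wE -vE.
move=> /(_ (isadj_amul b) (bounded_amul b)); apply: opos_ext => x.
by rewrite /= amulA.
Qed.

End SelfadjointElements.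

(** * The Hahn-Banach theorem *)

Section HahnBanach.
Context (R : realType) (V : lmodType R[i]).
Implicit Types (p q : V -> R) (x y : V) (t : R).

Definition sublinear p := (forall x y, p (x + y) <= p x + p y) /\
  (forall t x, 0 < t -> p (t%:C *: x) <= t * p x).

Definition real_linear f := (forall x y, f (x + y) = f x + f y) /\
  (forall t x, f (t%:C *: x) = t * f x).

Lemma sublinearZ p t x : sublinear p -> 0 < t -> p (t%:C *: x) = t * p x.
Proof.
move=> [_ pZ] t0; apply/eqP; rewrite eq_le pZ //=.
rewrite -ler_pdivlMl // -[x in p x](scale1r x).
have {1}-> : (1 : R[i]) = (t^-1)%:C * t%:C by rewrite -rmorphM mulVf ?gt_eqF.
by rewrite -scalerA pZ ?invr_gt0.
Qed.

Lemma sublinear0 p : sublinear p -> p 0 = 0.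
Proof.
move=> psub; have := sublinearZ 0 psub (ltr0n R 2); rewrite scaler0.
by move=> p2; lra.
Qed.

Lemma sublinear_lb p x : sublinear p -> - p (- x) <= p x.
Proof.
move=> psub; rewrite -subr_ge0 opprK -(sublinear0 psub) -(subrr x).
exact: psub.1.
Qed.

(** An infimum of sublinear functionals is not subadditive in general; the family has to absorb
    scaling and sums. Chains, translates along a direction and the cone used for separation all
    do. *)
Lemma sublinear_inf (I : Type) (F : set I) (q : I -> V -> R) (lb : V -> R) :
  F !=set0 -> (forall i x, F i -> lb x <= q i x) ->
  (forall i t x, F i -> 0 < t ->
     exists2 k, F k & q k (t%:C *: x) <= t * q i x) ->
  (forall i j x y, F i -> F j ->
     exists2 k, F k & q k (x + y) <= q i x + q j y) ->
  sublinear (fun x => inf [set q i x | i in F]).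
Proof.
move=> [i0 Fi0] qlb qZ qD.
have infF x : has_inf [set q i x | i in F].
  by split; [exists (q i0 x), i0|exists (lb x) => _ [i Fi <-]; exact: qlb].
split=> [x y|t x t0] /=.
  rewrite -lerBlDr; apply: lb_le_inf; first exact: (infF _).1.
  move=> _ [i Fi <-]; rewrite lerBlDr -lerBlDl.
  apply: lb_le_inf; first exact: (infF _).1.
  move=> _ [j Fj <-]; rewrite lerBlDl.
  have [k Fk kle] := qD i j x y Fi Fj; apply: le_trans kle.
  by apply: ge_inf; [exact: (infF _).2|exists k].
rewrite -ler_pdivrMl //; apply: lb_le_inf; first exact: (infF _).1.
move=> _ [i Fi <-]; rewrite ler_pdivrMl //.
have [k Fk kle] := qZ i t x Fi t0; apply: le_trans kle.
by apply: ge_inf; [exact: (infF _).2|exists k].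
Qed.

(* A minimal sublinear functional is linear: it coincides with the smaller
   functional [x |-> inf_(t > 0) q (x + t y) - t q y]. *)
Lemma hahn_banach p : sublinear p ->
  exists2 f, real_linear f & forall x, f x <= p x.
Proof.
move=> psub; pose P q := sublinear q /\ forall x, q x <= p x; pose T := {q | P q}.
(* [q'] comes after [q] when it lies below it, so that a maximal element for Zorn's lemma is a
   minimal functional. *)
pose r (q q' : T) := `[< forall x, sval q' x <= sval q x >].
have rr (q : T) : r q q by apply/asboolP.
have [||chain|q qmin] := Zorn rr.
- move=> q1 q2 q3 /asboolP q12 /asboolP q23; apply/asboolP => x.
  exact: le_trans (q23 x) (q12 x).
- move=> [q1 P1] [q2 P2] /asboolP /= q12 /asboolP /= q21.
  by apply: eq_exist; apply/funext => x; apply/eqP; rewrite eq_le q12 q21.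
- move=> tot; have [[c0 Fc0]|F0] := pselect (chain !=set0); last first.
    exists (exist P p (conj psub (fun x => lexx (p x)))) => s Fs.
    by exfalso; apply: F0; exists s.
  have lb (i : T) x : chain i -> - p (- x) <= sval i x.
    move=> _; apply: le_trans (sublinear_lb _ (svalP i).1).
    by rewrite lerN2 (svalP i).2.
  have infs : sublinear (fun x => inf [set sval i x | i in chain]).
    apply: (sublinear_inf (lb := fun x => - p (- x))) => //; first by exists c0.
      by move=> i t x Fi t0; exists i => //; rewrite (sublinearZ _ (svalP i).1).
    move=> i j x y Fi Fj; have [/asboolP ij|/asboolP ji] := tot i j Fi Fj.
      exists j => //; rewrite (le_trans ((svalP j).1.1 _ _)) // lerD2r.
      exact: ij.
    exists i => //; rewrite (le_trans ((svalP i).1.1 _ _)) // lerD2l.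
    exact: ji.
  have hlb x : has_lbound [set sval i x | i in chain].
    by exists (- p (- x)) => _ [i Fi <-]; exact: lb.
  have infp x : inf [set sval i x | i in chain] <= p x.
    by apply: le_trans ((svalP c0).2 x); apply: ge_inf => //; exists c0.
  exists (exist P _ (conj infs infp)) => s Fs; apply/asboolP => x /=.
  by apply: ge_inf => //; exists s.
have [[qD qZ] qp] := svalP q; set f := sval q in qD qZ qp.
have fsub : sublinear f by [].
exists f => //.
have fD x y : f (x + y) = f x + f y.
  apply/eqP; rewrite eq_le qD /=.
  have fy : sublinear (fun x => inf [set f (x + t%:C *: y) - t * f y | t in [set t : R | 0 <= t]]).
    apply: (sublinear_inf (lb := fun x => - f (- x))).
    - by exists 0 => /=.
    - move=> t z /= t0; have [->|t_neq0] := eqVneq t 0.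
        by rewrite scale0r addr0 mul0r subr0 sublinear_lb.
      have {}t0 : 0 < t by rewrite lt_def t_neq0.
      rewrite lerBrDr -(sublinearZ _ fsub t0) addrC lerBlDr addrC.
      by apply: le_trans (qD _ _); rewrite addrA addNr add0r.
    - move=> t s z /= t0 s0; exists (s * t); first by rewrite /= mulr_ge0 // ltW.
      rewrite mulrBr -mulrA lerD2r -(sublinearZ _ fsub s0).
      by rewrite scalerDr scalerA -rmorphM.
    - move=> t t' z z' /= t0 t'0; exists (t + t'); first exact: addr_ge0.
      rewrite mulrDl opprD addrACA lerD2r.
      apply: le_trans (qD _ _); rewrite rmorphD scalerDl addrACA //.
  set g := fun x => _ in fy.
  have glb z : has_lbound [set f (z + t%:C *: y) - t * f y | t in [set t : R | 0 <= t]].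
    exists (- f (- z)) => _ [t /= t0 <-]; have [->|t_neq0] := eqVneq t 0.
      by rewrite scale0r addr0 mul0r subr0 sublinear_lb.
    have {}t0 : 0 < t by rewrite lt_def t_neq0.
    rewrite lerBrDr -(sublinearZ _ fsub t0) addrC lerBlDr addrC.
    by apply: le_trans (qD _ _); rewrite addrA addNr add0r.
  have gf z : g z <= f z.
    by apply: ge_inf => //; exists 0 => //=; rewrite scale0r addr0 mul0r subr0.
  have gp z : g z <= p z := le_trans (gf z) (qp z).
  have := qmin (exist P g (conj fy gp)).
  move=> /(_ _)/(congr1 sval) /= gq.
  have -> : f x = g x.
    by rewrite gq //; apply/asboolP.
  (* The index 1 of the infimum gives [g x <= f (x + y) - f y]. *)
  rewrite -lerBrDr; apply: ge_inf => //; exists 1 => //=.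
  by rewrite scale1r mul1r.
have f0 : f 0 = 0 by exact: sublinear0.
have fN x : f (- x) = - f x.
  by apply/eqP; rewrite -subr_eq0 opprK -fD addNr f0.
split=> // t x; have [t0|t0|->] := ltgtP t 0; last by rewrite scale0r mul0r f0.
  have Nt0 : 0 < - t by rewrite oppr_gt0.
  rewrite -{1}[t]opprK rmorphN scaleNr fN (sublinearZ _ fsub Nt0) mulNr.
  by rewrite opprK.
by rewrite (sublinearZ _ fsub t0).
Qed.

End HahnBanach.

(** * Hilbert modules and separation *)

Section HilbertModules.
Context (R : realType) (A : cstarAlgType R) (E : hilbertModType A).
Implicit Types (a b : A) (t : R).

Lemma mipDr (x y z : E) : mip x (y + z) = mip x y + mip x z.
Proof. by rewrite -{1}(scale1r y) mip_linearr scale1r. Qed.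

Lemma mip0r (x : E) : mip x 0 = 0.
Proof. by apply: (addrI (mip x 0)); rewrite -mipDr !addr0. Qed.

Lemma mipZr (k : R[i]) (x y : E) : mip x (k *: y) = k *: mip x y.
Proof. by rewrite -[k *: y]addr0 mip_linearr mip0r addr0. Qed.

Lemma mipNr (x y : E) : mip x (- y) = - mip x y.
Proof. by rewrite -scaleN1r mipZr scaleN1r. Qed.

Lemma mipDl (x y z : E) : mip (x + y) z = mip x z + mip y z.
Proof. by rewrite mip_star mipDr starD -!mip_star. Qed.

Lemma mipZl (k : R[i]) (x y : E) : mip (k *: x) y = k^* *: mip x y.
Proof. by rewrite mip_star mipZr starZ -mip_star. Qed.

Lemma mipNl (x y : E) : mip (- x) y = - mip x y.
Proof. by rewrite mip_star mipNr starN -mip_star. Qed.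

Lemma mip0l (x : E) : mip 0 x = 0.
Proof. by rewrite mip_star mip0r star0. Qed.

Definition mipE := (mipDl, mipDr, mipZl, mipZr, mipNl, mipNr).

Lemma ract0r (x : E) : ract x (0 : A) = 0.
Proof.
have := ract_linearr x 1 (0 : A) 0; rewrite scaler0 addr0 scale1r => e.
by apply: (addrI (ract x 0)); rewrite -e addr0.
Qed.

Lemma mip_ractl (x y : E) a : mip (ract x a) y = amul (star a) (mip x y).
Proof. by rewrite mip_star mip_ract star_amul -mip_star. Qed.

Lemma rnorm_mip (x : E) : rnorm (mip x x) = rnorm x ^+ 2.
Proof.
apply: (@complexI R); rewrite rmorphXn /= -!normE [`|x|]normr_mip.
by rewrite sqrtCK.
Qed.

Lemma opos_mip (x : E) : opos (amul (mip x x)).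
Proof. exact: opos_apositive (mip_positive x). Qed.

Lemma rnormi : rnorm ('i : R[i]) = 1.
Proof. by apply: (@complexI R); rewrite -normE normCi. Qed.

(* By polarization, hence the constant. *)
Lemma rnorm_mip_le (x y : E) : rnorm (mip x y) <= 4 * rnorm x * rnorm y.
Proof.
have sq (v w : E) : rnorm v <= 1 -> rnorm w <= 1 -> rnorm (mip (v + w) (v + w)) <= 4.
  move=> v1 w1; rewrite rnorm_mip; have := rnormD v w.
  have := rnorm_ge0 (v + w); nra.
have aux (v w : E) : rnorm v <= 1 -> rnorm w <= 1 -> rnorm (mip v w) <= 4.
  move=> v1 w1; have w1' : rnorm (- w) <= 1 by rewrite rnormN.
  have wi : rnorm ('i *: w) <= 1 by rewrite rnormZ rnormi mul1r.
  have wi' : rnorm (- ('i *: w)) <= 1 by rewrite rnormN.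
  have -> : mip v w = (4^-1)%:C *:
     (mip (v + w) (v + w) - mip (v - w) (v - w)
      - ('i *: mip (v + 'i *: w) (v + 'i *: w)
        - 'i *: mip (v - 'i *: w) (v - 'i *: w))).
    apply: (@eq_scaleV R _ 3); rewrite !mipE conjCi.
    rewrite !(scalerDr, scalerN, scaleNr, opprD, opprK) !scale_ii.
    by lincomb R; ring.
  rewrite rnormZc ger0_norm ?invr_ge0 // ler_pdivrMl //.
  have := sq _ _ v1 w1; have := sq _ _ v1 w1'; have := sq _ _ v1 wi; have := sq _ _ v1 wi'.
  set a := mip (v + w) _; set b := mip (v - w) _.
  set c := mip (v + 'i *: w) _; set d := mip (v - 'i *: w) _ => d4 c4 b4 a4.
  have := rnormB (a - b) ('i *: c - 'i *: d); have := rnormB a b.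
  have := rnormB ('i *: c) ('i *: d); rewrite !rnormZ rnormi; lra.
have [->|x0] := eqVneq x 0; first by rewrite mip0l !rnorm0 mulr0 mul0r.
have [->|y0] := eqVneq y 0; first by rewrite mip0r !rnorm0 mulr0.
have px : 0 < rnorm x by rewrite lt_def rnorm_eq0 x0 rnorm_ge0.
have py : 0 < rnorm y by rewrite lt_def rnorm_eq0 y0 rnorm_ge0.
have := aux ((rnorm x)^-1%:C *: x) ((rnorm y)^-1%:C *: y).
rewrite !rnormZc !gtr0_norm ?invr_gt0 // !mulVf ?gt_eqF // => /(_ (lexx _) (lexx _)).
rewrite !mipE conj_real_complex !rnormZc !gtr0_norm ?invr_gt0 //.
by rewrite !ler_pdivrMl // mulrC [rnorm x * 4]mulrC.
Qed.

Definition mip2 (w : E * E) : A := mip w.1 w.1 + mip w.2 w.2.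

Lemma opos_mip2 w : opos (amul (mip2 w)).
Proof.
apply: opos_ext (oposD (opos_mip w.1) (opos_mip w.2)) => x.
by rewrite /mip2 amulDl.
Qed.

Definition separated (L : set (E * E)) (u : E * E) (d : R) :=
  forall l, L l -> d <= rnorm (mip2 (u - l)).

(** * Separation of a point from a subspace by a functional on A *)

Section Separation.
Context (L : set (E * E)) (u : E * E) (d : R).
Hypothesis L0 : L 0.
Hypothesis LD : forall l l' : E * E, L l -> L l' -> L (l + l').
Hypothesis LZ : forall t (l : E * E), L l -> L (t%:C *: l).
Hypothesis d0 : 0 < d.
Hypothesis dL : separated L u d.

(** A triple is [(S, lam, x)]: the element [lam + x] of the unitization dominates
    [S <u - l, u - l>]. The multiplicity [S] homogenizes a convex function of [l], which is why sums
    of triples stay in the set. *)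
Let cone (c : R * R * A) := 0 <= c.1.1 /\
  exists2 l, L l & opos (fun z => c.1.2%:C *: z + amul c.2 z
                              - c.1.1%:C *: amul (mip2 (u - l)) z).

Let cone0 : cone (0, 0, 0).
Proof.
split=> //=; exists 0 => //; apply: opos_ext (@opos0 R A) => z.
by rewrite amul0l !scale0r subr0 addr0.
Qed.

Let coneZ t c : 0 <= t -> cone c -> cone (t * c.1.1, t * c.1.2, t%:C *: c.2).
Proof.
move=> t0 [S0 [l Ll cl]]; split=> /=; first exact: mulr_ge0.
exists l => //; apply: opos_ext (oposZ t0 cl) => z.
by rewrite !amulE; lincomb R; ring.
Qed.

(* Convexity of [l |-> mip2 (u - l)]. *)
Let coneD c c' : cone c -> cone c' ->
  cone (c.1.1 + c'.1.1, c.1.2 + c'.1.2, c.2 + c'.2).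
Proof.
move: c c' => [[S lam] x] [[S' lam'] x'] [/= S0 [l Ll cl]] [/= S'0 [l' Ll' cl']].
split=> /=; first exact: addr_ge0.
have [SS|SS] := eqVneq (S + S') 0.
  have /andP[/eqP Se /eqP S'e] : (S == 0) && (S' == 0) by rewrite -paddr_eq0 ?SS.
  exists l => //; apply: opos_ext (oposD cl cl') => z; rewrite Se S'e.
  by rewrite !amulE; lincomb R; ring.
pose p := S / (S + S'); pose q := S' / (S + S').
have pq : p + q = 1 by rewrite -mulrDl mulfV.
exists (p%:C *: l + q%:C *: l'); first by apply: LD; exact: LZ.
have k0 : 0 <= p * q * (S + S') by rewrite !mulr_ge0 ?invr_ge0 ?addr_ge0.
apply: opos_ext (oposD (oposD cl cl') (oposZ k0 (opos_mip2 (l - l')))) => z.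
have [Se S'e] : S = p * (S + S') /\ S' = q * (S + S') by rewrite !mulfVK.
have qe : q = 1 - p by rewrite -pq addrAC subrr add0r.
move: (S + S') Se S'e => T -> ->; rewrite qe.
rewrite /mip2 /= !mipE !conj_real_complex !amulE.
by lincomb R; ring.
Qed.

(** If [f a <= value c a], then [a = - x] gives [S d <= lam + f x]: the case [S = 0] is positivity
    on the unitization, and the case [S = 1], [lam = 0] is the separation. *)
Let value (c : R * R * A) (a : A) := rnorm (a + c.2) + c.1.2 - c.1.1 * d.

(** Comes down to [S d <= lam + |x|], which keeps the infimum over the cone finite: [0 <= S <u - l,
    u - l> <= lam + x <= lam + |x|], and the norm is monotone. *)
Let cone_lb c a : cone c -> - rnorm a <= value c a.
Proof.
move: c => [[S lam] x] [/= S0 [l Ll cl]]; rewrite /value /=.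
suff : S * d <= lam + rnorm x.
  have := rnorm_dist_dist x (- a); rewrite opprK [x + a]addrC rnormN; lra.
have Spos := oposZ S0 (opos_mip2 (u - l)).
have xpos : opos (fun z => lam%:C *: z + amul x z).
  by apply: opos_ext (oposD cl Spos) => z; rewrite subrK.
have [/isadj_shift xx _] := xpos.
have [_ xle] := bounded_opos (rnorm_ge0 x) xx (bounded_by_amul x).
have kpos : opos (fun z => (lam + rnorm x)%:C *: z - amul (S%:C *: mip2 (u - l)) z).
  by apply: opos_ext (oposD cl xle) => z; rewrite !amulE; lincomb R; ring.
have {}Spos : opos (amul (S%:C *: mip2 (u - l))).
  by apply: opos_ext Spos => z; rewrite amulZl.
have [k0|k0] := leP 0 (lam + rnorm x).
  have := bounded_by_amulP k0 (bounded_by_opos_le k0 Spos kpos).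
  rewrite rnormZc ger0_norm // => Sm; apply: le_trans Sm.
  by rewrite ler_wpM2l // dL.
(* A negative scalar that is a positive operator acts as 0, so that A is trivial, against
   [d > 0]. *)
have k1 : opos (fun z : A => (lam + rnorm x)%:C *: z).
  by apply: opos_ext (oposD kpos Spos) => z; rewrite subrK.
have zero : bounded_by 0 (fun z : A => (lam + rnorm x)%:C *: z).
  apply: bounded_by_opos => //; first by apply: opos_ext k1 => z; rewrite scale0r add0r.
  have Nk0 : 0 <= - (lam + rnorm x) by rewrite oppr_ge0 ltW.
  apply: opos_ext (opos_scale _ Nk0) => z.
  by lincomb R; ring.
exfalso; have := dL L0; have := zero (mip2 (u - 0)).
rewrite rnormZc mul0r pmulr_rle0 ?normr_gt0 ?lt_eqF //.
by move=> m0 dm; have := le_trans dm m0; rewrite leNgt d0.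
Qed.

Lemma separating_functional : exists f : A -> R, [/\ real_linear f,
  forall a, f a <= rnorm a,
  forall lam a, opos (fun z => lam%:C *: z + amul a z) -> - lam <= f a &
  forall l, L l -> d <= f (mip2 (u - l))].
Proof.
have psub : sublinear (fun a => inf [set value c a | c in cone]).
  apply: (sublinear_inf (lb := fun a => - rnorm a)).
  - by exists (0, 0, 0).
  - by move=> c a /cone_lb.
  - move=> c t a cc t0; exists (t * c.1.1, t * c.1.2, t%:C *: c.2).
      exact: coneZ (ltW t0) cc.
    by rewrite /value /= -scalerDr rnormZc gtr0_norm // mulrBr mulrDr mulrA.
  - move=> c c' a a' cc cc'.
    exists (c.1.1 + c'.1.1, c.1.2 + c'.1.2, c.2 + c'.2); first exact: coneD.
    rewrite /value /= addrACA; have := rnormD (a + c.2) (a' + c'.2); lra.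
have [f flin fp] := hahn_banach psub.
have f_le c a : cone c -> f a <= value c a.
  move=> cc; apply: le_trans (fp a) _; apply: ge_inf; last by exists c.
  by exists (- rnorm a) => _ [c' /cone_lb + <-]; exact.
have fN a : f (- a) = - f a.
  by rewrite -scaleN1r -(rmorph1 (real_complex R)) -rmorphN flin.2 mulN1r.
exists f; split=> // [a|lam a apos|l Ll].
- by have := f_le _ a cone0; rewrite /value /= !addr0 mul0r subr0.
- suff /(f_le _ (- a)) : cone (0, lam, a).
    by rewrite /value /= addNr rnorm0 fN; lra.
  split=> //=; exists 0 => //; apply: opos_ext apos => z.
  by rewrite scale0r subr0.
- suff /(f_le _ (- mip2 (u - l))) : cone (1, 0, mip2 (u - l)).
    by rewrite /value /= addNr rnorm0 fN; lra.
  split=> //=; exists l => //; apply: opos_ext (@opos0 R A) => z.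
  by lincomb R; ring.
Qed.

End Separation.
End HilbertModules.

(** * Semi-inner products and completions *)

(** Definiteness is left out, as the form of a positive functional may have null vectors. The same
    lemmas serve inner products and the form on [H * H]. *)
Record semi_inner (R : realType) (V : lmodType R[i]) := SemiInner {
  form :> V -> V -> R[i] ;
  form_linearr : forall x (k : R[i]) y z,
    form x (k *: y + z) = k * form x y + form x z ;
  form_conj : forall x y, form y x = (form x y)^* ;
  form_ge0 : forall x, 0 <= form x x
}.

Section SemiInner.
Context (R : realType) (V : lmodType R[i]) (s : semi_inner V).
Implicit Types (x y z : V) (k : R[i]).

Lemma formDr x y z : s x (y + z) = s x y + s x z.
Proof. by rewrite -{1}(scale1r y) form_linearr mul1r. Qed.

Lemma form0r x : s x 0 = 0.
Proof. by apply: (addrI (s x 0)); rewrite -formDr !addr0. Qed.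

Lemma formZr k x y : s x (k *: y) = k * s x y.
Proof. by rewrite -[k *: y]addr0 form_linearr form0r addr0. Qed.

Lemma formNr x y : s x (- y) = - s x y.
Proof. by rewrite -scaleN1r formZr mulN1r. Qed.

Lemma formDl x y z : s (x + y) z = s x z + s y z.
Proof. by rewrite form_conj formDr rmorphD /= -!form_conj. Qed.

Lemma formZl k x y : s (k *: x) y = k^* * s x y.
Proof. by rewrite form_conj formZr rmorphM /= -form_conj. Qed.

Lemma formNl x y : s (- x) y = - s x y.
Proof. by rewrite form_conj formNr rmorphN /= -form_conj. Qed.

Lemma form0l x : s 0 x = 0.
Proof. by rewrite form_conj form0r rmorph0. Qed.

Definition formE := (formDl, formDr, formZl, formZr, formNl, formNr).

Definition form_norm x : R := Num.sqrt (complex.Re (s x x)).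

Lemma form_norm_ge0 x : 0 <= form_norm x. Proof. exact: sqrtr_ge0. Qed.

Lemma Re_form_ge0 x : 0 <= complex.Re (s x x).
Proof. by rewrite -lecR -rnorm_ge0_Re ?form_ge0. Qed.

Lemma form_norm_sqr x : (form_norm x ^+ 2)%:C = s x x.
Proof. by rewrite sqr_sqrtr ?Re_form_ge0 // -rnorm_ge0_Re ?form_ge0. Qed.

Lemma form_normP x (M : R) : 0 <= M -> (s x x <= (M ^+ 2)%:C) = (form_norm x <= M).
Proof.
by move=> M0; rewrite -form_norm_sqr lecR ler_sqr ?nnegrE ?form_norm_ge0.
Qed.

Lemma form_CS x y : rnorm (s x y) <= form_norm x * form_norm y.
Proof.
set a := form_norm x; set b := form_norm y; set c := rnorm (s x y).
have a0 : 0 <= a := form_norm_ge0 x; have b0 : 0 <= b := form_norm_ge0 y.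
have c0 : 0 <= c := rnorm_ge0 _.
have quad (t : R) : 0 <= a ^+ 2 - 2 * t * c ^+ 2 + t ^+ 2 * c ^+ 2 * b ^+ 2.
  pose k := t%:C * (s x y)^*.
  have kJ : k^* = t%:C * s x y by rewrite rmorphM /= conj_real_complex conjCK.
  have e : (c ^+ 2)%:C = (s x y)^* * s x y by rewrite -rnorm_sqr.
  have := form_ge0 s (x - k *: y).
  rewrite !formE (form_conj s x y) -!form_norm_sqr -/a -/b kJ -ler0c.
  congr (0 <= _).
  transitivity ((a ^+ 2)%:C - 2 * t%:C * (c ^+ 2)%:C
    + t%:C ^+ 2 * (c ^+ 2)%:C * (b ^+ 2)%:C); last by ring.
  by rewrite e /k; ring.
rewrite -ler_sqr ?nnegrE ?mulr_ge0 // exprMn.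
have [b_eq0|b_neq0] := eqVneq b 0.
  have [->|c_neq0] := eqVneq c 0; first by rewrite expr0n mulr_ge0 ?sqr_ge0.
  have cp : 0 < c ^+ 2 by rewrite exprn_gt0 // lt_def c_neq0.
  (* With [b = 0] the quadratic is [a^2 - 2 t c^2], which this [t] turns into -1. *)
  have := quad ((a ^+ 2 + 1) / (2 * c ^+ 2)); rewrite b_eq0.
  have -> : 2 * ((a ^+ 2 + 1) / (2 * c ^+ 2)) * c ^+ 2 = a ^+ 2 + 1.
    by field; exact: c_neq0.
  lra.
have bp : 0 < b ^+ 2 by rewrite exprn_gt0 // lt_def b_neq0.
have := quad (b ^- 2).
have -> : a ^+ 2 - 2 * b ^- 2 * c ^+ 2 + b ^- 2 ^+ 2 * c ^+ 2 * b ^+ 2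
    = a ^+ 2 - c ^+ 2 / b ^+ 2 by field.
by rewrite subr_ge0 ler_pdivrMr.
Qed.

Lemma form_normZ k x : form_norm (k *: x) = rnorm k * form_norm x.
Proof.
apply/eqP; rewrite -(eqrXn2 (n := 2)) ?mulr_ge0 ?rnorm_ge0 ?form_norm_ge0 //.
apply/eqP/(@complexI R); rewrite form_norm_sqr !formE exprMn rmorphM /=.
by rewrite rnorm_sqr form_norm_sqr; ring.
Qed.

Lemma form_normN x : form_norm (- x) = form_norm x.
Proof. by rewrite /form_norm formNl formNr opprK. Qed.

Lemma form_normD x y : form_norm (x + y) <= form_norm x + form_norm y.
Proof.
rewrite -form_normP ?addr_ge0 ?form_norm_ge0 //.
rewrite [leLHS]rnorm_ge0_Re ?form_ge0 // lecR !formE (form_conj s x y).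
have := form_CS x y; have := Re_le_rnorm (s x y).
rewrite -(form_norm_sqr x) -(form_norm_sqr y).
case: (s x y) => c d /=; nra.
Qed.

Lemma form_diff x x' y y' : rnorm (s x y - s x' y') <=
  form_norm (x - x') * form_norm y + form_norm x' * form_norm (y - y').
Proof.
have -> : s x y - s x' y' = s (x - x') y + s x' (y - y').
  by rewrite !formE; ring.
by rewrite (le_trans (rnormD _ _)) // lerD ?form_CS.
Qed.

End SemiInner.

Section ComplexSequences.
Context (R : realType).

Lemma real_cauchy_cvg (u : nat -> R) :
  (forall e, 0 < e -> exists N, forall m n, (N <= m)%N -> (N <= n)%N ->
     `|u m - u n| <= e) ->
  exists l, forall e, 0 < e -> exists N, forall n, (N <= n)%N -> `|l - u n| <= e.
Proof.
move=> cu; have : cvg (u @ \oo).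
  apply: (@cauchy_cvg R); apply: cauchy_exP => e e0.
  have [|N cN] := cu (e / 2); first by rewrite divr_gt0.
  exists (u N); exists N => // n /= Nn; rewrite -ball_normE /ball_ /=.
  by rewrite (le_lt_trans (cN _ _ _ _)) // ltr_pdivrMr // ltr_pMr // ltr1n.
move=> /cvg_ex[l /cvgrPdist_le ul]; exists l => e /ul[N _ lN].
by exists N => n Nn; exact: lN.
Qed.

Lemma Re_norm_le (z : R[i]) : `|complex.Re z| <= rnorm z.
Proof. by rewrite -lecR -normE normc_ge_Re. Qed.

Lemma Im_norm_le (z : R[i]) : `|complex.Im z| <= rnorm z.
Proof.
have -> : rnorm z = rnorm ('i%C * z).
  by rewrite rnormM complexiE rnormi mul1r.
by have := Re_norm_le ('i%C * z); rewrite mulrC ReiNIm normrN.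
Qed.

Lemma complex_cauchy_cvg (u : nat -> R[i]) : rcauchy u -> exists l, rcvg u l.
Proof.
move=> cu.
have [|a ua] := real_cauchy_cvg (u := fun n => complex.Re (u n)).
  move=> e /cu[N cN]; exists N => m n Nm Nn; rewrite -raddfB.
  exact: le_trans (Re_norm_le _) (cN _ _ Nm Nn).
have [|b ub] := real_cauchy_cvg (u := fun n => complex.Im (u n)).
  move=> e /cu[N cN]; exists N => m n Nm Nn; rewrite -raddfB.
  exact: le_trans (Im_norm_le _) (cN _ _ Nm Nn).
exists (a +i* b) => e e0; have e20 : 0 < e / 2 by rewrite divr_gt0.
have [N aN] := ua _ e20; have [N' bN] := ub _ e20.
exists (maxn N N') => n; rewrite geq_max => /andP[Nn N'n].
rewrite [_ - _]complexE (le_trans (rnormD _ _)) // [leRHS](splitr e).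
rewrite rnormc rnormM rnormc complexiE rnormi mul1r.
apply: lerD; first by have := aN n Nn; case: (u n).
by have := bN n N'n; case: (u n).
Qed.

End ComplexSequences.

Lemma rcauchy_complete (R : realType) (M : normedModType R[i]) :
  (forall u : nat -> M, rcauchy u -> exists l, rcvg u l) ->
  forall F : set_system M, ProperFilter F -> cauchy F -> cvg F.
Proof.
move=> cvgM F FF /cauchyP cF.
have e0 n : 0 < (n.+1%:R^-1)%:C :> R[i] by rewrite ltcR invr_gt0 ltr0n.
have /choice[u uF] : forall n, exists x : M, F (ball x (n.+1%:R^-1)%:C).
  by move=> n; exact: cF.
have ballP (x y : M) (t : R) : ball x t%:C y -> rnorm (x - y) <= t.
  by rewrite -ball_normE /ball_ /= normE ltcR => /ltW.
have [l ul] : exists l, rcvg u l.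
  apply: cvgM => e e_gt0; have [|N le_N] := @inv_small R (e / 2).
    by rewrite divr_gt0.
  exists N => m n Nm Nn.
  have [y [/ballP my /ballP ny]] := filter_ex (filterI (uF m) (uF n)).
  rewrite (le_trans (rnorm_dist y _ _)) // [leRHS](splitr e) lerD //.
    by rewrite (le_trans my) ?le_N.
  by rewrite rnorm_distC (le_trans ny) ?le_N.
apply/cvg_ex; exists l; apply/cvgrPdist_le => e e_gt0.
have ee := rnorm_ge0_Re (ltW e_gt0); set er := complex.Re e in ee.
have er2 : 0 < er / 2 by rewrite divr_gt0 // -ltcR -ee.
have [N le_N] := inv_small er2; have [N' lN'] := ul _ er2.
pose n := maxn N N'.
apply: filterS (uF n) => y /ballP ny; rewrite normE ee lecR.
rewrite (le_trans (rnorm_dist (u n) _ _)) // [leRHS](splitr er) lerD //.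
  by rewrite lN' ?leq_maxr.
by rewrite (le_trans ny) ?le_N ?leq_maxl.
Qed.

(** * Completion of a semi-inner product space *)

Section Approximable.
Context (R : realType) (V : lmodType R[i]) (s : semi_inner V).
Implicit Types (v w x : V) (e : R) (g h : V -> R[i]^o).

Local Notation nrm := (form_norm s).

Definition approx_by g v e := forall w, rnorm (g w - s w v : R[i]) <= e * nrm w.

Lemma approx_byD k g h v v' e e' : approx_by g v e -> approx_by h v' e' ->
  approx_by (k *: g + h) (k *: v + v') (rnorm k * e + e').
Proof.
move=> gv hv' w.
have -> : (k *: g + h) w - s w (k *: v + v') =
    k * (g w - s w v) + (h w - s w v') :> R[i].
  have aux (a b c d : R[i]) : k * a + b - (k * c + d) = k * (a - c) + (b - d).
    by ring.
  by rewrite form_linearr; exact: aux.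
rewrite (le_trans (rnormD _ _)) // rnormM mulrDl lerD // -mulrA.
by rewrite ler_wpM2l ?rnorm_ge0.
Qed.

Lemma approx_by_dist g v v' e e' : 0 <= e -> 0 <= e' ->
  approx_by g v e -> approx_by g v' e' ->
  nrm (v - v') <= e + e'.
Proof.
move=> e0 e'0 gv gv'; have [->|n0] := eqVneq (nrm (v - v')) 0.
  exact: addr_ge0.
have np : 0 < nrm (v - v') by rewrite lt_def n0 form_norm_ge0.
rewrite -(ler_pM2r np) -expr2 -lecR form_norm_sqr.
rewrite [leLHS]rnorm_ge0_Re ?form_ge0 // lecR (le_trans (Re_le_rnorm _)) //.
have -> : s (v - v') (v - v') =
    (g (v - v') - s (v - v') v') - (g (v - v') - s (v - v') v) :> R[i].
  have aux (a b c : R[i]) : b - c = (a - c) - (a - b) by ring.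
  by rewrite (formDr s (v - v')) formNr; exact: aux.
by rewrite (le_trans (rnormB _ _)) // mulrDl addrC lerD.
Qed.

(** The map [v |-> s _ v] is linear, while each [s _ v] is conjugate linear; so the ambient space is
    that of all functions. A submodule of it inherits its structure, and no quotient is taken: null
    vectors give the zero functional. *)
Definition approximable : {pred V -> R[i]^o} :=
  fun g => `[< forall e, 0 < e -> exists v, approx_by g v e >].

Lemma approximable_submod_closed : submod_closed approximable.
Proof.
split=> [|k g h].
  apply/asboolP => e e0; exists 0 => w.
  by rewrite form0r subr0 rnorm0 mulr_ge0 ?form_norm_ge0 ?ltW.
move=> /asboolP gP /asboolP hP; apply/asboolP => e e0.
pose e' := e / 2 / (rnorm k + 1).
have e'0 : 0 < e' by rewrite !divr_gt0 // ltr_wpDl ?rnorm_ge0.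
have le_e : rnorm k * e' <= e / 2.
  by rewrite mulrC ler_div_succ ?rnorm_ge0 // ltW // divr_gt0.
have [v gv] := gP _ e'0; have [|v' hv'] := hP (e / 2); first by rewrite divr_gt0.
exists (k *: v + v') => w; apply: le_trans (approx_byD k gv hv' w) _.
by rewrite ler_wpM2r ?form_norm_ge0 // [leRHS](splitr e) lerD.
Qed.

HB.instance Definition _ := GRing.isSubmodClosed.Build _ _ approximable
  approximable_submod_closed.

(* The completion of [V] for [s]: the functionals on [V] which are limits of
   the functionals [s _ v] in the norm dual to that of [s]. *)
Record completion := Completion {
  cfun :> V -> R[i]^o ;
  cfun_approx : cfun \in approximable
}.

HB.instance Definition _ := [isSub for cfun].
HB.instance Definition _ := [Choice of completion by <:].
HB.instance Definition _ := [SubChoice_isSubLmodule of completion by <:].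

End Approximable.

Section ComplexLimits.
Context (R : realType).
Implicit Types (u v : nat -> R[i]) (k l : R[i]).

Lemma rcvg_linear k u v l l' : rcvg u l -> rcvg v l' ->
  rcvg (fun n => k * u n + v n) (k * l + l').
Proof.
move=> ul vl' e e0; pose e' := e / 2 / (rnorm k + 1).
have e'0 : 0 < e' by rewrite !divr_gt0 // ltr_wpDl ?rnorm_ge0.
have le_e : rnorm k * e' <= e / 2.
  by rewrite mulrC ler_div_succ ?rnorm_ge0 // ltW // divr_gt0.
have [N uN] := ul _ e'0; have [|N' vN'] := vl' (e / 2); first by rewrite divr_gt0.
exists (maxn N N') => n; rewrite geq_max => /andP[Nn N'n].
have -> : k * l + l' - (k * u n + v n) = k * (l - u n) + (l' - v n) by ring.
rewrite (le_trans (rnormD _ _)) // rnormM [leRHS](splitr e) lerD ?vN' //.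
by rewrite (le_trans _ le_e) // ler_wpM2l ?rnorm_ge0 ?uN.
Qed.

Lemma rcvg_conj u l : rcvg u l -> rcvg (fun n => (u n)^*) (l^*).
Proof.
by move=> ul e /ul[N uN]; exists N => n /uN; rewrite -rmorphB rnormJ.
Qed.

Lemma rcvg_ge0 u l : rcvg u l -> (forall n, 0 <= u n) -> 0 <= l.
Proof.
move=> ul u0; rewrite lecE /=; apply/andP; split.
  rewrite -normr_eq0 eq_le normr_ge0 andbT; apply/ler_addgt0Pr => e e0.
  have [N uN] := ul e e0; rewrite add0r; apply: le_trans (uN N (leqnn N)).
  have := ger0_Im (u0 N); have := Im_norm_le (l - u N).
  case: (l) (u N) => [a b] [c d] /= h d0.
  by move: h; rewrite d0 subr0.
apply/ler_addgt0Pr => e e0; have [N uN] := ul e e0.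
have := Re_le_rnorm (u N - l); rewrite rnorm_distC.
move=> /le_trans/(_ (uN N (leqnn N))); have := u0 N; rewrite lecE /= => /andP[_].
by case: (l) (u N) => [a b] [c d] /=; lra.
Qed.

End ComplexLimits.

Section Completion.
Context (R : realType) (V : lmodType R[i]) (s : semi_inner V).
Implicit Types (v w x : V) (e : R) (g h : completion s) (u : nat -> V).

Local Notation nrm := (form_norm s).

Definition lims g u := forall e, 0 < e ->
  exists N, forall n, (N <= n)%N -> approx_by s g (u n) e.

Lemma lims_ex g : exists u, lims g u.
Proof.
have /asboolP gP := cfun_approx g.
have /choice[u uP] : forall n, exists v, approx_by s g v n.+1%:R^-1.
  by move=> n; apply: gP; rewrite invr_gt0.
exists u => e /inv_small[N le_N]; exists N => n Nn w.
by apply: le_trans (uP n w) _; rewrite ler_wpM2r ?form_norm_ge0 ?le_N.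
Qed.

Lemma limsD k g h u u' : lims g u -> lims h u' ->
  lims (k *: g + h) (fun n => k *: u n + u' n).
Proof.
move=> gu hu' e e0; pose e' := e / 2 / (rnorm k + 1).
have e'0 : 0 < e' by rewrite !divr_gt0 // ltr_wpDl ?rnorm_ge0.
have le_e : rnorm k * e' <= e / 2.
  by rewrite mulrC ler_div_succ ?rnorm_ge0 // ltW // divr_gt0.
have [N uN] := gu _ e'0; have [|N' uN'] := hu' (e / 2); first by rewrite divr_gt0.
exists (maxn N N') => n; rewrite geq_max => /andP[Nn N'n] w.
apply: le_trans (approx_byD k (uN n Nn) (uN' n N'n) w) _.
by rewrite ler_wpM2r ?form_norm_ge0 // [leRHS](splitr e) lerD.
Qed.

Lemma lims_close g u u' : lims g u -> lims g u' -> forall e, 0 < e ->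
  exists N, forall m n, (N <= m)%N -> (N <= n)%N -> nrm (u m - u' n) <= e.
Proof.
move=> gu gu' e e0; have e20 : 0 < e / 2 by rewrite divr_gt0.
have [N uN] := gu _ e20; have [N' uN'] := gu' _ e20.
exists (maxn N N') => m n; rewrite !geq_max => /andP[Nm _] /andP[_ N'n].
rewrite (splitr e); apply: approx_by_dist (uN m Nm) (uN' n N'n); exact: ltW.
Qed.

Lemma lims_bounded g u : lims g u ->
  exists2 B, 0 < B & exists N, forall n, (N <= n)%N -> nrm (u n) <= B.
Proof.
move=> gu; have [N uN] := lims_close gu gu ltr01.
exists (1 + nrm (u N)); first by rewrite ltr_pwDl ?form_norm_ge0.
exists N => n Nn; rewrite -[u n](subrK (u N)) (le_trans (form_normD _ _ _)) //.
by rewrite lerD ?uN.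
Qed.

Lemma lims_form g h (u v u' v' : nat -> V) :
  lims g u -> lims g v -> lims h u' -> lims h v' ->
  forall e, 0 < e -> exists N, forall m n, (N <= m)%N -> (N <= n)%N ->
    rnorm (s (u m) (u' m) - s (v n) (v' n)) <= e.
Proof.
move=> gu gv hu' hv' e e0.
have [B B0 [N uB]] := lims_bounded hu'; have [B' B'0 [N' vB]] := lims_bounded gv.
have [|M uv] := lims_close gu gv (e := e / 2 / B); first by rewrite !divr_gt0.
have [|M' uv'] := lims_close hu' hv' (e := e / 2 / B'); first by rewrite !divr_gt0.
exists (maxn (maxn N N') (maxn M M')) => m n.
rewrite !geq_max => /andP[/andP[Nm N'm] /andP[Mm M'm]] /andP[/andP[Nn N'n] /andP[Mn M'n]].
rewrite (le_trans (form_diff s _ _ _ _)) // [leRHS](splitr e) lerD //.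
  rewrite -[leRHS](mulfVK (lt0r_neq0 B0)).
  by rewrite ler_pM ?form_norm_ge0 ?uv ?uB.
rewrite mulrC -[leRHS](mulfVK (lt0r_neq0 B'0)).
by rewrite ler_pM ?form_norm_ge0 ?uv' ?vB.
Qed.

(** A single value is the limit along all approximating sequences, so that each property of the
    inner product may be checked on convenient ones. *)
Lemma cinner_ex g h : exists c, forall u u', lims g u -> lims h u' ->
  rcvg (fun n => s (u n) (u' n)) c.
Proof.
have [u gu] := lims_ex g; have [u' hu'] := lims_ex h.
have [c uc] : exists c, rcvg (fun n => s (u n) (u' n)) c.
  by apply: complex_cauchy_cvg; exact: (lims_form gu gu hu' hu').
exists c => v v' gv hv' e e0; have e20 : 0 < e / 2 by rewrite divr_gt0.
have [N cN] := uc _ e20; have [N' uN'] := lims_form gu gv hu' hv' e20.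
exists (maxn N N') => n; rewrite geq_max => /andP[Nn N'n].
rewrite (le_trans (rnorm_dist (s (u n) (u' n)) _ _)) // [leRHS](splitr e).
by rewrite lerD ?cN ?uN'.
Qed.

Definition cinner g h : R[i] := projT1 (cid (cinner_ex g h)).

Lemma cinnerP g h u u' : lims g u -> lims h u' ->
  rcvg (fun n => s (u n) (u' n)) (cinner g h).
Proof. exact: (projT2 (cid (cinner_ex g h))). Qed.

Lemma cinner_linearr g k h h' :
  cinner g (k *: h + h') = k * cinner g h + cinner g h'.
Proof.
have [u gu] := lims_ex g; have [v hv] := lims_ex h; have [v' hv'] := lims_ex h'.
apply: rcvg_unique (cinnerP gu (limsD k hv hv')) _.
have := rcvg_linear k (cinnerP gu hv) (cinnerP gu hv').
by congr (rcvg _ _); apply/funext => n; rewrite form_linearr.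
Qed.

Lemma cinner_conj g h : cinner h g = (cinner g h)^*.
Proof.
have [u gu] := lims_ex g; have [v hv] := lims_ex h.
apply: rcvg_unique (cinnerP hv gu) _; have := rcvg_conj (cinnerP gu hv).
by congr (rcvg _ _); apply/funext => n; rewrite -form_conj.
Qed.

Lemma cinner_ge0 g : 0 <= cinner g g.
Proof.
have [u gu] := lims_ex g; apply: rcvg_ge0 (cinnerP gu gu) _ => n.
exact: form_ge0.
Qed.

Definition cform : semi_inner (completion s) :=
  SemiInner cinner_linearr cinner_conj cinner_ge0.

Lemma cform_norm_le g u e N : 0 <= e -> lims g u ->
  (forall n, (N <= n)%N -> nrm (u n) <= e) -> form_norm cform g <= e.
Proof.
move=> e0 gu ue.
have [g0|g0] := leP (form_norm cform g) e => //.
exfalso; pose d := form_norm cform g ^+ 2 - e ^+ 2.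
have d0 : 0 < d by rewrite subr_gt0 ltr_sqr ?nnegrE ?form_norm_ge0.
have [N' gN'] := cinnerP gu gu (e := d / 2) (divr_gt0 d0 (ltr0n R 2)).
pose n := maxn N N'; have := gN' n (leq_maxr _ _); have := ue n (leq_maxl _ _).
rewrite -[cinner g g]/(cform g g) -!form_norm_sqr -rmorphB rnormc ler_norml.
have := form_norm_ge0 s (u n); rewrite /d => un0 une /andP[_]; nra.
Qed.

Lemma cmap_approx v : (fun w => s w v : R[i]^o) \in approximable s.
Proof.
apply/asboolP => e e0; exists v => w.
by rewrite subrr rnorm0 mulr_ge0 ?form_norm_ge0 ?ltW.
Qed.

Definition cmap v : completion s := Completion (cmap_approx v).

Lemma cmap_linear : linear cmap.
Proof.
move=> k v w; apply/val_inj/funext => x /=; exact: form_linearr.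
Qed.

Lemma lims_cmap v : lims (cmap v) (fun=> v).
Proof.
by move=> e e0; exists 0%N => n _ w; rewrite subrr rnorm0 mulr_ge0 ?form_norm_ge0 ?ltW.
Qed.

Lemma rcvg_const (c : R[i]) : rcvg (fun=> c) c.
Proof. by move=> e e0; exists 0%N => n _; rewrite subrr rnorm0 ltW. Qed.

Lemma cinner_cmap v w : cinner (cmap v) (cmap w) = s v w.
Proof.
exact: rcvg_unique (cinnerP (lims_cmap v) (lims_cmap w)) (rcvg_const _).
Qed.

(** Reproducing property: a functional is recovered from its inner products with the images of
    vectors, hence vanishes if its norm does. *)
Lemma cfunE g w : g w = cinner (cmap w) g.
Proof.
have [u gu] := lims_ex g.
apply: rcvg_unique (cinnerP (lims_cmap w) gu) => e e0.
pose e' := e / (nrm w + 1).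
have [|N uN] := gu e'; first by rewrite divr_gt0 // ltr_wpDl ?form_norm_ge0.
exists N => n Nn; apply: le_trans (uN n Nn w) _.
by rewrite ler_div_succ ?form_norm_ge0 // ltW.
Qed.

Lemma cform_norm_cmap v : form_norm cform (cmap v) = nrm v.
Proof. by rewrite /form_norm -cinner_cmap. Qed.

Lemma cfun_le g w : rnorm (g w : R[i]) <= nrm w * form_norm cform g.
Proof. by rewrite cfunE -cform_norm_cmap; exact: (form_CS cform). Qed.

Lemma cform_norm_eq0 g : form_norm cform g = 0 -> g = 0.
Proof.
move=> g0; have [u gu] := lims_ex g.
apply/val_inj/funext => w; rewrite /=.
have : rnorm (g w : R[i]) <= 0 by rewrite (le_trans (cfun_le g w)) // g0 mulr0.
by move=> gw; apply/eqP; rewrite -(rnorm_eq0 (g w : R[i])) eq_le gw rnorm_ge0.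
Qed.

Lemma approx_by_norm g v e : 0 <= e -> approx_by s g v e ->
  form_norm cform (g - cmap v) <= e.
Proof.
move=> e0 gv; apply/ler_addgt0Pr => e' e'0; have [u gu] := lims_ex g.
have [N uN] := gu _ e'0.
have lim : lims (g - cmap v) (fun n => u n - v).
  have := limsD (-1) (lims_cmap v) gu; rewrite scaleN1r addrC.
  by congr (lims _ _); apply/funext => n; rewrite scaleN1r addrC.
apply: (cform_norm_le (N := N)) lim _; first by rewrite addr_ge0 // ltW.
by move=> n Nn; rewrite [e + e']addrC; apply: approx_by_dist (uN n Nn) gv => //; exact: ltW.
Qed.

Lemma cmap_dense g e : 0 < e -> exists v, form_norm cform (g - cmap v) <= e.
Proof.
move=> e0; have [u gu] := lims_ex g; have [N uN] := gu _ e0.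
by exists (u N); apply: approx_by_norm; [exact: ltW|exact: uN].
Qed.

(** The limit functional is found pointwise; the Cauchy estimate is uniform in [w] relative to its
    seminorm, so that the convergence is that of the dual norm. *)
Lemma lims_cauchy u : (forall e, 0 < e -> exists N, forall m n,
    (N <= m)%N -> (N <= n)%N -> nrm (u m - u n) <= e) -> exists g, lims g u.
Proof.
move=> cu; have dist m n w : rnorm (s w (u m) - s w (u n)) <= nrm w * nrm (u m - u n).
  by rewrite -formNr -formDr form_CS.
have /choice[g gP] w : exists c, rcvg (fun n => s w (u n)) c.
  apply: complex_cauchy_cvg => e e0; pose e' := e / (nrm w + 1).
  have [|N uN] := cu e'; first by rewrite divr_gt0 // ltr_wpDl ?form_norm_ge0.
  exists N => m n Nm Nn; apply: le_trans (dist _ _ _) _.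
  apply: le_trans (ler_wpM2l (form_norm_ge0 _ _) (uN m n Nm Nn)) _.
  by rewrite mulrC ler_div_succ ?form_norm_ge0 // ltW.
have gu e : 0 < e -> exists N, forall n, (N <= n)%N -> approx_by s g (u n) e.
  move=> e0; have [N uN] := cu e e0; exists N => n Nn w.
  apply/ler_addgt0Pr => e' e'0; have [N' gN'] := gP w _ e'0.
  rewrite (le_trans (rnorm_dist (s w (u (maxn N N'))) _ _)) // addrC.
  rewrite lerD ?gN' ?leq_maxr // (le_trans (dist _ _ _)) // mulrC.
  by rewrite ler_wpM2r ?form_norm_ge0 ?uN ?leq_maxl.
have gapp : (g : V -> R[i]^o) \in approximable s.
  by apply/asboolP => e /gu[N uN]; exists (u N); exact: uN.
by exists (Completion gapp).
Qed.

Definition cnorm g : R[i] := (form_norm cform g)%:C.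

Lemma ler_cnormD g h : cnorm (g + h) <= cnorm g + cnorm h.
Proof. by rewrite /cnorm -rmorphD lecR form_normD. Qed.

Lemma cnormZ k g : cnorm (k *: g) = `|k| * cnorm g.
Proof. by rewrite /cnorm form_normZ rmorphM /= -normE. Qed.

Lemma cnorm0_eq0 g : cnorm g = 0 -> g = 0.
Proof. by move=> /(@complexI R)/cform_norm_eq0. Qed.

HB.instance Definition _ := Lmodule_isNormed.Build R[i] (completion s)
  ler_cnormD cnormZ cnorm0_eq0.

Lemma rnorm_completion g : rnorm g = form_norm cform g.
Proof. by []. Qed.

Lemma completion_rcauchy_cvg (u : nat -> completion s) : rcauchy u ->
  exists l, rcvg u l.
Proof.
move=> cu.
have /choice[v vP] : forall n, exists v, rnorm (u n - cmap v) <= n.+1%:R^-1.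
  by move=> n; apply: cmap_dense; rewrite invr_gt0.
have [|g gv] := lims_cauchy (u := v).
  move=> e e0; have e3 : 0 < e / 3 by rewrite divr_gt0.
  have [N uN] := cu _ e3; have [N' le_N'] := inv_small e3.
  exists (maxn N N') => m n; rewrite !geq_max => /andP[Nm N'm] /andP[Nn N'n].
  have cB : cmap (v m - v n) = cmap (v m) - cmap (v n).
    by rewrite addrC -scaleN1r cmap_linear scaleN1r addrC.
  rewrite -cform_norm_cmap cB -rnorm_completion.
  have -> : e = e / 3 + (e / 3 + e / 3) by field.
  apply: le_trans (rnorm_dist (u m) _ _) _; apply: lerD.
    by rewrite rnorm_distC; exact: le_trans (vP m) (le_N' m N'm).
  apply: le_trans (rnorm_dist (u n) _ _) _; apply: lerD; first exact: uN.
  exact: le_trans (vP n) (le_N' n N'n).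
exists g => e e0; have e20 : 0 < e / 2 by rewrite divr_gt0.
have [N vN] := gv _ e20; have [N' le_N'] := inv_small e20.
exists (maxn N N') => n; rewrite !geq_max => /andP[Nn N'n].
rewrite (splitr e); apply: le_trans (rnorm_dist (cmap (v n)) _ _) _.
apply: lerD; first exact: (approx_by_norm (ltW e20) (vN n Nn)).
by rewrite rnorm_distC; exact: le_trans (vP n) (le_N' n N'n).
Qed.

HB.instance Definition _ := Uniform_isComplete.Build (completion s)
  (rcauchy_complete completion_rcauchy_cvg).

Lemma normr_cinner g : `|g| = sqrtC (cinner g g).
Proof.
rewrite normE rnorm_completion -[cinner g g]/(cform g g) -form_norm_sqr.
by rewrite rmorphXn /= sqrCK // ler0c form_norm_ge0.
Qed.

HB.instance Definition _ := CompleteNormedModule_isHilbert.Build R (completion s)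
  cinner_linearr cinner_conj cinner_ge0 normr_cinner.

End Completion.

(** * Topology through real error bounds, and extension from dense images *)

Section NormTopology.
Context (R : realType).

Lemma nbhs_rnormP (M : normedModType R[i]) (x : M) (B : set M) :
  nbhs x B <-> exists2 e : R, 0 < e & forall y, rnorm (x - y) <= e -> B y.
Proof.
split=> [/nbhs_ballP[e /= e0 eB]|[e e0 eB]].
  have ee := rnorm_ge0_Re (ltW e0); set er := complex.Re e in ee.
  have er0 : 0 < er by rewrite -ltcR -ee.
  exists (er / 2) => [|y xy]; first by rewrite divr_gt0.
  apply: eB; rewrite -ball_normE /ball_ /= normE ee ltcR.
  by rewrite (le_lt_trans xy) // ltr_pdivrMr // ltr_pMr // ltr1n.
apply/nbhs_ballP; exists e%:C => /=; first by rewrite ltcR.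
by move=> y; rewrite -ball_normE /ball_ /= normE ltcR => /ltW/eB.
Qed.

Lemma dense_rnormP (M : normedModType R[i]) (D : set M) :
  dense D <-> forall x (e : R), 0 < e -> exists2 y, D y & rnorm (x - y) <= e.
Proof.
split=> [Ddense x e e0|Ddense O [x Ox] Oopen].
  have : nbhs x [set y | rnorm (x - y) <= e] by apply/nbhs_rnormP; exists e.
  rewrite nbhsE; case=> O [Oopen Ox] OB.
  have [|y [Oy Dy]] := Ddense O _ Oopen; first by exists x.
  by exists y => //; exact: OB.
have /nbhs_rnormP[e e0 eO] := open_nbhs_nbhs (conj Oopen Ox).
by have [y Dy xy] := Ddense x e e0; exists y; split=> //; exact: eO.
Qed.

Lemma closure_rnormP (M : normedModType R[i]) (S : set (M * M)) (w : M * M) :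
  closure S w <-> forall e : R, 0 < e ->
    exists s, [/\ S s, rnorm (w.1 - s.1) <= e & rnorm (w.2 - s.2) <= e].
Proof.
split=> [Sw e e0|Sw B].
  have : nbhs w [set s | rnorm (w.1 - s.1) <= e /\ rnorm (w.2 - s.2) <= e].
    exists ([set y | rnorm (w.1 - y) <= e], [set y | rnorm (w.2 - y) <= e]) => //.
    by split; apply/nbhs_rnormP; exists e.
  by move=> /Sw[s [Ss [s1 s2]]]; exists s.
move=> [[B1 B2] [/= /nbhs_rnormP[e e0 eB1] /nbhs_rnormP[e' e'0 eB2]] B12].
have m0 : 0 < Num.min e e' by rewrite lt_min e0 e'0.
have [s [Ss s1 s2]] := Sw _ m0; exists s; split=> //; apply: B12; split => /=.
  by apply: eB1; rewrite (le_trans s1) // ge_min lexx.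
by apply: eB2; rewrite (le_trans s2) // ge_min lexx orbT.
Qed.

Lemma closed_rnormP (M : normedModType R[i]) (S : set (M * M)) :
  closed S -> forall w, (forall e : R, 0 < e ->
    exists s, [/\ S s, rnorm (w.1 - s.1) <= e & rnorm (w.2 - s.2) <= e]) -> S w.
Proof. by move=> Sclosed w /closure_rnormP; exact: Sclosed. Qed.

(* The value of the extension at [h] is the only [w] such that
   [|w - g v| <= M |h - k v|] for all [v]. *)
Lemma bounded_extension (V : lmodType R[i]) (H W : completeNormedModType R[i])
    (k : {linear V -> H}) (g : {linear V -> W}) (M : R) : 0 <= M ->
  (forall v, rnorm (g v) <= M * rnorm (k v)) ->
  (forall h (e : R), 0 < e -> exists v, rnorm (h - k v) <= e) ->
  exists G : {linear H -> W}, (forall v, G (k v) = g v) /\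
    (forall h, rnorm (G h) <= M * rnorm h).
Proof.
move=> M0 gM kdense.
have /choice[G GP] h : exists w, forall v, rnorm (w - g v) <= M * rnorm (h - k v).
  have /choice[v vP] n : exists v, rnorm (h - k v) <= n.+1%:R^-1.
    by apply: kdense; rewrite invr_gt0.
  have gB v1 v2 : rnorm (g v1 - g v2) <= M * (rnorm (h - k v1) + rnorm (h - k v2)).
    rewrite -linearB (le_trans (gM _)) // ler_wpM2l // linearB.
    by rewrite (rnorm_distC h) rnorm_dist.
  have M1 : 0 < M + 1 by rewrite ltr_wpDl.
  have [l ul] : exists l, rcvg (fun n => g (v n)) l.
    apply: rcauchy_cvg => e e0; have [|N le_N] := @inv_small R (e / 2 / (M + 1)).
      by rewrite !divr_gt0.
    exists N => m n Nm Nn; apply: le_trans (gB _ _) _.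
    have e1 : e / 2 / (M + 1) * M <= e / 2.
      by apply: ler_div_succ => //; rewrite divr_ge0 // ltW.
    have := le_trans (vP m) (le_N m Nm); have := le_trans (vP n) (le_N n Nn).
    move: (rnorm _) (rnorm _) => a b ea eb.
    by rewrite mulrDr [leRHS](splitr e) lerD // (le_trans _ e1) // mulrC ler_wpM2r.
  exists l => v'; apply/ler_addgt0Pr => e e0.
  have e20 : 0 < e / 2 by rewrite divr_gt0.
  have [N lN] := ul _ e20.
  have [|N' le_N'] := @inv_small R (e / 2 / (M + 1)); first by rewrite !divr_gt0.
  pose n := maxn N N'.
  have e1 : e / 2 / (M + 1) * M <= e / 2.
    by apply: ler_div_succ => //; rewrite divr_ge0 // ltW.
  apply: le_trans (rnorm_dist (g (v n)) _ _) _.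
  have -> : M * rnorm (h - k v') + e = e / 2 + (e / 2 + M * rnorm (h - k v')).
    by field.
  apply: lerD; first by apply: lN; exact: leq_maxl.
  apply: le_trans (gB _ _) _; rewrite mulrDr lerD2r (le_trans _ e1) //.
  rewrite mulrC ler_wpM2r //.
  exact: le_trans (vP n) (le_N' n (leq_maxr _ _)).
have Guniq h w : (forall e : R, 0 < e -> exists v,
    rnorm (h - k v) <= e /\ rnorm (w - g v) <= e) -> w = G h.
  move=> wP; apply: rnorm_eq_small => e e0.
  have M1 : 0 < M + 1 by rewrite ltr_wpDl.
  pose c := e / (M + 1); have c0 : 0 < c by rewrite divr_gt0.
  have ec : e = c + M * c by rewrite /c; field; exact: lt0r_neq0.
  have [v [hv wv]] := wP c c0; rewrite ec.
  apply: le_trans (rnorm_dist (g v) _ _) _; apply: lerD => //.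
  by rewrite rnorm_distC; exact: le_trans (GP h v) (ler_wpM2l M0 hv).
have Glin : linear G.
  move=> c h h'; apply/esym/Guniq => e e0.
  pose C := (rnorm c + 1) * (M + 1).
  have C0 : 0 < C by rewrite mulr_gt0 // ltr_wpDl ?rnorm_ge0.
  pose e' := e / C; have e'0 : 0 < e' by rewrite divr_gt0.
  have [v hv] := kdense h _ e'0; have [v' hv'] := kdense h' _ e'0.
  have Gv := le_trans (GP h v) (ler_wpM2l M0 hv).
  have Gv' := le_trans (GP h' v') (ler_wpM2l M0 hv').
  have eC : e = e' * (rnorm c + 1) * (M + 1) by rewrite /e' -mulrA mulfVK ?lt0r_neq0.
  have c0 := rnorm_ge0 c.
  exists (c *: v + v'); split.
    have -> : k (c *: v + v') = c *: k v + k v' by rewrite linearD linearZ.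
    have -> : c *: h + h' - (c *: k v + k v') = c *: (h - k v) + (h' - k v').
      by lincomb R; ring.
    apply: le_trans (rnormD _ _) _; rewrite rnormZ.
    by apply: le_trans (lerD (ler_wpM2l c0 hv) hv') _; rewrite eC; nra.
  have -> : g (c *: v + v') = c *: g v + g v' by rewrite linearD linearZ.
  have -> : c *: G h + G h' - (c *: g v + g v') = c *: (G h - g v) + (G h' - g v').
    by lincomb R; ring.
  apply: le_trans (rnormD _ _) _; rewrite rnormZ.
  by apply: le_trans (lerD (ler_wpM2l c0 Gv) Gv') _; rewrite eC; nra.
pose m := GRing.isLinear.Build _ _ _ _ G Glin.
exists (HB.pack_for {linear H -> W} G m); split=> [v|h] /=.
  apply/esym/Guniq => e e0; exists v.
  by rewrite !subrr !rnorm0 ltW.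
by have := GP h 0; rewrite (linear0 g) (linear0 k) !subr0.
Qed.

End NormTopology.

(* The graph of [G] and the rotated graph of [G'] span a dense subspace. *)
Definition complementary (R : realType) (M : normedModType R[i])
    (G G' : set (M * M)) := forall (p q : M) (e : R), 0 < e ->
  exists x w y z, [/\ G (x, w), G' (y, z),
    rnorm (p - (x + z)) <= e & rnorm (q - (w - y)) <= e].

(** * Adjoints in Hilbert spaces *)

Section Projection.
Context (R : realType) (V : lmodType R[i]) (s : semi_inner V).
Context (G : set V).
Hypothesis G0 : G 0.
Hypothesis GD : forall x y, G x -> G y -> G (x + y).
Hypothesis GZ : forall (k : R[i]) x, G x -> G (k *: x).

Local Notation nrm := (form_norm s).

Lemma form_norm_sqrE x : nrm x ^+ 2 = complex.Re (s x x).
Proof. by rewrite sqr_sqrtr ?Re_form_ge0. Qed.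

Lemma parallelogram x y :
  nrm (x - y) ^+ 2 + nrm (x + y) ^+ 2 = 2 * nrm x ^+ 2 + 2 * nrm y ^+ 2.
Proof.
rewrite !form_norm_sqrE !formE.
by case: (s x x) (s x y) (s y x) (s y y) => [? ?] [? ?] [? ?] [? ?] /=; ring.
Qed.

Lemma form_norm_sqrD x y : nrm (x + y) ^+ 2 =
  nrm x ^+ 2 + 2 * complex.Re (s x y) + nrm y ^+ 2.
Proof.
rewrite !form_norm_sqrE !formE (form_conj s x y).
by case: (s x x) (s x y) (s y y) => [? ?] [? ?] [? ?] /=; ring.
Qed.

Lemma orthogonal_norm_le x y : s x y = 0 -> nrm x <= nrm (x + y).
Proof.
move=> xy0; rewrite -ler_sqr ?nnegrE ?form_norm_ge0 // form_norm_sqrD xy0 /=.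
by rewrite mulr0 addr0 lerDl sqr_ge0.
Qed.

(** [V] need not be complete, so a minimizing sequence stands in for the projection: it is Cauchy,
    and [u - g n] becomes orthogonal to each vector of [G]. *)
Lemma minimizing_sequence u : exists g : nat -> V, [/\ forall n, G (g n),
  forall e, 0 < e -> exists N, forall m n, (N <= m)%N -> (N <= n)%N ->
    nrm (g m - g n) <= e &
  forall k e, G k -> 0 < e -> exists N, forall n, (N <= n)%N ->
    rnorm (s k (u - g n)) <= e].
Proof.
pose S := [set nrm (u - g) ^+ 2 | g in G].
have Sinf : has_inf S.
  by split; [exists (nrm (u - 0) ^+ 2), 0|exists 0 => _ [g _ <-]; exact: sqr_ge0].
have S_le g : G g -> inf S <= nrm (u - g) ^+ 2.
  by move=> Gg; apply: ge_inf; [exact: Sinf.2|exists g].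
have /choice[g gP] n : exists g, G g /\ nrm (u - g) ^+ 2 <= inf S + n.+1%:R^-1.
  have n0 : 0 < n.+1%:R^-1 :> R by rewrite invr_gt0.
  have [_ [g Gg <-] lt_g] := inf_adherent n0 Sinf.
  by exists g; split=> //; exact: ltW.
exists g; split=> [n|e e0|k e Gk e0]; first exact: (gP n).1.
  (* The midpoint being in [G], the parallelogram identity gives [|g m - g n|^2 <= 2 / (m + 1) + 2 /
     (n + 1)]. *)
  have e4 : 0 < e ^+ 2 / 4 by rewrite divr_gt0 ?exprn_gt0.
  have [N le_N] := inv_small e4; exists N => m n Nm Nn.
  rewrite -ler_sqr ?nnegrE ?form_norm_ge0 ?(ltW e0) //.
  have := parallelogram (u - g m) (u - g n).
  have -> : u - g m - (u - g n) = - (g m - g n) by lincomb R; ring.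
  have -> : u - g m + (u - g n) =
      (2%:R)%:C *: (u - (2^-1)%:C *: (g m + g n)).
    rewrite scalerBr scalerA -rmorphM mulfV ?pnatr_eq0 //; lincomb R; ring.
  have mid : G ((2^-1)%:C *: (g m + g n)).
    by apply/GZ/GD; [exact: (gP m).1|exact: (gP n).1].
  rewrite form_normN form_normZ rnormc ger0_norm // exprMn.
  have := S_le _ mid; have := (gP m).2; have := (gP n).2.
  have := le_N m Nm; have := le_N n Nn; rewrite [2 ^+ 2]expr2.
  move: (nrm _ ^+ 2) (nrm _ ^+ 2) (nrm _ ^+ 2) (nrm _ ^+ 2) => a b c d.
  move: (inf S) (n.+1%:R^-1) (m.+1%:R^-1) (e ^+ 2) => i n' m' e2; lra.
(* One more than the squared seminorm, to divide safely. Moving [g n] by [(c / K) k] lowers the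
   squared distance by at least [|c|^2 / K]. *)
pose K := nrm k ^+ 2 + 1; have K0 : 0 < K by rewrite ltr_wpDl ?sqr_ge0.
have eK : 0 < e ^+ 2 / K by rewrite divr_gt0 ?exprn_gt0.
have [N le_N] := inv_small eK; exists N => n Nn.
set c := s k (u - g n).
have := S_le (g n + (K^-1%:C * c) *: k) (GD (gP n).1 (GZ _ Gk)).
have -> : u - (g n + (K^-1%:C * c) *: k) = (u - g n) + (- (K^-1%:C * c)) *: k.
  by lincomb R; ring.
rewrite form_norm_sqrD form_normZ rnormN rnormM rnormc formZr form_conj -/c.
have -> : - (K^-1%:C * c) * c^* = (- (K^-1 * rnorm c ^+ 2))%:C.
  by rewrite rmorphN rmorphM /= rnorm_sqr; ring.
rewrite (ger0_norm (_ : 0 <= K^-1)) ?invr_ge0 ?(ltW K0) //=.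
have := (gP n).2; have := le_N n Nn.
rewrite -[rnorm c <= e]ler_sqr ?nnegrE ?rnorm_ge0 ?(ltW e0) //.
have c2 := sqr_ge0 (rnorm c).
have kK : nrm k ^+ 2 = K - 1 by rewrite /K addrK.
rewrite exprMn kK exprMn.
move: (nrm _ ^+ 2) (inf S) (_.+1%:R^-1) => a i m'.
rewrite ler_pdivlMr // => m'e ai iS.
have : K * m' <= e ^+ 2 by rewrite mulrC.
suff : rnorm c ^+ 2 * K^-1 <= m' by rewrite ler_pdivrMr // mulrC; exact: le_trans.
move: iS; have -> : K^-1 ^+ 2 * rnorm c ^+ 2 * (K - 1) =
    K^-1 * rnorm c ^+ 2 - K^-1 ^+ 2 * rnorm c ^+ 2.
  by field; exact: lt0r_neq0.
have := mulr_ge0 (sqr_ge0 K^-1) c2; lra.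
Qed.

End Projection.

Section HilbertAdjoints.
Context (R : realType) (H : hilbertType R).
Implicit Types (x y z w p q : H) (G : set (H * H)).

Definition inner_form : semi_inner H :=
  SemiInner (@inner_linearr R H) (@inner_conj R H) (@inner_ge0 R H).

Lemma rnorm_inner x : rnorm x = form_norm inner_form x.
Proof.
apply/eqP; rewrite -(eqrXn2 (n := 2)) ?rnorm_ge0 ?form_norm_ge0 //.
apply/eqP/(@complexI R); rewrite form_norm_sqr /= rmorphXn /= -normE.
by rewrite normr_inner sqrtCK.
Qed.

Lemma inner_CS x y : rnorm (inner x y) <= rnorm x * rnorm y.
Proof. by rewrite !rnorm_inner; exact: (form_CS inner_form). Qed.

(** The norm of the product type is a maximum; this form carries the Hilbert space structure of
    [H + H]. *)
Definition pair_form : semi_inner (H * H)%type.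
Proof.
pose f (u v : H * H) := inner u.1 v.1 + inner u.2 v.2.
apply: (@SemiInner R (H * H)%type f) => [u k v v'|u v|u]; rewrite /f /=.
- by rewrite !inner_linearr; ring.
- by rewrite inner_conj [inner v.2 _]inner_conj -rmorphD.
- by rewrite addr_ge0 ?inner_ge0.
Defined.

Lemma pair_form_norm (u : H * H) :
  form_norm pair_form u ^+ 2 = rnorm u.1 ^+ 2 + rnorm u.2 ^+ 2.
Proof.
apply: (@complexI R); rewrite form_norm_sqr rmorphD /= !rnorm_inner.
by rewrite !form_norm_sqr.
Qed.

Lemma pair_form_norm1 (u : H * H) : rnorm u.1 <= form_norm pair_form u.
Proof.
rewrite -ler_sqr ?nnegrE ?form_norm_ge0 ?rnorm_ge0 // pair_form_norm.
by rewrite lerDl sqr_ge0.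
Qed.

Lemma pair_form_norm2 (u : H * H) : rnorm u.2 <= form_norm pair_form u.
Proof.
rewrite -ler_sqr ?nnegrE ?form_norm_ge0 ?rnorm_ge0 // pair_form_norm.
by rewrite lerDr sqr_ge0.
Qed.

Lemma pair_form_normD (u : H * H) :
  form_norm pair_form u <= rnorm u.1 + rnorm u.2.
Proof.
rewrite -ler_sqr ?nnegrE ?addr_ge0 ?form_norm_ge0 ?rnorm_ge0 // pair_form_norm.
have := rnorm_ge0 u.1; have := rnorm_ge0 u.2; nra.
Qed.

Lemma innerDl x x' y : inner (x + x') y = inner x y + inner x' y.
Proof. exact: (formDl inner_form). Qed.

Lemma innerDr x y y' : inner x (y + y') = inner x y + inner x y'.
Proof. exact: (formDr inner_form). Qed.

Lemma innerZr (k : R[i]) x y : inner x (k *: y) = k * inner x y.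
Proof. exact: (formZr inner_form). Qed.

Lemma inner0l x : inner 0 x = 0.
Proof. exact: (form0l inner_form). Qed.

Lemma inner0r x : inner x 0 = 0.
Proof. exact: (form0r inner_form). Qed.

Lemma innerE x : inner x x = (rnorm x ^+ 2)%:C.
Proof. by rewrite rnorm_inner form_norm_sqr. Qed.

Lemma innerBl x x' y : inner (x - x') y = inner x y - inner x' y.
Proof. by have := formDl inner_form x (- x') y; rewrite formNl. Qed.

Lemma innerBr x y y' : inner x (y - y') = inner x y - inner x y'.
Proof. by have := formDr inner_form x y (- y'); rewrite formNr. Qed.

Lemma hadjoint_closure G : hadjoint G `<=` hadjoint (closure G).
Proof.
move=> [y z] Gyz x w /closure_rnormP Gxw /=; apply: rnorm_eq_small => e e0.
pose C := rnorm y + rnorm z; have C0 : 0 <= C by rewrite addr_ge0 ?rnorm_ge0.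
have [|[x' w'] [/= Gxw' xx ww]] := Gxw (e / (C + 1)).
  by rewrite divr_gt0 // ltr_wpDl.
have /= e1 := Gyz x' w' Gxw'.
have -> : inner w y - inner x z = inner (w - w') y - inner (x - x') z.
  by rewrite !innerBl e1; ring.
apply: le_trans (rnormB _ _) _.
apply: le_trans (ler_div_succ (ltW e0) C0); rewrite /C mulrDr lerD //.
  by rewrite (le_trans (inner_CS _ _)) // ler_wpM2r ?rnorm_ge0.
by rewrite (le_trans (inner_CS _ _)) // ler_wpM2r ?rnorm_ge0.
Qed.

Lemma closure_hadjoint G : closure (hadjoint G) `<=` hadjoint G.
Proof.
move=> [y z] /closure_rnormP Gyz x w Gxw /=; apply: rnorm_eq_small => e e0.
pose C := rnorm w + rnorm x; have C0 : 0 <= C by rewrite addr_ge0 ?rnorm_ge0.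
have [|[y' z'] [/= Gyz' yy zz]] := Gyz (e / (C + 1)).
  by rewrite divr_gt0 // ltr_wpDl.
have /= e1 := Gyz' x w Gxw.
have -> : inner w y - inner x z = inner w (y - y') - inner x (z - z').
  by rewrite !innerBr e1; ring.
apply: le_trans (rnormB _ _) _.
apply: le_trans (ler_div_succ (ltW e0) C0); rewrite /C mulrDr lerD //.
  by rewrite (le_trans (inner_CS _ _)) // mulrC ler_wpM2r ?rnorm_ge0.
by rewrite (le_trans (inner_CS _ _)) // mulrC ler_wpM2r ?rnorm_ge0.
Qed.

(** For [(y, z)] in the adjoint, approximating [(z, - y)] by [(x, w) + (z', - y')] leaves
    [(z - z', y' - y)] orthogonal to [(x, w)]; by Pythagoras it is no longer than the total
    error. *)
Lemma hadjoint_complementary G G' : G' `<=` hadjoint G -> complementary G G' ->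
  closure G' = hadjoint (closure G).
Proof.
move=> GG' dGG'; apply/seteqP; split=> [u|[y z] Gyz].
  move=> /(closure_subset GG')/closure_hadjoint; exact: hadjoint_closure.
apply/closure_rnormP => e e0 /=.
have [|x [w [y' [z' [Gxw Gyz' e1 e2]]]]] := dGG' z (- y) (e / 2).
  by rewrite divr_gt0.
pose xi : H * H := (x, w); pose al : H * H := (z - z', y' - y).
have orth : pair_form xi al = 0.
  have /= E1 := Gyz x w (subset_closure Gxw); have /= E2 := GG' _ Gyz' x w Gxw.
  by rewrite /= !innerBr E1 E2; ring.
have orth' : pair_form al (- xi) = 0.
  by rewrite formNr form_conj orth conjC0 oppr0.
have le_e : form_norm pair_form al <= e.
  apply: le_trans (orthogonal_norm_le orth') _.
  apply: le_trans (pair_form_normD _) _; rewrite (splitr e) lerD //=.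
    by apply: le_trans e1; rewrite opprD addrA addrAC.
  by apply: le_trans e2; rewrite opprB addrCA addrA.
exists (y', z'); split=> //=.
  by rewrite rnorm_distC (le_trans (pair_form_norm2 al)).
by rewrite (le_trans (pair_form_norm1 al)).
Qed.

(** The limit [(a, b)] of a minimizing sequence is the projection of [(p, q)] on the closure of [G];
    orthogonality of the remainder says that [(b - q, p - a)] is in the adjoint, where [G'] is
    dense. *)
Lemma complementary_hadjoint G G' : G 0 ->
  (forall u v, G u -> G v -> G (u + v)) ->
  (forall (k : R[i]) u, G u -> G (k *: u)) ->
  closure G' = hadjoint (closure G) -> complementary G G'.
Proof.
move=> G0 GD GZ G'adj p q e e0.
have [g [gG gC gorth]] := minimizing_sequence pair_form G0 GD GZ (p, q).
have e20 : 0 < e / 2 by rewrite divr_gt0.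
have [a ga] : exists a, rcvg (fun n => (g n).1) a.
  apply: rcauchy_cvg => d /gC[N gN]; exists N => m n Nm Nn.
  exact: le_trans (pair_form_norm1 (g m - g n)) (gN m n Nm Nn).
have [b gb] : exists b, rcvg (fun n => (g n).2) b.
  apply: rcauchy_cvg => d /gC[N gN]; exists N => m n Nm Nn.
  exact: le_trans (pair_form_norm2 (g m - g n)) (gN m n Nm Nn).
have Gadj : hadjoint G (b - q, p - a).
  move=> x w Gxw /=; apply: rnorm_eq_small => d d0.
  pose C := rnorm x + rnorm w; have C0 : 0 <= C by rewrite addr_ge0 ?rnorm_ge0.
  pose d' := d / 2 / (C + 1).
  have d'0 : 0 < d' by rewrite !divr_gt0 // ltr_wpDl.
  have [N1 aN] := ga _ d'0; have [N2 bN] := gb _ d'0.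
  have [|N3 oN] := gorth (x, w) (d / 2) Gxw; first by rewrite divr_gt0.
  pose n := maxn (maxn N1 N2) N3.
  have an : rnorm (a - (g n).1) <= d' by apply: aN; rewrite !leq_max leqnn.
  have bn : rnorm (b - (g n).2) <= d' by apply: bN; rewrite !leq_max leqnn orbT.
  have /= on := oN n (leq_maxr _ _).
  have -> : inner w (b - q) - inner x (p - a) =
      (inner w (b - (g n).2) + inner x (a - (g n).1))
      - (inner x (p - (g n).1) + inner w (q - (g n).2)).
    by rewrite !innerBr; ring.
  apply: le_trans (rnormB _ _) _; rewrite [leRHS](splitr d) lerD //.
  apply: le_trans (rnormD _ _) _.
  have d20 : 0 <= d / 2 by rewrite divr_ge0 ?(ltW d0).
  apply: le_trans (ler_div_succ d20 C0); rewrite -/d' /C mulrDr addrC lerD //.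
    by rewrite (le_trans (inner_CS _ _)) // mulrC ler_wpM2r ?rnorm_ge0.
  by rewrite (le_trans (inner_CS _ _)) // mulrC ler_wpM2r ?rnorm_ge0.
have : closure G' (b - q, p - a) by rewrite G'adj; exact: hadjoint_closure.
move=> /closure_rnormP/(_ _ e20)[[y z] /= [Gyz yb zp]].
have [N1 aN] := ga _ e20; have [N2 bN] := gb _ e20; pose n := maxn N1 N2.
exists (g n).1, (g n).2, y, z; split=> //; first by rewrite -surjective_pairing.
  have -> : p - ((g n).1 + z) = (a - (g n).1) + (p - a - z).
    by lincomb R; ring.
  by rewrite (le_trans (rnormD _ _)) // (splitr e) lerD // aN // leq_maxl.
have -> : q - ((g n).2 - y) = (b - (g n).2) - (b - q - y).
  by lincomb R; ring.
by rewrite (le_trans (rnormB _ _)) // (splitr e) lerD // bN // leq_maxr.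
Qed.

End HilbertAdjoints.

(** * Regular operators *)

Section ModuleOperators.
Context (R : realType) (A : cstarAlgType R) (E : hilbertModType A).
Implicit Types (T : set (E * E)) (x y z w : E) (e : R).

(** [a <= a + b <= |a + b|], and the norm is monotone on positive elements. *)
Lemma rnorm_amul_le (a b : A) : opos (amul a) -> opos (amul b) ->
  rnorm a <= rnorm (a + b).
Proof.
move=> apos bpos; have abpos : opos (amul (a + b)).
  by apply: opos_ext (oposD apos bpos) => x; rewrite amulDl.
have [_ le_ab] := bounded_opos (rnorm_ge0 (a + b)) abpos.1 (bounded_by_amul _).
apply: bounded_by_amulP; rewrite ?rnorm_ge0 //.
apply: bounded_by_opos_le apos _; first exact: rnorm_ge0.
by apply: opos_ext (oposD le_ab bpos) => x; rewrite amulDl; lincomb R; ring.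
Qed.

Lemma rnorm_mip2_1 (u : E * E) : rnorm u.1 ^+ 2 <= rnorm (mip2 u).
Proof. by rewrite -rnorm_mip; apply: rnorm_amul_le; exact: opos_mip. Qed.

Lemma rnorm_mip2_2 (u : E * E) : rnorm u.2 ^+ 2 <= rnorm (mip2 u).
Proof.
by rewrite -rnorm_mip /mip2 addrC; apply: rnorm_amul_le; exact: opos_mip.
Qed.

Lemma madjointD T (k : R[i]) (u v : E * E) : madjoint T u -> madjoint T v ->
  madjoint T (k *: u + v).
Proof. by move=> Tu Tv x w Txw /=; rewrite !mipE (Tu x w) // (Tv x w). Qed.

Lemma madjoint_ract T x y (a : A) : madjoint T (x, y) ->
  madjoint T (ract x a, ract y a).
Proof.
by move=> Txy v w Tvw /=; rewrite !mip_ract; congr amul; exact: Txy.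
Qed.

Lemma madjoint0 T : madjoint T 0.
Proof. by move=> x w Txw /=; rewrite !mip0r. Qed.

Lemma mip_small0 x (D : set E) : dense D -> (forall v, D v -> mip x v = 0) ->
  x = 0.
Proof.
move=> /dense_rnormP Ddense xD; apply/eqP; rewrite -rnorm_eq0 -sqrf_eq0.
rewrite -rnorm_mip; suff -> : mip x x = 0 by rewrite rnorm0.
apply: rnorm_small0 => e e0; pose C := 4 * rnorm x.
have C0 : 0 <= C by rewrite mulr_ge0 ?rnorm_ge0.
have [|v Dv xv] := Ddense x (e / (C + 1)); first by rewrite divr_gt0 // ltr_wpDl.
have -> : mip x x = mip x (x - v) by rewrite !mipE (xD v Dv) subr0.
apply: le_trans (ler_div_succ (ltW e0) C0).
by rewrite (le_trans (rnorm_mip_le _ _)) // mulrC ler_wpM2r.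
Qed.

Section SemiregularLinear.
Context T (Tsemi : semiregular T).

(** The source of the linearity of [T]: its values are determined by their pairings with the dense
    domain of the adjoint. *)
Lemma semiregular_eq x y y' : T (x, y) ->
  (forall v w, madjoint T (v, w) -> mip x w = mip y' v) -> y = y'.
Proof.
move=> Txy y'P; apply/eqP; rewrite -subr_eq0; apply/eqP.
apply: mip_small0 (Tsemi.2) _ => v [w Tvw].
by rewrite mipDl mipNl -(y'P v w) // -(Tvw x y) // subrr.
Qed.

Lemma semiregularD (k : R[i]) (u v : E * E) : T u -> T v -> T (k *: u + v).
Proof.
case: u v => [x y] [x' y'] Txy Txy'; have [[_ [_ Dlin _] _] _] := Tsemi.
have [|| y'' Ty''] := Dlin k x x'; [by exists y|by exists y'|].
suff -> : k *: (x, y) + (x', y') = (k *: x + x', y'') by [].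
congr (_, _); apply/esym; apply: (semiregular_eq Ty'') => v w Tvw.
by rewrite !mipE (Tvw x y) // (Tvw x' y').
Qed.

Lemma semiregular0 : T 0.
Proof.
have [[_ [[y Ty] _ _] _] _] := Tsemi.
suff y0 : y = 0 by rewrite y0 in Ty.
by apply: (semiregular_eq Ty) => v w Tvw; rewrite !mip0l.
Qed.

Lemma semiregular_ract x y (a : A) : T (x, y) -> T (ract x a, ract y a).
Proof.
move=> Txy; have [[_ [_ _ Dract] _] _] := Tsemi.
have [y' Ty'] := Dract x a (ex_intro _ y Txy).
suff -> : ract y a = y' by [].
apply/esym; apply: (semiregular_eq Ty') => v w Tvw.
by rewrite !mip_ractl; congr amul; apply/esym; exact: (Tvw x y).
Qed.

End SemiregularLinear.

Lemma madjoint_closed T (u : E * E) : (forall e, 0 < e ->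
    exists s, [/\ madjoint T s, rnorm (u.1 - s.1) <= e & rnorm (u.2 - s.2) <= e]) ->
  madjoint T u.
Proof.
move=> uP x w Txw; apply: rnorm_eq_small => e e0.
pose C := 4 * (rnorm w + rnorm x).
have C0 : 0 <= C by rewrite mulr_ge0 // addr_ge0 ?rnorm_ge0.
pose e' := e / (C + 1); have e'0 : 0 < e' by rewrite divr_gt0 // ltr_wpDl.
have e'C : e' * C <= e := ler_div_succ (ltW e0) C0.
have [[y z] [/= Tyz uy uz]] := uP e' e'0.
have /= wy := Tyz x w Txw.
have -> : mip w u.1 - mip x u.2 = mip w (u.1 - y) - mip x (u.2 - z).
  by rewrite !mipE wy; lincomb R; ring.
apply: le_trans (rnormB _ _) _; apply: le_trans e'C; rewrite /C 2!mulrDr.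
apply: lerD.
  apply: le_trans (rnorm_mip_le _ _) _; rewrite mulrC ler_wpM2r //.
  by rewrite mulr_ge0 ?rnorm_ge0.
apply: le_trans (rnorm_mip_le _ _) _; rewrite mulrC ler_wpM2r //.
by rewrite mulr_ge0 ?rnorm_ge0.
Qed.

(** Take [y] near [- q] in the domain of the adjoint, with image [z], and split [p - z]
    approximately as [x1 + z1], with [(x1, w1)] in [T] and [(w1, z1)] in the adjoint; then
    [w1 - (w1 + y) = - y] is near [q]. *)
Lemma regular_complementary T : regular T -> complementary T (madjoint T).
Proof.
move=> [[_ /dense_rnormP dT'] _ /dense_rnormP dR] p q e e0.
have [y [z Tyz] qy] := dT' (- q) e e0.
have [u [x1 [w1 [z1 [Txw Twz ->]]]] pu] := dR (p - z) e e0.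
exists x1, w1, (w1 + y), (z1 + z); split=> //.
- by have := madjointD 1 Twz Tyz; rewrite scale1r.
- by apply: le_trans pu; rewrite addrA opprD addrA [_ - z]addrAC opprD addrA.
- rewrite (_ : q - _ = - (- q - y)) ?rnormN //; lincomb R; ring.
Qed.

(* The graphs are orthogonal, so that the components of a convergent sequence
   of their sum converge separately. *)
Lemma complementary_regular T : semiregular T -> closed T ->
  complementary T (madjoint T) -> regular T.
Proof.
move=> Tsemi Tclosed Tcomp; split=> //; apply/dense_rnormP => u e e0.
(* The second component of the target is 0: in the limit it makes [w = T x] equal to [y], so that
   [u = x + T* T x]. *)
have /choice[f fP] : forall n, exists f : (E * E) * (E * E),
    [/\ T f.1, madjoint T f.2, rnorm (u - (f.1.1 + f.2.2)) <= n.+1%:R^-1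
      & rnorm (0 - (f.1.2 - f.2.1)) <= n.+1%:R^-1].
  move=> n; have [|x [w [y [z P]]]] := Tcomp u 0 n.+1%:R^-1.
    by rewrite invr_gt0.
  by exists ((x, w), (y, z)).
pose g n : E * E := (f n).1; pose h n : E * E := ((f n).2.2, - (f n).2.1).
have orth m n : mip2 (g m - g n + (h m - h n)) = mip2 (g m - g n) + mip2 (h m - h n).
  have Tg : T (g m - g n).
    have [Tm _ _ _] := fP m; have [Tn _ _ _] := fP n.
    by have := semiregularD Tsemi (-1) Tn Tm; rewrite scaleN1r addrC.
  have Th : madjoint T ((f m).2 - (f n).2).
    have [_ Tm _ _] := fP m; have [_ Tn _ _] := fP n.
    by have := madjointD (-1) Tn Tm; rewrite scaleN1r addrC.
  have := Th (g m - g n).1 (g m - g n).2; rewrite -surjective_pairing.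
  rewrite /mip2 /h /g /=.
  set a := (f m).1.1 - _; set b := (f m).1.2 - _; set c := (f m).2.1 - _.
  set d := (f m).2.2 - _ => /(_ Tg) bc.
  have -> : - (f m).2.1 - - (f n).2.1 = - c by rewrite /c; lincomb R; ring.
  have cb := congr1 star bc; rewrite -!mip_star in cb.
  clearbody a b c d; rewrite !mipE bc cb.
  by lincomb R; ring.
have gh_small e' : 0 < e' -> exists N, forall m n, (N <= m)%N -> (N <= n)%N ->
    rnorm (mip2 (g m - g n)) <= e' ^+ 2 /\ rnorm (mip2 (h m - h n)) <= e' ^+ 2.
  move=> e'0; have e4 : 0 < e' / 4 by rewrite divr_gt0.
  have [N le_N] := inv_small e4; exists N => m n Nm Nn.
  have [_ _ um wm] := fP m; have [_ _ un wn] := fP n.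
  have le_e : rnorm (mip2 (g m - g n + (h m - h n))) <= e' ^+ 2.
    rewrite /mip2; set a := _.1; set b := _.2.
    have ae : rnorm a <= e' / 4 + e' / 4.
      have -> : a = (u - ((f n).1.1 + (f n).2.2)) - (u - ((f m).1.1 + (f m).2.2)).
        by rewrite /a /=; lincomb R; ring.
      apply: le_trans (rnormB _ _) _.
      by apply: lerD; [exact: le_trans un (le_N n Nn)|exact: le_trans um (le_N m Nm)].
    have be : rnorm b <= e' / 4 + e' / 4.
      have -> : b = (0 - ((f n).1.2 - (f n).2.1)) - (0 - ((f m).1.2 - (f m).2.1)).
        by rewrite /b /=; lincomb R; ring.
      apply: le_trans (rnormB _ _) _.
      by apply: lerD; [exact: le_trans wn (le_N n Nn)|exact: le_trans wm (le_N m Nm)].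
    apply: le_trans (rnormD _ _) _; rewrite !rnorm_mip.
    have a0 := rnorm_ge0 a; have b0 := rnorm_ge0 b.
    move: (rnorm a) (rnorm b) ae be a0 b0 => ra rb ae be a0 b0; nra.
  split; apply: le_trans le_e; rewrite orth.
    by apply: rnorm_amul_le; exact: opos_mip2.
  rewrite (addrC (mip2 (g m - g n))).
  by apply: rnorm_amul_le; exact: opos_mip2.
have sqr_le (v : E) (e' : R) : 0 < e' -> rnorm v ^+ 2 <= e' ^+ 2 -> rnorm v <= e'.
  by move=> e'0; rewrite ler_sqr ?nnegrE ?rnorm_ge0 ?(ltW e'0).
have cvg_cmp (k : nat -> E) : (forall m n e', 0 < e' ->
      rnorm (mip2 (g m - g n)) <= e' ^+ 2 /\ rnorm (mip2 (h m - h n)) <= e' ^+ 2 ->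
      rnorm (k m - k n) <= e') -> exists l, rcvg k l.
  move=> kP; apply: rcauchy_cvg => e' e'0; have [N NP] := gh_small _ e'0.
  by exists N => m n Nm Nn; apply: kP => //; exact: NP.
have [x ax] : exists l, rcvg (fun n => (g n).1) l.
  apply: cvg_cmp => m n e' e'0 [le_e _]; apply: sqr_le => //.
  exact: le_trans (rnorm_mip2_1 _) le_e.
have [w aw] : exists l, rcvg (fun n => (g n).2) l.
  apply: cvg_cmp => m n e' e'0 [le_e _]; apply: sqr_le => //.
  exact: le_trans (rnorm_mip2_2 _) le_e.
have [z az] : exists l, rcvg (fun n => (f n).2.2) l.
  apply: cvg_cmp => m n e' e'0 [_ le_e]; apply: sqr_le => //.
  exact: le_trans (rnorm_mip2_1 (h m - h n)) le_e.
have [y ay] : exists l, rcvg (fun n => (f n).2.1) l.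
  apply: cvg_cmp => m n e' e'0 [_ le_e]; apply: sqr_le => //.
  apply: le_trans le_e; apply: le_trans (rnorm_mip2_2 (h m - h n)).
  by rewrite /= -opprD rnormN.
have lim2 (k k' : nat -> E) l l' (S : set (E * E)) : rcvg k l -> rcvg k' l' ->
    (forall n, S (k n, k' n)) -> forall e', 0 < e' ->
    exists s, [/\ S s, rnorm (l - s.1) <= e' & rnorm (l' - s.2) <= e'].
  move=> kl k'l' kS e' e'0; have [N kN] := kl _ e'0; have [N' k'N] := k'l' _ e'0.
  exists (k (maxn N N'), k' (maxn N N')).
  by split; [exact: kS|apply: kN; exact: leq_maxl|apply: k'N; exact: leq_maxr].
have Txw : T (x, w).
  apply: (closed_rnormP Tclosed); apply: lim2 ax aw _ => n.
  by rewrite -surjective_pairing; have [] := fP n.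
have Tyz : madjoint T (y, z).
  apply: madjoint_closed; apply: lim2 ay az _ => n.
  by rewrite -surjective_pairing; have [] := fP n.
have wy : w = y.
  apply: rnorm_eq_small => e' e'0; have e3 : 0 < e' / 3 by rewrite divr_gt0.
  have [N1 wN] := aw _ e3; have [N2 yN] := ay _ e3; have [N3 le_N] := inv_small e3.
  pose n := maxn (maxn N1 N2) N3; have [_ _ _ fn] := fP n.
  have -> : w - y = (w - (g n).2) + ((f n).2.1 - y) - (0 - ((f n).1.2 - (f n).2.1)).
    by rewrite /g; lincomb R; ring.
  have -> : e' = e' / 3 + e' / 3 + e' / 3 by field.
  apply: le_trans (rnormB _ _) _; apply: lerD; last first.
    by apply: le_trans fn (le_N _ _); exact: leq_maxr.
  apply: le_trans (rnormD _ _) _; apply: lerD.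
    by apply: wN; rewrite !leq_max leqnn.
  by rewrite rnorm_distC; apply: yN; rewrite !leq_max leqnn orbT.
have uxz : u = x + z.
  apply: rnorm_eq_small => e' e'0; have e3 : 0 < e' / 3 by rewrite divr_gt0.
  have [N1 xN] := ax _ e3; have [N2 zN] := az _ e3; have [N3 le_N] := inv_small e3.
  pose n := maxn (maxn N1 N2) N3; have [_ _ fn _] := fP n.
  have -> : u - (x + z) = ((g n).1 - x) + ((f n).2.2 - z) + (u - ((f n).1.1 + (f n).2.2)).
    by rewrite /g; lincomb R; ring.
  have -> : e' = e' / 3 + e' / 3 + e' / 3 by field.
  apply: le_trans (rnormD _ _) _; apply: lerD; last first.
    by apply: le_trans fn (le_N _ _); exact: leq_maxr.
  apply: le_trans (rnormD _ _) _; apply: lerD.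
    by rewrite rnorm_distC; apply: xN; rewrite !leq_max leqnn.
  by rewrite rnorm_distC; apply: zN; rewrite !leq_max leqnn orbT.
exists u; last by rewrite subrr rnorm0 ltW.
by exists x, w, z; split=> //; rewrite wy.
Qed.

End ModuleOperators.

(** * Localizations along representations *)

Section FiniteSums.
Context (V : nmodType) (S : set V).

Lemma finite_sums_sub : S `<=` finite_sums S.
Proof. by move=> x Sx; exists 1%N, (fun=> x); rewrite big_ord1. Qed.

Lemma finite_sumsD x y : finite_sums S x -> finite_sums S y ->
  finite_sums S (x + y).
Proof.
move=> [n [s [sS ->]]] [m [t [tS ->]]].
exists (n + m)%N, (fun i => match fintype.split i with inl j => s j | inr j => t j end).
split=> [i|]; first by case: (fintype.split i).
rewrite big_split_ord /=; congr (_ + _); apply: eq_bigr => i _.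
  by case: splitP => [j /= /val_inj ->|j /= e] //; have := ltn_ord i; rewrite e ltnNge leq_addr.
case: splitP => [j /= e|j /= /eqP]; last by rewrite eqn_add2l => /eqP/val_inj ->.
by have := ltn_ord j; rewrite -e ltnNge leq_addr.
Qed.

Lemma finite_sums_ind (P : V -> Prop) : P 0 ->
  (forall x y, P x -> P y -> P (x + y)) -> (forall x, S x -> P x) ->
  forall x, finite_sums S x -> P x.
Proof.
move=> P0 PD SP x [n [s [sS ->]]].
by apply: (big_ind P) => // i _; exact: SP.
Qed.

End FiniteSums.

Section Representations.
Context (R : realType) (A : cstarAlgType R) (H : hilbertType R).
Context (pi : representation A H).
Implicit Types (a b c : A) (h : H).

Lemma rep_selfadjoint c h h' : star c = c ->
  inner (pi c h) h' = inner h (pi c h').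
Proof. by move=> cc; rewrite -{1}cc rep_star. Qed.

Lemma rep_adj b h h' : inner (pi b h) h' = inner h (pi (star b) h').
Proof. by rewrite -{1}(starK b) rep_star. Qed.

Lemma repE k a b h : pi (k *: a + b) h = k *: pi a h + pi b h.
Proof. exact: rep_linear. Qed.

Lemma rep0 h : pi 0 h = 0.
Proof.
have := repE 1 0 0 h; rewrite !scale1r addr0 => e.
by apply: (addrI (pi 0 h)); rewrite -e addr0.
Qed.

Lemma repZ k a h : pi (k *: a) h = k *: pi a h.
Proof. by have := repE k a 0 h; rewrite addr0 rep0 addr0. Qed.

(* If [b* b = 2 c - c^2] with [c] selfadjoint, then
   [|h|^2 - |pi(b) h|^2 = |h - pi(c) h|^2]. *)
Lemma rep_contractive b h : rnorm (pi b h) <= rnorm b * rnorm h.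
Proof.
apply/ler_addgt0Pr => e e0.
pose d := e / (rnorm h + 1).
have d0 : 0 < d by rewrite divr_gt0 // ltr_wpDl ?rnorm_ge0.
(* [t] exceeds [|b|], so that [b* b / t^2] has norm at most [rho^2 < 1] and the square root
   exists. *)
pose t := rnorm b + d; have t0 : 0 < t by rewrite ltr_wpDl ?rnorm_ge0.
suff le_t : rnorm (pi b h) <= t * rnorm h.
  apply: le_trans le_t _; rewrite mulrDl lerD2l.
  by apply: ler_div_succ; rewrite ?rnorm_ge0 ?(ltW e0).
pose rho := rnorm b / t.
have rho01 : 0 <= rho < 1.
  by rewrite divr_ge0 ?rnorm_ge0 ?(ltW t0) //= ltr_pdivrMr // mul1r ltrDl.
pose s := (t^-1 ^+ 2)%:C *: amul (star b) b.
have ss : star s = s.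
  by rewrite /s starZ conj_real_complex star_amul starK.
have sM : rnorm s <= rho ^+ 2.
  rewrite /s rnormZc rnorm_cstar ger0_norm ?sqr_ge0 //.
  by rewrite /rho exprMn mulrC.
have [c cc sE] := sqrt_element rho01 ss sM.
have tb : (t^-1 ^+ 2)%:C * inner (pi b h) (pi b h) = inner h (pi s h).
  by rewrite /s repZ rep_amul innerZr -rep_adj.
have pos : inner h h - inner h (pi s h) = inner (h - pi c h) (h - pi c h).
  rewrite innerBl !innerBr [inner (pi c h) (pi c h)]rep_selfadjoint //.
  rewrite [inner (pi c h) h]rep_selfadjoint // -rep_amul sE.
  have -> : pi ((2%:R)%:C *: c - amul c c) h =
      (2%:R)%:C *: pi c h - pi (amul c c) h.
    by rewrite repE -scaleN1r repZ scaleN1r.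
  rewrite innerBr innerZr; ring.
have : 0 <= inner h h - (t^-1 ^+ 2)%:C * inner (pi b h) (pi b h).
  by rewrite tb pos inner_ge0.
rewrite !innerE -rmorphM -rmorphB ler0c subr_ge0.
rewrite -exprMn ler_sqr ?nnegrE ?mulr_ge0 ?invr_ge0 ?rnorm_ge0 ?(ltW t0) //.
by rewrite ler_pdivrMl.
Qed.

End Representations.

Section TensorLocalization.
Context (R : realType) (A : cstarAlgType R) (E : hilbertModType A).
Context (H : hilbertType R) (pi : representation A H) (K : interior_tensor E pi).
Implicit Types (T : set (E * E)).

(** If [<x, x> = b* b], then the norm of the tensor is [|pi(b) h|], and [|b| = |x|]. *)
Lemma rnorm_tens x h : rnorm (tens K x h) <= rnorm x * rnorm h.
Proof.
have [b xb] := mip_positive x.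
have bx : rnorm b = rnorm x.
  by apply/eqP; rewrite -(eqrXn2 (n := 2)) ?rnorm_ge0 // -rnorm_cstar -xb rnorm_mip.
rewrite -bx; apply: le_trans (rep_contractive pi b h).
rewrite -ler_sqr ?nnegrE ?rnorm_ge0 // -lecR -!innerE.
by rewrite tens_inner xb rep_amul -rep_adj.
Qed.

Lemma tens0l h : tens K 0 h = 0.
Proof.
apply/eqP; rewrite -rnorm_eq0 eq_le rnorm_ge0 andbT.
by rewrite (le_trans (rnorm_tens _ _)) // rnorm0 mul0r.
Qed.

Lemma tensBl x y h : tens K (x - y) h = tens K x h - tens K y h.
Proof. by rewrite addrC -scaleN1r tens_linearl scaleN1r addrC. Qed.

Lemma tensDl x y h : tens K (x + y) h = tens K x h + tens K y h.
Proof. by have := tens_linearl K h 1 x y; rewrite !scale1r. Qed.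

Lemma rep_localization_madjoint T :
  rep_localization0 K (madjoint T) `<=` hadjoint (rep_localization0 K T).
Proof.
move=> u uP x w xwP.
pose f (u v : it_space K * it_space K) := inner v.2 u.1 = inner v.1 u.2.
suff : f u (x, w) by [].
have fD u1 u2 v : f u1 v -> f u2 v -> f (u1 + u2) v.
  by rewrite /f /= !innerDr => -> ->.
have fD' u1 v1 v2 : f u1 v1 -> f u1 v2 -> f u1 (v1 + v2).
  by rewrite /f /= !innerDl => -> ->.
have f0 v : f 0 v by rewrite /f /= !inner0r.
have f0' v : f v 0 by rewrite /f /= !inner0l.
move: (x, w) xwP => v vP {x w}.
apply: (finite_sums_ind (P := fun u => f u v)) uP => //.
  by move=> u1 u2; exact: fD.
move=> _ [[y z] Tyz [h _ <-]].
apply: (finite_sums_ind (P := fun v => f _ v)) vP => //.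
  by move=> v1 v2; exact: fD'.
move=> _ [[x w] Txw [h' _ <-]].
by rewrite /f /= !tens_inner (Tyz x w).
Qed.

Lemma rep_localization_complementary T T' : complementary T T' ->
  complementary (rep_localization0 K T) (rep_localization0 K T').
Proof.
move=> Tcomp.
(* Approximability by the span is additive, which leaves the pairs of elementary tensors with a
   common [h]; these inherit it from [Tcomp], with the error scaled by [|h|]. *)
pose Q (u : it_space K * it_space K) := forall e : R, 0 < e -> exists v v',
  [/\ rep_localization0 K T v, rep_localization0 K T' v',
    rnorm (u.1 - (v.1 + v'.2)) <= e & rnorm (u.2 - (v.2 - v'.1)) <= e].
have QD u1 u2 : Q u1 -> Q u2 -> Q (u1 + u2).
  move=> Q1 Q2 e e0; have e20 : 0 < e / 2 by rewrite divr_gt0.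
  have [v1 [v1' [v1P v1'P e1 e1']]] := Q1 _ e20.
  have [v2 [v2' [v2P v2'P e2 e2']]] := Q2 _ e20.
  exists (v1 + v2), (v1' + v2').
  split; [exact: finite_sumsD|exact: finite_sumsD| |]; rewrite (splitr e).
    have -> : (u1 + u2).1 - ((v1 + v2).1 + (v1' + v2').2) =
        (u1.1 - (v1.1 + v1'.2)) + (u2.1 - (v2.1 + v2'.2)).
      by move=> /=; lincomb R; ring.
    by apply: le_trans (rnormD _ _) _; exact: lerD.
  have -> : (u1 + u2).2 - ((v1 + v2).2 - (v1' + v2').1) =
      (u1.2 - (v1.2 - v1'.1)) + (u2.2 - (v2.2 - v2'.1)).
    by move=> /=; lincomb R; ring.
  by apply: le_trans (rnormD _ _) _; exact: lerD.
have Qtens x y h : Q (tens K x h, tens K y h).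
  move=> e e0; pose e' := e / (rnorm h + 1).
  have e'0 : 0 < e' by rewrite divr_gt0 // ltr_wpDl ?rnorm_ge0.
  have e'h : e' * rnorm h <= e := ler_div_succ (ltW e0) (rnorm_ge0 h).
  have [x' [w [y' [z [Tx Ty e1 e2]]]]] := Tcomp x y e' e'0.
  exists (tens K x' h, tens K w h), (tens K y' h, tens K z h); split=> /=.
  - by apply: finite_sums_sub; exists (x', w) => //; exists h.
  - by apply: finite_sums_sub; exists (y', z) => //; exists h.
  - rewrite -tensDl -tensBl (le_trans (rnorm_tens _ _)) // (le_trans _ e'h) //.
    by rewrite ler_wpM2r ?rnorm_ge0.
  - rewrite -!tensBl (le_trans (rnorm_tens _ _)) // (le_trans _ e'h) //.
    by rewrite ler_wpM2r ?rnorm_ge0.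
have Q0 : Q 0 by have := Qtens 0 0 0; rewrite !tens0l.
have QS p q : finite_sums [set tens K x h | x in setT & h in setT] p ->
    finite_sums [set tens K x h | x in setT & h in setT] q -> Q (p, q).
  move=> pS qS; have -> : (p, q) = (p, 0) + (0, q).
    by congr (_, _); rewrite ?addr0 ?add0r.
  apply: (QD).
    apply: (finite_sums_ind (P := fun p => Q (p, 0))) pS => // [p1 p2 Q1 Q2|_ [x _ [h _ <-]]].
      by have := QD _ _ Q1 Q2; rewrite [_ + _](_ : _ = (p1 + p2, 0 + 0)) // addr0.
    by have := Qtens x 0 h; rewrite tens0l.
  apply: (finite_sums_ind (P := fun q => Q (0, q))) qS => // [p1 p2 Q1 Q2|_ [x _ [h _ <-]]].
    by have := QD _ _ Q1 Q2; rewrite [_ + _](_ : _ = (0 + 0, p1 + p2)) // addr0.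
  by have := Qtens 0 x h; rewrite tens0l.
move=> p q e e0; have e20 : 0 < e / 2 by rewrite divr_gt0.
have /dense_rnormP Kd := @tens_dense _ _ _ _ _ K.
have [p' p'S pp'] := Kd p _ e20; have [q' q'S qq'] := Kd q _ e20.
have [[v1 v2] [[v1' v2'] [/= vP v'P e1 e2]]] := QS p' q' p'S q'S _ e20.
exists v1, v2, v1', v2'; split=> //; rewrite (splitr e).
  by apply: le_trans (rnorm_dist p' _ _) _; exact: lerD.
by apply: le_trans (rnorm_dist q' _ _) _; exact: lerD.
Qed.

Lemma rep_localization_regular T : complementary T (madjoint T) ->
  rep_localization K (madjoint T) = hadjoint (rep_localization K T).
Proof.
move=> Tcomp; apply: hadjoint_complementary.
  exact: rep_localization_madjoint.
exact: rep_localization_complementary.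
Qed.

End TensorLocalization.

(** * Localizations at states *)

Section StateLocalizations.
Context (R : realType) (A : cstarAlgType R) (E : hilbertModType A).
Context (omega : state A) (K : state_space E omega).
Implicit Types (T : set (E * E)) (x y : E) (a : A).

Lemma state_le a : rnorm (omega a : R[i]) <= rnorm a.
Proof.
pose S := [set complex.Re `|omega a : R[i]| | a in [set a | `|a| <= 1]].
have S1 : sup S = 1 := state_norm1 omega.
(* The supremum of an unbounded set is 0 by convention, so the value 1 yields boundedness. *)
have supS : has_sup S.
  by apply: contrapT => /sup_out; rewrite S1 => /eqP; rewrite oner_eq0.
apply/ler_addgt0Pr => e e0.
have ae : 0 < rnorm a + e by rewrite ltr_wpDl ?rnorm_ge0.
have : S (rnorm (omega ((rnorm a + e)^-1%:C *: a) : R[i])).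
  exists ((rnorm a + e)^-1%:C *: a) => //=.
  rewrite normE -(rmorph1 (real_complex R)) lecR rnormZc.
  by rewrite ger0_norm ?invr_ge0 ?(ltW ae) // ler_pdivrMl // mulr1 lerDl ltW.
move=> /(sup_upper_bound supS); rewrite -/S S1 linearZ /=.
rewrite [_ *: _](_ : _ = (rnorm a + e)^-1%:C * (omega a : R[i])) //.
rewrite rnormM rnormc ger0_norm ?invr_ge0 ?(ltW ae) // ler_pdivrMl //.
by rewrite mulr1.
Qed.

Lemma rnorm_iota x : rnorm (iota_st K x) <= rnorm x.
Proof.
rewrite -ler_sqr ?nnegrE ?rnorm_ge0 // -rnorm_mip.
apply: le_trans (state_le (mip x x)).
rewrite -(iota_inner K) innerE rnormc ger0_norm ?sqr_ge0 //.
Qed.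

Lemma state_localization_madjoint T :
  state_localization0 K (madjoint T) `<=` hadjoint (state_localization0 K T).
Proof.
move=> _ [[y z] Tyz <-] _ _ [[x w] Txw [<- <-]] /=.
by rewrite !iota_inner (Tyz x w).
Qed.

Lemma state_localization_complementary T T' : complementary T T' ->
  complementary (state_localization0 K T) (state_localization0 K T').
Proof.
move=> Tcomp p q e e0; have e20 : 0 < e / 2 by rewrite divr_gt0.
have /dense_rnormP Kd := @iota_dense _ _ _ _ K.
have [_ [u _ <-] pu] := Kd p _ e20; have [_ [v _ <-] qv] := Kd q _ e20.
have [x [w [y [z [Tx Ty e1 e2]]]]] := Tcomp u v _ e20.
exists (iota_st K x), (iota_st K w), (iota_st K y), (iota_st K z).
split; [by exists (x, w)|by exists (y, z)| |]; rewrite (splitr e).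
  apply: le_trans (rnorm_dist (iota_st K u) _ _) _; apply: lerD => //.
  by rewrite -linearD -linearB (le_trans (rnorm_iota _)).
apply: le_trans (rnorm_dist (iota_st K v) _ _) _; apply: lerD => //.
by rewrite -!linearB (le_trans (rnorm_iota _)).
Qed.

Lemma state_localization_regular T : complementary T (madjoint T) ->
  state_localization K (madjoint T) = hadjoint (state_localization K T).
Proof.
move=> Tcomp; apply: hadjoint_complementary.
  exact: state_localization_madjoint.
exact: state_localization_complementary.
Qed.

End StateLocalizations.

(** * Positive functionals and the GNS construction *)

Section Complexification.
Context (R : realType) (A : cstarAlgType R) (f : A -> R).
Hypothesis flin : real_linear f.
Hypothesis f_le : forall a, f a <= rnorm a.
Hypothesis f_pos : forall lam a, opos (fun z => lam%:C *: z + amul a z) -> - lam <= f a.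
Implicit Types (a b : A).

(** Real and imaginary parts: [f] is linear over the reals only, and its values on selfadjoint
    elements alone are kept. *)
Let re a := (2^-1)%:C *: (a + star a).
Let im a := (2^-1)%:C *: ('i *: (star a - a)).
Let om a : R[i] := (f (re a))%:C + 'i * (f (im a))%:C.

Let fD a b : f (a + b) = f a + f b. Proof. exact: flin.1. Qed.
Let fZ t a : f (t%:C *: a) = t * f a. Proof. exact: flin.2. Qed.
Let fN a : f (- a) = - f a.
Proof.
by rewrite -scaleN1r -(rmorph1 (real_complex R)) -rmorphN fZ mulN1r.
Qed.

Let omD a b : om (a + b) = om a + om b.
Proof.
rewrite /om.
have -> : re (a + b) = re a + re b by rewrite /re starD; lincomb R; ring.
have -> : im (a + b) = im a + im b by rewrite /im starD; lincomb R; ring.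
by rewrite !fD !rmorphD; ring.
Qed.

Let omZ t a : om (t%:C *: a) = t%:C * om a.
Proof.
rewrite /om.
have -> : re (t%:C *: a) = t%:C *: re a.
  by rewrite /re starZ conj_real_complex; lincomb R; ring.
have -> : im (t%:C *: a) = t%:C *: im a.
  by rewrite /im starZ conj_real_complex; lincomb R; ring.
by rewrite !fZ !rmorphM /=; ring.
Qed.

Let omi a : om ('i *: a) = 'i * om a.
Proof.
rewrite /om.
have -> : re ('i *: a) = - im a.
  by rewrite /re /im starZ conjCi; lincomb R; ring.
have -> : im ('i *: a) = re a.
  rewrite /re /im starZ conjCi scaleNr !(scalerBr 'i, scalerN 'i) !scale_ii.
  by lincomb R; ring.
rewrite fN rmorphN mulrDr mulrA -expr2 sqrCi; ring.
Qed.

Let om_linear : linear (om : A -> R[i]^o).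
Proof.
move=> k a b; rewrite omD; congr (_ + _).
rewrite [in LHS](complexE k) complexiE scalerDl -scalerA omD omZ omi omZ.
by rewrite mulrA -mulrDl -complexiE -complexE.
Qed.

(** [lam + a >= 0] makes [a] selfadjoint, and there [omega] and [f] agree; so positivity on the
    unitization is inherited. The constant 2 adds up the real and imaginary parts. *)
Lemma complexified_functional : exists omega : {linear A -> R[i]^o},
  [/\ forall a, omega (star a) = (omega a : R[i])^*,
    forall lam a, opos (fun z => lam%:C *: z + amul a z) ->
      0 <= lam%:C + (omega a : R[i]),
    forall a, star a = a -> omega a = (f a)%:C &
    forall a, rnorm (omega a : R[i]) <= 2 * rnorm a].
Proof.
pose om' : A -> R[i]^o := om.
pose m := GRing.isLinear.Build _ _ _ _ om' om_linear.
pose omega : {linear A -> R[i]^o} := HB.pack_for {linear A -> R[i]^o} om' m.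
have omE a : omega a = om a by [].
have om_sa a : star a = a -> om a = (f a)%:C.
  move=> aa; rewrite /om.
  have -> : re a = a by apply/esym/(@eq_scaleV R _ 1); rewrite aa; lincomb R; ring.
  have -> : im a = 0 by rewrite /im aa subrr !scaler0.
  have -> : f 0 = 0 by have := fZ 0 0; rewrite scaler0 mul0r.
  by rewrite rmorph0 mulr0 addr0.
exists omega; split=> [a|lam a apos|a|a]; rewrite ?omE.
- rewrite /om.
  have -> : re (star a) = re a by rewrite /re starK; lincomb R; ring.
  have -> : im (star a) = - im a by rewrite /im starK; lincomb R; ring.
  have conjE (x y : R) : (x%:C + 'i * y%:C : R[i])^* = x%:C - 'i * y%:C.
    by rewrite rmorphD rmorphM /= conjCi !conj_real_complex mulNr.
  by rewrite conjE fN rmorphN mulrN.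
- have [/isadj_shift/isadj_amul_sa aa _] := apos.
  by rewrite om_sa // -rmorphD ler0c -lerBlDl sub0r f_pos.
- exact: om_sa.
- have f_abs b : `|f b| <= rnorm b.
    by rewrite ler_norml f_le andbT lerNl -fN (le_trans (f_le _)) // rnormN.
  have half b b' : rnorm b' = rnorm b -> rnorm ((2^-1)%:C *: b) + rnorm ((2^-1)%:C *: b') = rnorm b.
    by move=> e; rewrite !rnormZc e ger0_norm ?invr_ge0 // -mulrDl -[2^-1]mul1r -splitr mul1r.
  rewrite /om (le_trans (rnormD _ _)) // rnormM rnormi mul1r !rnormc.
  have le1 : rnorm (re a) <= rnorm a.
    rewrite /re scalerDr (le_trans (rnormD _ _)) //.
    by rewrite half ?rnorm_star.
  have le2 : rnorm (im a) <= rnorm a.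
    rewrite /im rnormZc rnormZ rnormi mul1r ger0_norm ?invr_ge0 //.
    rewrite ler_pdivrMl // (le_trans (rnormB _ _)) // rnorm_star.
    by rewrite mulr2n mulrDl mul1r.
  have := f_abs (re a); have := f_abs (im a); lra.
Qed.

End Complexification.

Section PositiveFunctional.
Context (R : realType) (A : cstarAlgType R) (E : hilbertModType A).
Context (om : {linear A -> R[i]^o}).
Hypothesis omJ : forall a, om (star a) = (om a : R[i])^*.
Hypothesis om_ge0 : forall a, opos (amul a) -> 0 <= (om a : R[i]).

Let omDZ k a b : om (k *: a + b) = k * (om a : R[i]) + (om b : R[i]) :> R[i].
Proof. exact: linearP. Qed.

Definition functional_form : semi_inner E.
Proof.
apply: (@SemiInner R E (fun x y => om (mip x y))) => [x k y z|x y|x].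
- by rewrite mip_linearr omDZ.
- by rewrite mip_star omJ.
- exact: om_ge0 (opos_mip x).
Defined.

Definition functional_space : hilbertType R := completion functional_form.

Lemma functional_iota : exists iota : {linear E -> functional_space},
  (forall x y, inner (iota x) (iota y) = om (mip x y)) /\
  (forall h (e : R), 0 < e -> exists x, rnorm (h - iota x) <= e).
Proof.
pose io : E -> functional_space := cmap functional_form.
pose m := GRing.isLinear.Build _ _ _ _ io (cmap_linear functional_form).
pose iota : {linear E -> functional_space} :=
  HB.pack_for {linear E -> functional_space} io m.
exists iota; split=> [x y|h e e0]; first exact: cinner_cmap.
exact: (cmap_dense h e0).
Qed.

(** Division by the norm [N] of [om]; the crude bound 2 makes the supremum over the unit ball
    finite. *)
Lemma state_normalization : (exists a, om a != 0 :> R[i]) ->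
  (forall a, rnorm (om a : R[i]) <= 2 * rnorm a) ->
  exists (omega : state A) (N : R), 0 < N /\
    forall a, om a = N%:C * (omega a : R[i]) :> R[i].
Proof.
move=> [a0 oma0] om_le.
pose S := [set complex.Re `|om a : R[i]| | a in [set a | `|a| <= 1]].
have norm1 a : (`|a| <= 1 :> R[i]) = (rnorm a <= 1).
  by rewrite normE -(rmorph1 (real_complex R)) lecR.
have supS : has_sup S.
  split; first by exists (rnorm (om 0 : R[i])), 0 => //=; rewrite normr0.
  exists 2 => _ [a /= + <-]; rewrite norm1 => a1.
  by apply: le_trans (om_le a) _; have := rnorm_ge0 a; lra.
pose N := sup S.
have SN a : rnorm a <= 1 -> rnorm (om a : R[i]) <= N.
  by move=> a1; apply: sup_upper_bound => //; exists a => //=; rewrite norm1.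
have omZ k a : om (k *: a) = k * (om a : R[i]) :> R[i] by exact: linearZ.
have N0 : 0 < N.
  have r1 : 0 < rnorm a0 + 1 by rewrite ltr_wpDl ?rnorm_ge0.
  have := SN ((rnorm a0 + 1)^-1%:C *: a0); rewrite rnormZc omZ rnormM rnormc.
  rewrite ger0_norm ?invr_ge0 ?(ltW r1) // ler_pdivrMl // mulr1 lerDl ler01.
  move=> /(_ isT); apply: lt_le_trans; rewrite mulr_gt0 ?invr_gt0 //.
  by rewrite lt_def rnorm_eq0 oma0 rnorm_ge0.
pose st a : R[i]^o := N^-1%:C * (om a : R[i]).
have st_lin : linear st.
  by move=> k a b; rewrite /st omDZ; rewrite mulrDr mulrCA.
pose m := GRing.isLinear.Build _ _ _ _ st st_lin.
pose stl : {linear A -> R[i]^o} := HB.pack_for {linear A -> R[i]^o} st m.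
have stE a : rnorm (st a : R[i]) = N^-1 * rnorm (om a : R[i]).
  by rewrite rnormM rnormc ger0_norm // invr_ge0 ltW.
have st_pos a : 0 <= (stl (amul (star a) a) : R[i]).
  rewrite mulr_ge0 ?ler0c ?invr_ge0 ?(ltW N0) //.
  by apply: om_ge0; apply: opos_apositive; exists a.
have st_norm : sup [set complex.Re `|stl a : R[i]| | a in [set a | `|a| <= 1]] = 1.
  set S' := (X in sup X).
  have S'1 x : S' x -> x <= 1.
    move=> [a /= + <-]; rewrite norm1 => a1; rewrite [leLHS](stE a).
    by rewrite ler_pdivrMl // mulr1 SN.
  have supS' : has_sup S'.
    split; last by exists 1 => x; exact: S'1.
    by exists (rnorm (stl 0 : R[i])), 0 => //=; rewrite normr0.
  apply/eqP; rewrite eq_le; apply/andP; split.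
    by apply: ge_sup; [exact: supS'.1|move=> x; exact: S'1].
  rewrite -(ler_pM2l N0) mulr1; apply: ge_sup; first exact: supS.1.
  move=> _ [a /= a1 <-]; rewrite -[leLHS]/(rnorm (om a : R[i])).
  rewrite -ler_pdivrMl // -stE; apply: sup_upper_bound => //.
  by exists a.
exists (@State R A stl st_pos st_norm), N; split=> // a.
rewrite /= /st mulrA -rmorphM /= mulfV ?gt_eqF // rmorph1 mul1r //.
Qed.

End PositiveFunctional.

Lemma bounded_linear_continuous (R : realType) (M N : normedModType R[i])
    (f : {linear M -> N}) (C : R) : 0 <= C ->
  (forall x, rnorm (f x) <= C * rnorm x) -> continuous f.
Proof.
move=> C0 fC x B /nbhs_rnormP[e e0 eB]; apply/nbhs_rnormP.
exists (e / (C + 1)) => [|y xy]; first by rewrite divr_gt0 // ltr_wpDl.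
apply: eB; rewrite -linearB (le_trans (fC _)) // mulrC.
apply: le_trans (ler_div_succ (ltW e0) C0).
by rewrite ler_wpM2r.
Qed.

(** For identities between bounded maps, checked on a dense image. [k] and [phi] are bare functions,
    so that differences of composites fit without being packed as linear maps. *)
Lemma dense_zero (R : realType) (V : Type) (H W : normedModType R[i])
    (k : V -> H) (phi : H -> W) (M : R) : 0 <= M ->
  (forall h h', phi (h - h') = phi h - phi h') ->
  (forall h, rnorm (phi h) <= M * rnorm h) ->
  (forall h (e : R), 0 < e -> exists v, rnorm (h - k v) <= e) ->
  (forall v, phi (k v) = 0) -> forall h, phi h = 0.
Proof.
move=> M0 phiB phiM kd phi0 h; apply: rnorm_small0 => e e0.
have [|v hv] := kd h (e / (M + 1)); first by rewrite divr_gt0 // ltr_wpDl.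
have -> : phi h = phi (h - k v) by rewrite phiB phi0 subr0.
apply: le_trans (phiM _) _; rewrite mulrC.
by apply: le_trans (ler_div_succ (ltW e0) M0); rewrite ler_wpM2r.
Qed.

(** * The GNS representation and the tensor product over it *)

Section GNS.
Context (R : realType) (A : cstarAlgType R) (E : hilbertModType A).
Context (om : {linear A -> R[i]^o}).
Hypothesis omJ : forall a, om (star a) = (om a : R[i])^*.
Hypothesis om_ge0 : forall lam a, opos (fun z => lam%:C *: z + amul a z) ->
  0 <= lam%:C + (om a : R[i]).
Implicit Types (a b c : A) (x y : E).

Local Notation unitization := (R[i]^o * A)%type.
Implicit Types (v w : unitization).

Let omD a b : om (a + b) = (om a : R[i]) + om b :> R[i].
Proof. exact: linearD. Qed.

Let omZ k a : om (k *: a) = k * (om a : R[i]) :> R[i].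
Proof. exact: linearZ. Qed.

Let omN a : om (- a) = - (om a : R[i]) :> R[i].
Proof. exact: linearN. Qed.

(* The element [v* c w] of [A], for [v w] in the unitization of [A]. *)
Definition sandwich v c w : A :=
  (((v.1 : R[i])^* * w.1) *: c + (v.1 : R[i])^* *: amul c w.2) +
  ((w.1 : R[i]) *: amul (star v.2) c + amul (star v.2) (amul c w.2)).

(* [om (v* w)] for the extension of [om] to the unitization by [om 1 = 1]. *)
Definition unitization_prod v w : R[i] :=
  (v.1 : R[i])^* * w.1 + (v.1 : R[i])^* * om w.2 +
  ((w.1 : R[i]) * om (star v.2) + om (amul (star v.2) w.2)).

Let wleft v (z : A) : A := (v.1 : R[i]) *: z + amul v.2 z.
(** Left multiplication by [v*], the adjoint of [wleft v]; their composite is multiplication by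
    [v* v], expanded in [sqE]. *)
Let wright v (z : A) : A := (v.1 : R[i])^* *: z + amul (star v.2) z.

Let wadj v : isadj (wleft v) (wright v).
Proof.
apply: isadjD; last exact: isadj_amul.
exact: (isadj_scale (v.1 : R[i]) (@isadj_id R A)).
Qed.

Let wbounded v : bounded (wleft v).
Proof.
apply: boundedD; last exact: bounded_amul.
by exists (rnorm (v.1 : R[i])) => [|z]; rewrite ?rnorm_ge0 ?rnormZ.
Qed.

Let sqE v : wright v \o wleft v = fun z => (rnorm (v.1 : R[i]) ^+ 2)%:C *: z +
  amul ((v.1 : R[i])^* *: v.2 + (v.1 : R[i]) *: star v.2 + amul (star v.2) v.2) z.
Proof.
apply/funext => z; rewrite /wleft /wright /= rnorm_sqr !amulE amulA.
by lincomb R; ring.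
Qed.

Lemma unitization_prod_ge0 v : 0 <= unitization_prod v v.
Proof.
have [w wE] := isadj_linear (wadj v); have [w' w'E] := isadj_linear (isadj_sym (wadj v)).
have := wadj v; have := wbounded v; rewrite wE w'E => wb ww'.
have := opos_adj_mul ww' wb; rewrite -wE -w'E sqE => /om_ge0.
by rewrite rnorm_sqr !omD !omZ /unitization_prod !addrA.
Qed.

Definition unitization_form : semi_inner unitization.
Proof.
apply: (@SemiInner R unitization unitization_prod) => [v k w w'|v w|v].
- rewrite /unitization_prod /= !amulE !omD !omZ /GRing.scale /=; ring.
- rewrite /unitization_prod !rmorphD !rmorphM /= -!omJ !conjCK.
  by rewrite star_amul !starK; ring.
- exact: unitization_prod_ge0.
Defined.

(** Conjugation of [|c| - c >= 0] by [v], followed by [om]. Both the GNS operators and tensoring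
    with a fixed vector of E owe their boundedness to it. *)
Lemma sandwich_le c v : opos (amul c) ->
  (om (sandwich v c v) : R[i]) <= (rnorm c)%:C * unitization_prod v v.
Proof.
move=> cpos; set M := rnorm c.
have [_ Mc] := bounded_opos (rnorm_ge0 c) cpos.1 (bounded_by_amul c).
have [w wE] := isadj_linear (wadj v); have [w' w'E] := isadj_linear (isadj_sym (wadj v)).
have := wadj v; have := wbounded v; rewrite wE w'E => wb ww'.
pose d := M%:C *: ((v.1 : R[i])^* *: v.2 + (v.1 : R[i]) *: star v.2
                   + amul (star v.2) v.2) - sandwich v c v.
have : opos (fun z => (M * rnorm (v.1 : R[i]) ^+ 2)%:C *: z + amul d z).
  apply: opos_ext (opos_conj Mc ww' wb) => z.
  rewrite -wE -w'E /wleft /wright /d /sandwich rmorphM /= rnorm_sqr.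
  by rewrite !amulE !amulA; lincomb R; ring.
move=> /om_ge0 pos; rewrite -subr_ge0; move: pos; congr (0 <= _).
rewrite /d omD omN omZ !omD !omZ /unitization_prod rmorphM /= rnorm_sqr.
ring.
Qed.

Definition gns_space : hilbertType R := completion unitization_form.

Let kap v : gns_space := cmap unitization_form v.

Let kap_linear : linear kap. Proof. exact: cmap_linear. Qed.

Let kapl : {linear unitization -> gns_space} :=
  HB.pack_for {linear unitization -> gns_space} kap
    (GRing.isLinear.Build _ _ _ _ kap kap_linear).

Let kap_dense h (e : R) : 0 < e -> exists v, rnorm (h - kapl v) <= e.
Proof. exact: cmap_dense. Qed.

Let kap_inner v w : inner (kapl v) (kapl w) = unitization_prod v w.
Proof. exact: cinner_cmap. Qed.

Let kap_norm v : ((rnorm (kapl v)) ^+ 2)%:C = unitization_prod v v.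
Proof. by rewrite -innerE kap_inner. Qed.

(** The product [c v]; A is an ideal of its unitization, hence the scalar part 0. *)
Let pre c v : unitization := (0, (v.1 : R[i]) *: c + amul c v.2).

(** [|c v|^2 = om (v* c* c v) <= |c|^2 |v|^2], so that [v |-> c v] extends from the dense image of
    the unitization. *)
Let gns_rep_ex c : exists G : {linear gns_space -> gns_space},
  (forall v, G (kapl v) = kapl (pre c v)) /\
  (forall h, rnorm (G h) <= rnorm c * rnorm h).
Proof.
pose g v := kapl (pre c v).
have g_lin : linear g.
  move=> k v w; rewrite /g -linearP; congr (kapl _); rewrite /pre.
  congr (_, _) => /=; first by rewrite scaler0 addr0.
  rewrite !amulE -[k *: v.1]/(k * (v.1 : R[i])).
  by lincomb R; ring.
pose gl : {linear unitization -> gns_space} :=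
  HB.pack_for {linear unitization -> gns_space} g
    (GRing.isLinear.Build _ _ _ _ g g_lin).
apply: (@bounded_extension R unitization _ _ kapl gl) => [|v|h e e0].
- exact: rnorm_ge0.
- rewrite -ler_sqr ?nnegrE ?mulr_ge0 ?rnorm_ge0 // exprMn -rnorm_cstar.
  rewrite -[gl v]/(kapl (pre c v)) -lecR [leRHS]rmorphM /= !kap_norm.
  apply: le_trans (sandwich_le v _).
    rewrite le_eqVlt; apply/orP; left; apply/eqP.
    rewrite /unitization_prod /= rmorph0 !mul0r !add0r; congr (om _ : R[i]).
    rewrite /sandwich !starE !star_amul !amulE !amulA; lincomb R; ring.
  by apply: opos_apositive; exists c.
- exact: kap_dense.
Qed.

Let grep c : {linear gns_space -> gns_space} := projT1 (cid (gns_rep_ex c)).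

Let grepE c v : grep c (kapl v) = kapl (pre c v).
Proof. exact: (projT2 (cid (gns_rep_ex c))).1. Qed.

Let grepM c h : rnorm (grep c h) <= rnorm c * rnorm h.
Proof. exact: (projT2 (cid (gns_rep_ex c))).2. Qed.

Lemma gns_representation : exists pi : representation A gns_space,
  forall c v, pi c (kapl v) = kapl (pre c v).
Proof.
have cont c : continuous (grep c).
  exact: bounded_linear_continuous (rnorm_ge0 c) (grepM c).
have lin (k : R[i]) a b h : grep (k *: a + b) h = k *: grep a h + grep b h.
  apply/eqP; rewrite -subr_eq0; apply/eqP.
  pose phi h := grep (k *: a + b) h - (k *: grep a h + grep b h).
  pose M := rnorm (k *: a + b) + (rnorm k * rnorm a + rnorm b).
  apply: (dense_zero (phi := phi) (M := M) _ _ _ kap_dense) h.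
  - by rewrite !addr_ge0 ?mulr_ge0 ?rnorm_ge0.
  - by move=> h h'; rewrite /phi !linearB /=; lincomb R; ring.
  - move=> h; apply: le_trans (rnormB _ _) _; rewrite mulrDl; apply: lerD => //.
    apply: le_trans (rnormD _ _) _; rewrite mulrDl rnormZ -mulrA.
    by apply: lerD => //; rewrite ler_wpM2l ?rnorm_ge0.
  - move=> v; rewrite /phi !grepE -linearP /=; apply/eqP; rewrite subr_eq0.
    apply/eqP; congr (kapl _); rewrite /pre; congr (_, _) => /=.
      by rewrite scaler0 addr0.
    by rewrite !amulE; lincomb R; ring.
have mul a b h : grep (amul a b) h = grep a (grep b h).
  apply/eqP; rewrite -subr_eq0; apply/eqP.
  pose phi h := grep (amul a b) h - grep a (grep b h).
  pose M := rnorm (amul a b) + rnorm a * rnorm b.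
  apply: (dense_zero (phi := phi) (M := M) _ _ _ kap_dense) h.
  - by rewrite !addr_ge0 ?mulr_ge0 ?rnorm_ge0.
  - by move=> h h'; rewrite /phi !linearB /=; lincomb R; ring.
  - move=> h; apply: le_trans (rnormB _ _) _; rewrite mulrDl; apply: lerD => //.
    by apply: le_trans (grepM _ _) _; rewrite -mulrA ler_wpM2l ?rnorm_ge0.
  - move=> v; rewrite /phi !grepE; apply/eqP; rewrite subr_eq0.
    apply/eqP; congr (kapl _); rewrite /pre /=; congr (_, _).
    by rewrite scale0r add0r !amulE amulA.
have adj a h h' : inner (grep (star a) h) h' = inner h (grep a h').
  apply/eqP; rewrite -subr_eq0; apply/eqP.
  pose phi h h' : R[i]^o := inner (grep (star a) h) h' - inner h (grep a h').
  have phi_le u u' : rnorm (phi u u') <= 2 * rnorm a * rnorm u * rnorm u'.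
    apply: le_trans (rnormB (_ : R[i]) _) _.
    have := inner_CS (grep (star a) u) u'; have := inner_CS u (grep a u').
    have := grepM (star a) u; have := grepM a u'; rewrite rnorm_star.
    have := rnorm_ge0 u; have := rnorm_ge0 u'; have := rnorm_ge0 a; nra.
  have phi0 v u' : phi (kapl v) u' = 0.
    apply: (dense_zero (phi := phi (kapl v)) (M := 2 * rnorm a * rnorm (kapl v)) _ _ _ kap_dense) u'.
    - by rewrite !mulr_ge0 ?rnorm_ge0.
    - by move=> u u'; rewrite /phi linearB /= !innerBr; lincomb R; ring.
    - by move=> u; exact: phi_le.
    - move=> w; rewrite /phi !grepE !kap_inner /unitization_prod /pre /=.
      rewrite rmorph0 !mul0r !add0r !(starE, amulE, omD, omZ, starK, star_amul).
      by rewrite mulr0 add0r amulA; apply/eqP; rewrite subr_eq0; apply/eqP; ring.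
  apply: (dense_zero (phi := fun u => phi u h') (M := 2 * rnorm a * rnorm h') _ _ _ kap_dense) h.
  - by rewrite !mulr_ge0 ?rnorm_ge0.
  - by move=> u u'; rewrite /phi linearB /= !innerBl; lincomb R; ring.
  - by move=> u; apply: le_trans (phi_le u h') _; rewrite mulrAC.
  - by move=> v; exact: phi0.
by exists (@Representation R A gns_space grep cont lin mul adj) => c v; exact: grepE.
Qed.

Let om_ge0' a : opos (amul a) -> 0 <= (om a : R[i]).
Proof.
move=> apos; have := om_ge0 (lam := 0) (a := a); rewrite rmorph0 add0r; apply.
by apply: opos_ext apos => z; rewrite scale0r add0r.
Qed.

Local Notation tensor_space := (functional_space E omJ om_ge0').

Section Tensors.
Context (iota : {linear E -> tensor_space}).
Hypothesis iota_in : forall x y, inner (iota x) (iota y) = om (mip x y).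
Hypothesis iota_de : forall h (e : R), 0 < e -> exists x, rnorm (h - iota x) <= e.

(** E is a right module over the unitization, with [<x v, y w> = v* <x, y> w]. *)
Let act x v : E := (v.1 : R[i]) *: x + ract x v.2.

Let act_mip x y v w : mip (act x v) (act y w) = sandwich v (mip x y) w.
Proof.
rewrite /act /sandwich !mipE !mip_ract !mip_ractl !amulA.
by lincomb R; ring.
Qed.

Let prod_pre v c w : unitization_prod v (pre c w) = om (sandwich v c w).
Proof.
rewrite /unitization_prod /pre /sandwich /= !mulr0 !mul0r !add0r.
by rewrite !amulE !omD !omZ; ring.
Qed.

Let actD x k v w : act x (k *: v + w) = k *: act x v + act x w.
Proof.
rewrite /act /= ract_linearr -[k *: v.1]/(k * (v.1 : R[i])).
by lincomb R; ring.
Qed.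

(** The tensor of [x] and [v] is realized as [iota (x v)], in the completion of E for [om], so that
    no further space is built; [<x v, x v> = v* <x, x> v] gives the bound [|x|]. *)
Let tens_ex x : exists G : {linear gns_space -> tensor_space},
  (forall v, G (kapl v) = iota (act x v)) /\
  (forall h, rnorm (G h) <= rnorm x * rnorm h).
Proof.
pose g v := iota (act x v).
have g_lin : linear g by move=> k v w; rewrite /g actD linearP.
pose gl : {linear unitization -> tensor_space} :=
  HB.pack_for {linear unitization -> tensor_space} g
    (GRing.isLinear.Build _ _ _ _ g g_lin).
apply: (@bounded_extension R unitization _ _ kapl gl) => [|v|h e e0].
- exact: rnorm_ge0.
- rewrite -ler_sqr ?nnegrE ?mulr_ge0 ?rnorm_ge0 // exprMn -rnorm_mip.
  rewrite -[gl v]/(iota (act x v)) -lecR [leRHS]rmorphM /= kap_norm -innerE.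
  by rewrite iota_in act_mip; exact/sandwich_le/opos_mip.
- exact: kap_dense.
Qed.

Let gtens x : {linear gns_space -> tensor_space} := projT1 (cid (tens_ex x)).

Let gtensE x v : gtens x (kapl v) = iota (act x v).
Proof. exact: (projT2 (cid (tens_ex x))).1. Qed.

Let gtensM x h : rnorm (gtens x h) <= rnorm x * rnorm h.
Proof. exact: (projT2 (cid (tens_ex x))).2. Qed.

Let kap1 : unitization := (1, 0).

Let act1 x : act x kap1 = x.
Proof. by rewrite /act /= ract0r scale1r addr0. Qed.

Let gtens_iota x : gtens x (kapl kap1) = iota x.
Proof. by rewrite gtensE act1. Qed.

(** Tensoring with the cyclic vector [kap1] is [iota], so the localization contains the image of the
    graph. Conversely, [h] is approximated by some [v] in the unitization, and [(x v, y v)] stays in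
    the graph. *)
Lemma gns_tensor_ex : exists (pi : representation A gns_space)
  (K : interior_tensor E pi) (io : {linear E -> it_space K}),
  (forall x y, inner (io x) (io y) = om (mip x y)) /\
  forall T : set (E * E),
    T 0 -> (forall (k : R[i]) (p q : E * E), T p -> T q -> T (k *: p + q)) ->
    (forall x y (a : A), T (x, y) -> T (ract x a, ract y a)) ->
    rep_localization K T = closure [set (io xy.1, io xy.2) | xy in T].
Proof.
have [pi piE] := gns_representation.
have tlinl h (k : R[i]) x y : gtens (k *: x + y) h = k *: gtens x h + gtens y h.
  apply/eqP; rewrite -subr_eq0; apply/eqP.
  pose phi h := gtens (k *: x + y) h - (k *: gtens x h + gtens y h).
  pose M := rnorm (k *: x + y) + (rnorm k * rnorm x + rnorm y).
  apply: (dense_zero (phi := phi) (M := M) _ _ _ kap_dense) h.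
  - by rewrite !addr_ge0 ?mulr_ge0 ?rnorm_ge0.
  - by move=> h h'; rewrite /phi !linearB /=; lincomb R; ring.
  - move=> h; apply: le_trans (rnormB _ _) _; rewrite mulrDl; apply: lerD => //.
    apply: le_trans (rnormD _ _) _; rewrite mulrDl rnormZ -mulrA.
    by apply: lerD => //; rewrite ler_wpM2l ?rnorm_ge0.
  - move=> v; rewrite /phi !gtensE -linearP /=; apply/eqP; rewrite subr_eq0.
    apply/eqP; congr (iota _); rewrite /act ract_linearl; lincomb R; ring.
have tlinr x (k : R[i]) h h' : gtens x (k *: h + h') = k *: gtens x h + gtens x h'.
  exact: linearP.
have tbal x a h : gtens (ract x a) h = gtens x (pi a h).
  apply/eqP; rewrite -subr_eq0; apply/eqP.
  pose phi h := gtens (ract x a) h - gtens x (pi a h).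
  pose M := rnorm (ract x a) + rnorm x * rnorm a.
  apply: (dense_zero (phi := phi) (M := M) _ _ _ kap_dense) h.
  - by rewrite !addr_ge0 ?mulr_ge0 ?rnorm_ge0.
  - by move=> h h'; rewrite /phi !linearB /=; lincomb R; ring.
  - move=> h; apply: le_trans (rnormB _ _) _; rewrite mulrDl; apply: lerD => //.
    apply: le_trans (gtensM _ _) _; rewrite -mulrA ler_wpM2l ?rnorm_ge0 //.
    exact: rep_contractive.
  - move=> v; rewrite /phi piE !gtensE; apply/eqP; rewrite subr_eq0.
    apply/eqP; congr (iota _); rewrite /act /pre /= scale0r add0r ractA.
    by rewrite ract_linearr.
have tin x h x' h' : inner (gtens x h) (gtens x' h') = inner h (pi (mip x x') h').
  apply/eqP; rewrite -subr_eq0; apply/eqP; set c := mip x x'.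
  pose phi h h' : R[i]^o := inner (gtens x h) (gtens x' h') - inner h (pi c h').
  pose M := rnorm x * rnorm x' + rnorm c.
  have M0 : 0 <= M by rewrite addr_ge0 ?mulr_ge0 ?rnorm_ge0.
  have phi_le u u' : rnorm (phi u u') <= M * rnorm u * rnorm u'.
    apply: le_trans (rnormB (_ : R[i]) _) _; rewrite /M !mulrDl; apply: lerD.
      apply: le_trans (inner_CS _ _) _.
      apply: le_trans (ler_pM (rnorm_ge0 _) (rnorm_ge0 _) (gtensM x u) (gtensM x' u')) _.
      by rewrite le_eqVlt; apply/orP; left; apply/eqP; ring.
    apply: le_trans (inner_CS _ _) _; rewrite [rnorm c * _]mulrC -mulrA.
    by rewrite ler_wpM2l ?rnorm_ge0 // rep_contractive.
  have phi0 v u' : phi (kapl v) u' = 0.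
    apply: (dense_zero (phi := phi (kapl v)) (M := M * rnorm (kapl v)) _ _ _ kap_dense) u'.
    - by rewrite mulr_ge0 ?rnorm_ge0.
    - by move=> u u'; rewrite /phi !linearB /= !innerBr; lincomb R; ring.
    - by move=> u; exact: phi_le.
    - move=> w; rewrite /phi !gtensE piE iota_in kap_inner act_mip prod_pre.
      by rewrite subrr.
  apply: (dense_zero (phi := fun u => phi u h') (M := M * rnorm h') _ _ _ kap_dense) h.
  - by rewrite mulr_ge0 ?rnorm_ge0.
  - by move=> u u'; rewrite /phi linearB /= !innerBl; lincomb R; ring.
  - by move=> u; apply: le_trans (phi_le u h') _; rewrite mulrAC.
  - by move=> v; exact: phi0.
have tde : dense (finite_sums [set gtens x h | x in setT & h in setT] : set tensor_space).
  apply/dense_rnormP => h e e0; have [x hx] := iota_de h e0; exists (iota x) => //.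
  apply: finite_sums_sub; exists x => //; exists (kapl kap1) => //.
pose K := @InteriorTensor R A E gns_space pi tensor_space (fun x => gtens x)
  tlinl tlinr tbal tin tde.
exists pi, K, iota; split=> // T T0 TD Tract; apply/seteqP; split; last first.
  apply: closure_subset => _ [[x y] Txy <-]; apply: finite_sums_sub.
  by exists (x, y) => //; exists (kapl kap1) => //=; rewrite !gtens_iota.
set S := [set _ | _ in T].
suff : rep_localization0 K T `<=` closure S.
  move=> /closure_subset; rewrite -[closure (closure S)]((closure_id _).1 _) //.
  exact: closed_closure.
have S0 : closure S 0.
  by apply: subset_closure; exists 0 => //=; rewrite linear0.
have SD (u v : tensor_space * tensor_space) : closure S u -> closure S v -> closure S (u + v).
  move=> /closure_rnormP Su /closure_rnormP Sv; apply/closure_rnormP => e e0.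
  have e20 : 0 < e / 2 by rewrite divr_gt0.
  have [_ [[[x y] Txy <-] /= u1 u2]] := Su _ e20.
  have [_ [[[x' y'] Txy' <-] /= v1 v2]] := Sv _ e20.
  exists (iota (x + x'), iota (y + y')); split=> /=.
  - exists (x + x', y + y') => //.
    by have := TD 1 _ _ Txy Txy'; rewrite scale1r.
  - rewrite linearD opprD addrACA (splitr e).
    by apply: le_trans (rnormD _ _) _; exact: lerD.
  - rewrite linearD opprD addrACA (splitr e).
    by apply: le_trans (rnormD _ _) _; exact: lerD.
apply: finite_sums_ind => // _ [[x y] Txy [h _ <-]] /=.
apply/closure_rnormP => e e0 /=; pose M := rnorm x + rnorm y.
have M0 : 0 <= M by rewrite addr_ge0 ?rnorm_ge0.
have e'0 : 0 < e / (M + 1) by rewrite divr_gt0 // ltr_wpDl.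
have [v hv] := kap_dense h e'0.
have le_e (z : E) : rnorm z <= M -> rnorm (gtens z h - iota (act z v)) <= e.
  move=> zM; rewrite -gtensE -linearB; apply: le_trans (gtensM _ _) _.
  apply: le_trans (ler_div_succ (ltW e0) M0); rewrite mulrC.
  by apply: ler_pM; rewrite ?rnorm_ge0.
exists (iota (act x v), iota (act y v)); split=> /=.
- exists (act x v, act y v) => //; exact: (TD v.1 _ _ Txy (Tract x y v.2 Txy)).
- by apply: le_e; rewrite lerDl rnorm_ge0.
- by apply: le_e; rewrite lerDr rnorm_ge0.
Qed.

End Tensors.

Lemma gns_tensor : exists (pi : representation A gns_space)
  (K : interior_tensor E pi) (io : {linear E -> it_space K}),
  (forall x y, inner (io x) (io y) = om (mip x y)) /\
  forall T : set (E * E),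
    T 0 -> (forall (k : R[i]) (p q : E * E), T p -> T q -> T (k *: p + q)) ->
    (forall x y (a : A), T (x, y) -> T (ract x a, ract y a)) ->
    rep_localization K T = closure [set (io xy.1, io xy.2) | xy in T].
Proof.
have [iota [iota_in iota_de]] := functional_iota E omJ om_ge0'.
exact: gns_tensor_ex iota_in iota_de.
Qed.

End GNS.

(** * Separation in a localization, and the two equivalences *)

Section Separation.
Context (R : realType) (A : cstarAlgType R) (E : hilbertModType A).
Implicit Types (L T : set (E * E)) (e d r : R).

Definition far (M : normedModType R[i]) (S : set (M * M)) (u : M * M) r :=
  forall l, S l -> ~ (rnorm (u.1 - l.1) <= r /\ rnorm (u.2 - l.2) <= r).

Definition graph_image (M : Type) (io : E -> M) T : set (M * M) :=
  [set (io xy.1, io xy.2) | xy in T].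

Definition subspace_of L := L 0 /\
  forall (k : R[i]) (u l : E * E), L u -> L l -> L (k *: u + l).

(** If [u - l] is longer than [e] in one coordinate, then [<u - l, u - l>] has norm at least [e^2],
    whence [d]. These elements are selfadjoint, so complexifying the functional keeps its values on
    them. *)
Lemma separating_positive_functional L u e : subspace_of L -> 0 < e -> far L u e ->
  exists (om : {linear A -> R[i]^o}) d, [/\ 0 < d,
    (forall a, om (star a) = (om a : R[i])^*),
    (forall lam a, opos (fun z => lam%:C *: z + amul a z) ->
      0 <= lam%:C + (om a : R[i])),
    (forall a, rnorm (om a : R[i]) <= 2 * rnorm a) &
    (forall l, L l -> d%:C <= (om (mip2 (u - l)) : R[i]))].
Proof.
move=> [L0 LDZ] e0 Lfar; have e2 : 0 < e ^+ 2 by rewrite exprn_gt0.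
have Lsep : separated L u (e ^+ 2).
  move=> l Ll; rewrite leNgt; apply/negP => lt_e; apply: (Lfar l Ll).
  split; rewrite -ler_sqr ?nnegrE ?rnorm_ge0 ?(ltW e0) //.
    exact: le_trans (rnorm_mip2_1 (u - l)) (ltW lt_e).
  exact: le_trans (rnorm_mip2_2 (u - l)) (ltW lt_e).
have LD l l' : L l -> L l' -> L (l + l').
  by move=> Ll Ll'; have := LDZ 1 _ _ Ll Ll'; rewrite scale1r.
have LZ t l : L l -> L (t%:C *: l).
  by move=> Ll; have := LDZ t%:C _ _ Ll L0; rewrite addr0.
have [f [flin f_le f_pos fd]] := separating_functional L0 LD LZ e2 Lsep.
have [om [omJ om_ge0 om_sa om_le]] := complexified_functional flin f_le f_pos.
exists om, (e ^+ 2); split=> // l Ll.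
rewrite om_sa ?lecR; first exact: fd.
by rewrite /mip2 starD -!mip_star.
Qed.

Lemma image_far (H : hilbertType R) (io : {linear E -> H}) (om : E -> R[i]) L u d :
  (forall x, inner (io x) (io x) = om x) -> 0 < d ->
  (forall l, L l -> d%:C <= om (u - l).1 + om (u - l).2) ->
  exists2 r, 0 < r & far (graph_image io L) (io u.1, io u.2) r.
Proof.
(* [r <= 1] and [r <= d / 4] give [r^2 + r^2 <= d / 2 < d]. *)
move=> ioE d0 Ld; exists (Num.min 1 (d / 4)).
  by rewrite lt_min ltr01 divr_gt0.
move=> _ [l Ll <-] /=; set r := Num.min _ _ => -[].
rewrite -!linearB => r1 r2; have := Ld l Ll.
rewrite -!ioE !innerE -rmorphD lecR leNgt => /negP; apply.
have r_le1 : r <= 1 by rewrite ge_min lexx.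
have r_led : r <= d / 4 by rewrite ge_min lexx orbT.
have := rnorm_ge0 (io (u - l).1); have := rnorm_ge0 (io (u - l).2).
move: (rnorm _) (rnorm _) r1 r2 => a b r1 r2 a0 b0; nra.
Qed.

Lemma state_separation L u e : subspace_of L -> 0 < e -> far L u e ->
  exists (omega : state A) (K : state_space E omega),
    exists2 r, 0 < r & far (graph_image (iota_st K) L) (iota_st K u.1, iota_st K u.2) r.
Proof.
move=> Lsub e0 Lfar.
have [om [d [d0 omJ om_pos om_le omd]]] :=
  separating_positive_functional Lsub e0 Lfar.
have om_ge0 a : opos (amul a) -> 0 <= (om a : R[i]).
  move=> apos; have := om_pos 0 a; rewrite rmorph0 add0r; apply.
  by apply: opos_ext apos => z; rewrite scale0r add0r.
have om_neq0 : exists a, om a != 0 :> R[i].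
  exists (mip2 (u - 0)); apply: contraTneq (omd 0 Lsub.1) => /= ->.
  by rewrite lecR -ltNge.
have [omega [N [N0 omE]]] := state_normalization om_ge0 om_neq0 om_le.
have omegaE a : (omega a : R[i]) = N^-1%:C * (om a : R[i]).
  by rewrite omE mulrA -rmorphM mulVf ?gt_eqF // mul1r.
have omegaJ a : omega (star a) = (omega a : R[i])^*.
  by rewrite !omegaE rmorphM /= conj_real_complex omJ.
have omega_ge0 a : opos (amul a) -> 0 <= (omega a : R[i]).
  by move=> apos; rewrite omegaE mulr_ge0 ?om_ge0 // ler0c invr_ge0 ltW.
have [io [io_in io_de]] := functional_iota E omegaJ omega_ge0.
have io_dense : dense (range io).
  apply/dense_rnormP => h r r0; have [x hx] := io_de h r r0.
  by exists (io x) => //; exists x.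
exists omega, (@StateSpace R A E omega _ io io_in io_dense) => /=.
apply: (image_far (om := fun x => omega (mip x x)) (d := N^-1 * d)) => //.
  by rewrite mulr_gt0 ?invr_gt0.
move=> l Ll; rewrite !omegaE -mulrDr rmorphM /= ler_pM2l ?ltcR ?invr_gt0 //.
by have := omd l Ll; rewrite [om _]linearD.
Qed.

Lemma rep_separation L u e : subspace_of L -> 0 < e -> far L u e ->
  exists (H : hilbertType R) (pi : representation A H)
    (K : interior_tensor E pi) (io : {linear E -> it_space K}),
    (forall T, subspace_of T ->
      (forall x y (a : A), T (x, y) -> T (ract x a, ract y a)) ->
      rep_localization K T = closure (graph_image io T)) /\
    exists2 r, 0 < r & far (graph_image io L) (io u.1, io u.2) r.
Proof.
move=> Lsub e0 Lfar.
have [om [d [d0 omJ om_pos om_le omd]]] :=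
  separating_positive_functional Lsub e0 Lfar.
have [pi [K [io [io_in locE]]]] := gns_tensor E omJ om_pos.
exists _, pi, K, io; split=> [T [T0 TD] Tract|]; first exact: locE.
apply: (image_far (om := fun x => om (mip x x)) (d := d)) => // l Ll.
by have := omd l Ll; rewrite [om _]linearD.
Qed.

Definition rotated_sum T T' : set (E * E) :=
  [set l | exists x w y z, [/\ T (x, w), T' (y, z) & l = (x + z, w - y)]].

Lemma rotated_sum_subspace T T' : subspace_of T -> subspace_of T' ->
  subspace_of (rotated_sum T T').
Proof.
move=> [T0 TD] [T'0 T'D]; split; first by exists 0, 0, 0, 0; split; rewrite ?addr0 ?subr0.
move=> k _ _ [x1 [w1 [y1 [z1 [T1 T1' ->]]]]] [x2 [w2 [y2 [z2 [T2 T2' ->]]]]].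
exists (k *: x1 + x2), (k *: w1 + w2), (k *: y1 + y2), (k *: z1 + z2); split.
- exact: TD T1 T2.
- exact: T'D T1' T2'.
- by congr (_, _) => /=; lincomb R; ring.
Qed.

Lemma not_complementary_far T T' : ~ complementary T T' ->
  exists u e, 0 < e /\ far (rotated_sum T T') u e.
Proof.
move=> Tcomp; apply: contrapT => nfar; apply: Tcomp => p q e e0.
apply: contrapT => nex; apply: nfar; exists (p, q), e; split=> // l.
move=> [x [w [y [z [Txw Tyz ->]]]]] [/= e1 e2]; apply: nex.
by exists x, w, y, z.
Qed.

(** The two graphs decompose [H + H], so that the image of the span is dense and cannot stay away
    from a point. *)
Lemma image_not_far (H : hilbertType R) (io : {linear E -> H}) T T' u r :
  subspace_of T -> closure (graph_image io T') = hadjoint (closure (graph_image io T)) ->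
  0 < r -> ~ far (graph_image io (rotated_sum T T')) (io u.1, io u.2) r.
Proof.
move=> [T0 TD] adj r0 Lfar.
have img0 : graph_image io T 0 by exists 0 => //=; rewrite linear0.
have imgDZ (k : R[i]) v w : graph_image io T v -> graph_image io T w -> graph_image io T (k *: v + w).
  move=> [v' Tv <-] [w' Tw <-]; exists (k *: v' + w'); first exact: TD.
  by rewrite /= !linearP.
have imgD v w : graph_image io T v -> graph_image io T w -> graph_image io T (v + w).
  by move=> Tv Tw; have := imgDZ 1 _ _ Tv Tw; rewrite scale1r.
have imgZ (k : R[i]) v : graph_image io T v -> graph_image io T (k *: v).
  by move=> Tv; have := imgDZ k _ _ Tv img0; rewrite addr0.
have [_ [_ [_ [_ [[[x w] Txw [<- <-]] [[y z] Tyz [<- <-]] e1 e2]]]]] :=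
  complementary_hadjoint img0 imgD imgZ adj (io u.1) (io u.2) r0.
apply: (Lfar (io (x + z), io (w - y))).
  by exists (x + z, w - y) => //; exists x, w, y, z.
by rewrite /= linearD linearB.
Qed.

Lemma madjoint_subspace T : subspace_of (madjoint T).
Proof. by split; [exact: madjoint0|move=> k u l; exact: madjointD]. Qed.

Lemma semiregular_subspace T : semiregular T -> subspace_of T.
Proof.
move=> Tsemi; split; first exact: semiregular0.
by move=> k u l; exact: semiregularD.
Qed.

Lemma closed_far T u : closed T -> ~ T u -> exists2 e, 0 < e & far T u e.
Proof.
move=> Tclosed nTu; apply: contrapT => nfar; apply: nTu.
apply: (closed_rnormP Tclosed) => e e0; apply: contrapT => nex; apply: nfar.
by exists e => // l Tl [e1 e2]; apply: nex; exists l.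
Qed.

Lemma closure_not_far (H : hilbertType R) (S : set (H * H)) u r :
  closure S u -> 0 < r -> ~ far S u r.
Proof.
move=> /closure_rnormP Su r0 Sfar; have [l [Sl e1 e2]] := Su r r0.
exact: (Sfar l Sl).
Qed.

Lemma symmetric_semiregular T : densely_defined T -> msymmetric T -> semiregular T.
Proof.
move=> Tdd Tsym; split=> //; have [_ _ Tdense] := Tdd.
apply/dense_rnormP => x e e0; have /dense_rnormP Td := Tdense.
by have [y [z Tyz] xy] := Td x e e0; exists y => //; exists z; exact: Tsym.
Qed.

Lemma state_localizations_regular T : semiregular T -> closed T ->
  (forall (omega : state A) (K : state_space E omega),
    state_localization K (madjoint T) = hadjoint (state_localization K T)) ->
  regular T.
Proof.
move=> Tsemi Tclosed loc; apply: complementary_regular => //.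
apply: contrapT => /not_complementary_far[u [e [e0 Lfar]]].
have Tsub := semiregular_subspace Tsemi.
have Lsub := rotated_sum_subspace Tsub (madjoint_subspace T).
have [omega [K [r r0]]] := state_separation Lsub e0 Lfar.
exact: image_not_far (loc omega K) r0.
Qed.

Lemma rep_localizations_regular T : semiregular T -> closed T ->
  (forall (H : hilbertType R) (pi : representation A H) (K : interior_tensor E pi),
    rep_localization K (madjoint T) = hadjoint (rep_localization K T)) ->
  regular T.
Proof.
move=> Tsemi Tclosed loc; apply: complementary_regular => //.
apply: contrapT => /not_complementary_far[u [e [e0 Lfar]]].
have Tsub := semiregular_subspace Tsemi.
have Lsub := rotated_sum_subspace Tsub (madjoint_subspace T).
have [H [pi [K [io [locE [r r0]]]]]] := rep_separation Lsub e0 Lfar.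
apply: image_not_far r0 => //.
rewrite -!locE //; first exact: loc.
- exact: semiregular_ract.
- exact: madjoint_subspace.
- by move=> x y a; exact: madjoint_ract.
Qed.

(** The closure of [G'] lies between that of [G] and its adjoint, which are equal. With [G] and [G']
    coming from [T] and [T*], this reduces regularity in the symmetric case to the first
    equivalence. *)
Lemma selfadjoint_localization (H : hilbertType R) (G G' : set (H * H)) :
  G `<=` G' -> G' `<=` hadjoint G -> hselfadjoint (closure G) ->
  closure G' = closure G.
Proof.
move=> GG' G'adj Gsa; apply/seteqP; split=> [u|]; last exact: closure_subset.
move=> /(closure_subset G'adj)/closure_hadjoint/hadjoint_closure.
by rewrite -Gsa.
Qed.

Lemma rep_localization_symmetric T (H : hilbertType R) (pi : representation A H)
    (K : interior_tensor E pi) : msymmetric T ->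
  hselfadjoint (rep_localization K T) ->
  rep_localization K (madjoint T) = rep_localization K T.
Proof.
move=> Tsym; apply: selfadjoint_localization; last exact: rep_localization_madjoint.
move=> _ [n [s [sP ->]]]; exists n, s; split=> // i.
by have [[x y] Txy hP] := sP i; exists (x, y) => //; exact: Tsym.
Qed.

Lemma state_localization_symmetric T (omega : state A) (K : state_space E omega) :
  msymmetric T -> hselfadjoint (state_localization K T) ->
  state_localization K (madjoint T) = state_localization K T.
Proof.
move=> Tsym; apply: selfadjoint_localization; last exact: state_localization_madjoint.
by move=> _ [[x y] Txy <-]; exists (x, y) => //; exact: Tsym.
Qed.

(** A point of [T*] outside the closed graph of [T] would stay away from it in some localization,
    where however both graphs have the same closure. *)
Lemma state_localizations_selfadjoint T : semiregular T -> closed T ->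
  msymmetric T -> (forall (omega : state A) (K : state_space E omega),
    hselfadjoint (state_localization K T)) ->
  mselfadjoint T /\ regular T.
Proof.
move=> Tsemi Tclosed Tsym loc; split; last first.
  apply: state_localizations_regular => // omega K.
  by rewrite state_localization_symmetric //; exact: loc.
apply/seteqP; split=> // u Tu; apply: contrapT => /(closed_far Tclosed)[e e0 Tfar].
have Tsub := semiregular_subspace Tsemi.
have [omega [K [r r0]]] := state_separation Tsub e0 Tfar.
apply: closure_not_far r0.
have := state_localization_symmetric Tsym (loc omega K).
rewrite /state_localization => <-; apply: subset_closure; by exists u.
Qed.

Lemma rep_localizations_selfadjoint T : semiregular T -> closed T ->
  msymmetric T ->
  (forall (H : hilbertType R) (pi : representation A H) (K : interior_tensor E pi),
    hselfadjoint (rep_localization K T)) ->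
  mselfadjoint T /\ regular T.
Proof.
move=> Tsemi Tclosed Tsym loc; split; last first.
  apply: rep_localizations_regular => // H pi K.
  by rewrite rep_localization_symmetric //; exact: loc.
apply/seteqP; split=> // u Tu; apply: contrapT => /(closed_far Tclosed)[e e0 Tfar].
have Tsub := semiregular_subspace Tsemi.
have [H [pi [K [io [locE [r r0]]]]]] := rep_separation Tsub e0 Tfar.
apply: closure_not_far r0; rewrite -locE //; last exact: semiregular_ract.
rewrite -(rep_localization_symmetric Tsym (loc H pi K)) locE.
- by apply: subset_closure; exists u.
- exact: madjoint_subspace.
- by move=> x y a; exact: madjoint_ract.
Qed.

End Separation.

Theorem theorem4p2 (R : realType) (A : cstarAlgType R) (E : hilbertModType A) :
  (forall T : set (E * E), semiregular T -> closed T ->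
    [<-> regular T;
         forall (H : hilbertType R) (pi : representation A H)
                (K : interior_tensor E pi),
           rep_localization K (madjoint T) = hadjoint (rep_localization K T);
         forall (omega : state A) (K : state_space E omega),
           state_localization K (madjoint T)
           = hadjoint (state_localization K T)])
  /\
  (forall T : set (E * E), densely_defined T -> closed T -> msymmetric T ->
    [<-> mselfadjoint T /\ regular T;
         forall (H : hilbertType R) (pi : representation A H)
                (K : interior_tensor E pi),
           hselfadjoint (rep_localization K T);
         forall (omega : state A) (K : state_space E omega),
           hselfadjoint (state_localization K T)]).
Proof.
split=> [T Tsemi Tclosed|T Tdd Tclosed Tsym].
  tfae.
  - move=> /regular_complementary Tcomp H pi K.
    exact: rep_localization_regular.
  (* The implication passes through regularity: the representation attached to a separating
     functional yields it, and the density of the span then descends to every state. *)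
  - move=> /(rep_localizations_regular Tsemi Tclosed)/regular_complementary Tcomp.
    by move=> omega K; exact: state_localization_regular.
  - exact: state_localizations_regular.
have Tsemi := symmetric_semiregular Tdd Tsym.
tfae.
- move=> [Tsa /regular_complementary Tcomp] H pi K.
  by rewrite /hselfadjoint -(rep_localization_regular K Tcomp) -Tsa.
- move=> /(rep_localizations_selfadjoint Tsemi Tclosed Tsym)[Tsa].
  move=> /regular_complementary Tcomp omega K.
  by rewrite /hselfadjoint -(state_localization_regular K Tcomp) -Tsa.
- exact: state_localizations_selfadjoint.
Qed.
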